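(* Consider a sequence of gated processor sharing queueing models indexed by $r$ (with $r>0$ ranging over a sequence tending to infinity), each defined as in the context, with fluid scaled primitives $\bar{\mathcal{E}}^r(\cdot)$, $\bar{\mathcal{B}}^r_0$ and fluid scaled state descriptors $(\bar\sigma^r(\cdot),\bar\mu^r(\cdot))$. Let $\alpha>0$ and let $\nu$ be a probability measure on $\mathbb{R}_+$ with no atoms and finite mean $\langle\chi,\nu\rangle=1/\alpha$. Assume that, as $r\to\infty$: (i) $\alpha^r\to\alpha$, $\nu^r\to\nu$ in $\mathcal{M}_1$, and $\langle\chi,\nu^r\rangle\to\langle\chi,\nu\rangle$; (ii) $\bar{\mathcal{E}}^r(\cdot)\Rightarrow \alpha(\cdot)\nu$ in $\mathbf{D}([0,\infty),\mathcal{M}_1)$ (uniformly on compact time intervals), where $\alpha(t)=\alpha t$ for $t\ge0$; (iii) for some random $\mathcal{B}_0\in\mathcal{M}_1$ that almost surely has no atoms, with $W_0=\langle\chi,\mathcal{B}_0\rangle<\infty$, one has $\bar{\mathcal{B}}^r_0\Rightarrow\mathcal{B}_0$ in $\mathcal{M}_1$ and $\mathbb{E}^r[\langle\chi,\bar{\mathcal{B}}^r_0\rangle]\to\mathbb{E}[W_0]$. Then, as $r\to\infty$, the sequence $\{(\bar\sigma^r(\cdot),\bar\mu^r(\cdot))\}$ converges in distribution on $\mathbf{D}([0,\infty),\mathcal{M}_1)^2$ to a limit $(\sigma(\cdot),\mu(\cdot))$ that is almost surely the fluid model path for $\alpha$, $\nu$, and initial condition $\mathcal{B}_0$.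
   Context: **Notation.** $\mathbb{R}_+=[0,\infty)$; $a^-=(-a)\vee 0$; $\chi$ is the identity function on $\mathbb{R}_+$ and $\chi_x=\chi\wedge x$; $\langle f,\zeta\rangle=\int_{\mathbb{R}_+} f\,d\zeta$; $\delta_v$ is the Dirac mass at $v$. For $w>0$, $\llbracket t\rrbracket_w=t-\lfloor t/w\rfloor w$, and $\llbracket t\rrbracket_0=0$. $\mathcal{M}_1$ is the space of finite non-negative Borel measures on $\mathbb{R}_+$ with finite first moment, with the Wasserstein$_1$ topology: $\zeta_n\to\zeta$ iff $\langle\chi,\zeta_n\rangle\to\langle\chi,\zeta\rangle$ and $\langle f,\zeta_n\rangle\to\langle f,\zeta\rangle$ for all bounded continuous $f$ on $\mathbb{R}_+$ (a Polish topology). $\mathbf{D}([0,\infty),\mathcal{M}_1)$ is the space of right-continuous paths with left limits, with the Skorohod $J_1$-topology. $\Rightarrow$ is convergence in distribution. For $\zeta\in\mathcal{M}_1$ and $x\ge0$, $\zeta(\cdot+_0x)$ is $\zeta$ shifted left by $x$ with any mass at or below zero removed: $\langle f,\zeta(\cdot+_0x)\rangle=\langle(1_{(0,\infty)}f)(\cdot-x),\zeta\rangle$ (functions extended by $0$ to $(-\infty,0)$). For $\zeta\in\mathcal{M}_1$ let $F_\zeta(x)=\langle\chi_x,\zeta\rangle$, $x\ge0$, and let $x^*$ be the supremum of the support of $\zeta$. $F_\zeta$ is continuous and strictly increasing on $[0,x^* )$, and $F_\zeta^{-1}$ denotes its inverse on $[0,\langle\chi,\zeta\rangle)$, extended to be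 constant equal to $x^*$ on $[\langle\chi,\zeta\rangle,\infty)$; if $\zeta=0$, $F_\zeta^{-1}\equiv0$. **Stochastic model.** (For each $r$; the superscript $r$ is attached to every object, and each model may live on its own probability space $(\Omega^r,\mathscr{F}^r,P^r)$ with expectation $\mathbb{E}^r$.) $E(\cdot)$ is a possibly delayed renewal process with finite arrival rate $\alpha^r$ and $E(0)=0$. Service times $\{v_i\}$ are i.i.d. with distribution $\nu^r$, a Borel probability measure on $\mathbb{R}_+$ with $\nu^r(\{0\})=0$ and finite mean. $Z_0$ is a $\mathbb{Z}_+$-valued random variable and $\{\tilde v_j\}$ are positive random variables with $\mathbb{E}[\sum_{j=1}^{Z_0}\tilde v_j]<\infty$. Set $\mathcal{B}_0=\sum_{j=1}^{Z_0}\delta_{\tilde v_j}$ and $\mathcal{E}(t)=\sum_{i=1}^{E(t)}\delta_{v_i}$. The workload is $W(t)=W(0)+\langle\chi,\mathcal{E}(t)\rangle-t+I(t)$, with $W(0)=\langle\chi,\mathcal{B}_0\rangle$ and $I(t)=\sup_{s\in[0,t]}(W(0)+\langle\chi,\mathcal{E}(s)\rangle-s)^-$. Batch start times: $\beta_0=0$ and $\beta_k=\inf\{s\ge\beta_{k-1}+W(\beta_{k-1}):W(s)>0\}$ for $k\ge1$. Batch profiles: $\mathcal{B}_k=\mathcal{E}(\beta_k)-\mathcal{E}(\beta_{k-1})$ for $k\ge1$. For $t\ge0$: $\beta(t)=\max\{\beta_k:\beta_k\le t\}$, $\ell(t)=\max\{j:\beta_j\le t\}$, $\mathcal{B}(t)=\mathcal{B}_{\ell(t)}$,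 $S(t)=F^{-1}_{\mathcal{B}(t)}(t-\beta(t))$. The state descriptor is the pair $$\sigma(t)=\mathcal{B}(t)(\cdot+_0S(t)),\qquad \mu(t)=\mathcal{E}(t)-\mathcal{E}(\beta(t)),\qquad t\ge0.$$ **Fluid scaling.** $\bar{\mathcal{E}}^r(t)=r^{-1}\mathcal{E}^r(rt)$, $\bar{\mathcal{B}}^r_0=r^{-1}\mathcal{B}^r_0$, $\bar\sigma^r(t)=r^{-1}\sigma^r(rt)$, $\bar\mu^r(t)=r^{-1}\mu^r(rt)$. **Fluid model path.** Let $\alpha>0$, let $\nu$ be a probability measure on $\mathbb{R}_+$ with $\nu(\{0\})=0$ and $\langle\chi,\nu\rangle=1/\alpha$, and let $\xi\in\mathcal{M}_1$ with $\xi(\{0\})=0$ and $w=\langle\chi,\xi\rangle<\infty$. The fluid model path for $\alpha$, $\nu$ and initial condition $\xi$ is the pair $(\sigma(\cdot),\mu(\cdot))\in\mathbf{D}([0,\infty),\mathcal{M}_1)^2$ given by $$\sigma(t)=\begin{cases}\xi\bigl(\cdot+_0F_\xi^{-1}(t)\bigr),& t\in[0,w),\\ (\alpha w\nu)\bigl(\cdot+_0F^{-1}_{\alpha w\nu}(\llbracket t\rrbracket_w)\bigr),& t\in[w,\infty),\end{cases}\qquad \mu(t)=\alpha\llbracket t\rrbracket_w\,\nu,\quad t\ge0.$$ If $\xi=0$ both paths are identically zero. *)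

(* Defs.v *)
From HB Require Import structures.
From mathcomp Require Import all_boot all_order all_algebra.
From mathcomp Require Import all_classical all_reals all_analysis.
From mathcomp Require Import measurable_realfun.

Set Implicit Arguments.
Unset Strict Implicit.
Unset Printing Implicit Defensive.
Import Order.TTheory GRing.Theory Num.Theory.
Import numFieldNormedType.Exports.
Local Open Scope classical_set_scope.
Local Open Scope ring_scope.

(* A Borel measure on R_+ is represented by a Borel measure on R that does not
   charge the negative half-line. *)
Record M1 (R : realType) := MkM1 {
  m1_measure :> {measure set R -> \bar R} ;
  m1_neg : m1_measure `]-oo, 0[%classic = 0%E ;
  m1_finite : (m1_measure setT < +oo)%E ;
  m1_moment : (\int[m1_measure]_(x in `[0%R, +oo[) x%:E < +oo)%E }.

HB.instance Definition _ (R : realType) := gen_eqMixin (M1 R).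
HB.instance Definition _ (R : realType) := gen_choiceMixin (M1 R).

Section wasserstein_topology.
Variable R : realType.

Definition pairing (f : R -> R) (z : M1 R) : R :=
  \int[z]_(x in `[0, +oo[) f x.

Definition first_moment : M1 R -> R := pairing id.

Definition w1_test : set (R -> R) :=
  [set f : R -> R | f = id \/
    {within `[0, +oo[%classic, continuous f} /\
    exists C : R, forall x, 0 <= x -> `|f x| <= C].

Definition w1_map (z : M1 R) : {ptws w1_test -> R} :=
  fun f => pairing (set_val f) z.

End wasserstein_topology.

(* The initial topology for the maps z |-> <chi, z> and z |-> <f, z>, with f
   bounded and continuous on R_+. Up to identification of set functions that agree
   on Borel sets, which it does not distinguish, it is metrizable, and its
   convergent sequences are those of the Wasserstein_1 topology. *)
HB.instance Definition _ (R : realType) :=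
  Uniform.copy (M1 R) (initial_topology (@w1_map R)).

Section measure_constructions.
Variable R : realType.

Let measurable_Rp : measurable (`[0, +oo[%classic : set R).
Proof. exact: measurable_itv. Qed.

Section scale.
Variables (c : R) (z : M1 R).
Let k : {nonneg R} := NngNum (normr_ge0 c).

Let neg : mscale k z `]-oo, 0[%classic = 0%E.
Proof. by rewrite /mscale m1_neg mule0. Qed.

Let fin : (mscale k z setT < +oo)%E.
Proof. by rewrite /mscale lte_mul_pinfty// m1_finite. Qed.

Let mom : (\int[mscale k z]_(x in `[0%R, +oo[) x%:E < +oo)%E.
Proof.
rewrite ge0_integral_mscale//.
- by rewrite lte_mul_pinfty// m1_moment.
- by move=> x /=; rewrite in_itv/= andbT lee_fin.
Qed.

(* Used for c >= 0 only, where it is c times z. *)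
Definition M1_scale : M1 R := MkM1 neg fin mom.

End scale.

Section point_masses.
Variables (v : nat -> R) (m n : nat).

Let pm (k : nat) : {measure set R -> \bar R} := \d_(Num.max 0 (v (m + k)%N)).

Let neg : msum pm (n - m) `]-oo, 0[%classic = 0%E.
Proof.
rewrite /msum big1// => i _; rewrite /pm /= diracE.
case: (boolP (_ \in _)) => //; rewrite inE/= in_itv/= => h.
by move: h; rewrite gt_max ltxx.
Qed.

Let fin : (msum pm (n - m) setT < +oo)%E.
Proof. by rewrite /msum; apply: lte_sum_pinfty => i _; rewrite /pm /= diracT ltry. Qed.

Let mom : (\int[msum pm (n - m)]_(x in `[0%R, +oo[) x%:E < +oo)%E.
Proof.
rewrite ge0_integral_measure_sum//; last first.
  by move=> x /=; rewrite in_itv/= andbT lee_fin.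
apply: lte_sum_pinfty => i _; rewrite /pm integral_dirac//.
by rewrite diracE -EFinM ltry.
Qed.

(* The sum of the Dirac masses at v m, ..., v (n - 1), for nonnegative v. *)
Definition point_masses : M1 R := MkM1 neg fin mom.

End point_masses.

Section shift.
Variables (z : M1 R) (x : \bar R).

Definition shift_mass (A : set R) : \bar R :=
  z ((fun y => y - fine x) @^-1` A `&` [set y | (x < y%:E)%E]).

Let mdom : measurable [set y | (x < y%:E)%E].
Proof.
case: x => [r| |].
- rewrite (_ : [set y | _] = `]r, +oo[%classic); first exact: measurable_itv.
  by apply/seteqP; split => y /=; rewrite in_itv/= andbT lte_fin.
- by rewrite (_ : [set y | _] = set0)//; apply/seteqP; split => y /=.
- rewrite (_ : [set y | _] = setT)//; apply/seteqP; split => y //= _.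
  exact: ltNyr.
Qed.

Let mphi : measurable_fun setT (fun y : R => y - fine x).
Proof. exact: measurable_funB. Qed.

Let shift_mass0 : shift_mass set0 = 0%E.
Proof. by rewrite /shift_mass preimage_set0 set0I measure0. Qed.

Let shift_mass_ge0 A : (0 <= shift_mass A)%E.
Proof. exact: measure_ge0. Qed.

Let shift_mass_sigma_additive : semi_sigma_additive shift_mass.
Proof.
move=> F mF tF mUF; rewrite /shift_mass preimage_bigcup setI_bigcupl.
have mG i : measurable ((fun y : R => y - fine x) @^-1` F i `&`
    [set y | (x < y%:E)%E]).
  by apply: measurableI => //; rewrite -[X in measurable X]setTI; exact: mphi.
apply: measure_semi_sigma_additive => //; last exact: bigcup_measurable.
apply/trivIsetP => i j _ _ ij; rewrite setIACA -preimage_setI.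
by move/trivIsetP : tF => /(_ _ _ _ _ ij) ->//; rewrite preimage_set0 set0I.
Qed.

HB.instance Definition _ := isMeasure.Build _ _ _ shift_mass
  shift_mass0 shift_mass_ge0 shift_mass_sigma_additive.

Let neg : shift_mass `]-oo, 0[%classic = 0%E.
Proof.
apply/eqP; rewrite eq_le measure_ge0 andbT -(m1_neg z).
apply: le_measure; rewrite ?inE//.
- apply: measurableI => //; rewrite -[X in measurable X]setTI.
  by apply: mphi => //; exact: measurable_itv.
move=> y [/=]; rewrite !in_itv/=; case: x => [r| |] //=.
  by rewrite lte_fin subr_lt0 => yr ry; move: (lt_trans yr ry); rewrite ltxx.
by rewrite subr0.
Qed.

Let fin : (shift_mass setT < +oo)%E.
Proof.
apply: le_lt_trans (m1_finite z); rewrite /shift_mass preimage_setT setTI.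
by apply: le_measure; rewrite ?inE.
Qed.

Let mom : (\int[shift_mass]_(y in `[0%R, +oo[) y%:E < +oo)%E.
Proof.
pose m' : {measure set R -> \bar R} := mrestr z mdom.
have -> : (\int[shift_mass]_(y in `[0%R, +oo[) y%:E =
    \int[pushforward m' (fun y : R => y - fine x)%R]_(y in `[0%R, +oo[) y%:E)%E.
  by [].
rewrite ge0_integral_pushforward//; last first.
  by move=> y; rewrite inE/= in_itv/= andbT lee_fin.
set D : set R := _ @^-1` _.
have mp : measurable D.
  by rewrite -[X in measurable X]setTI; apply: mphi.
pose h : R -> \bar R := (EFin \_ (`[0, +oo[%classic : set R)).
pose g (y : R) : \bar R := (h y + `|fine x|%:E)%E.
have h0 y : (0 <= h y)%E.
  by rewrite /h patchE; case: ifP => //; rewrite inE/= in_itv/= andbT lee_fin.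
have mh : measurable_fun setT h.
  by apply/(measurable_restrictT _ _).1.
have g0 y : (0 <= g y)%E by rewrite /g adde_ge0// lee_fin.
have mg : measurable_fun setT g by apply: emeasurable_funD.
apply: (@le_lt_trans _ _ (\int[m']_(y in D)
    g y)%E).
  apply: ge0_le_integral => //=.
  - by move=> y; rewrite /D/= in_itv/= andbT lee_fin.
  - by apply/measurable_EFinP; exact: measurable_funS mphi.
  - exact: measurable_funS mg.
  move=> y _; rewrite /g /h patchE; case: ifPn => hy.
    by rewrite -EFinD lee_fin lerD2l ler_normr lexx orbT.
  rewrite add0e lee_fin; apply: (@le_trans _ _ (- fine x)); last first.
    by rewrite ler_normr lexx orbT.
  rewrite gerDr; move: hy; rewrite notin_setE/= in_itv/= andbT.
  by move/negP; rewrite -ltNge; exact: ltW.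
apply: (@le_lt_trans _ _ (\int[z]_y g y)%E).
  apply: (@le_trans _ _ (\int[z]_(y in D)
    g y)%E); last by apply: ge0_subset_integral.
  apply: ge0_le_measure_integral => //= A mA.
  by apply: le_measure; rewrite ?inE//; exact: measurableI.
rewrite ge0_integralD//.
rewrite -integral_mkcond lte_add_pinfty ?m1_moment//.
by rewrite integral_cst// lte_mul_pinfty// m1_finite.
Qed.

(* For finite x, z shifted left by x with the mass at or below 0 removed; for
   x = +oo, the zero measure. *)
Definition M1_shift : M1 R := MkM1 neg fin mom.

End shift.

End measure_constructions.

Section inverse_distribution.
Variable R : realType.
Implicit Types z : M1 R.

Definition truncated_moment z (x : R) : R := pairing (fun y => Num.min y x) z.

Definition msupport z : set R :=
  [set x | forall U : set R, open U -> U x -> (0 < z U)%E].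

Definition support_sup z : \bar R := ereal_sup (EFin @` msupport z).

(* F_z^{-1}(y) for y >= 0. The value can be +oo, but only for y at least
   first_moment z and z with unbounded support. *)
Definition truncated_moment_inv z (y : R) : \bar R :=
  if z setT == 0%E then 0%E
  else if y < first_moment z then
    (xget 0 [set x | [/\ 0 <= x, (x%:E < support_sup z)%E
                       & truncated_moment z x = y]])%:E
  else support_sup z.

End inverse_distribution.

Section skorohod_space.
Variables (R : realType) (V : uniformType).

Definition cadlag (x : R -> V) : Prop := forall t, 0 <= t ->
  x s @[s --> t^'+] --> x t /\
  (0 < t -> exists l : V, x s @[s --> t^'-] --> l).

(* The values at negative times play no role; in particular the topology below
   does not distinguish paths that agree on R_+. *)
Record skorohod := MkSkorohod {
  skorohod_path :> R -> V ;
  skorohod_cadlag : cadlag skorohod_path }.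

HB.instance Definition _ := gen_eqMixin skorohod.
HB.instance Definition _ := gen_choiceMixin skorohod.

Definition time_change (l : R -> R) : Prop :=
  {in `[0, +oo[ &, {mono l : s t / s < t}} /\ l @` `[0, +oo[ = `[0, +oo[%classic.

(* Basic J1 neighbourhoods on [0, oo), after the characterization of J1
   convergence x_n -> x of Ethier and Kurtz, Proposition 3.5.3 (c): for each T
   there are time changes l_n such that, uniformly over t in [0, T],
   l_n t - t -> 0 and x_n t gets close to x (l_n t). Since x maps [0, T + 1] into
   a relatively compact set, the uniformity chosen on V only matters through its
   topology when V is metrizable. *)
Definition skorohod_nbhd (x : skorohod) (T e : R) (U : set (V * V)) :
    set skorohod :=
  [set y : skorohod | exists2 l : R -> R, time_change l &
    forall t, 0 <= t <= T -> `|l t - t| < e /\ U (y t, x (l t))].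

Definition skorohod_open : set_system skorohod :=
  [set O : set skorohod | forall x, O x -> exists T e U,
    [/\ 0 < e, entourage U & skorohod_nbhd x T e U `<=` O]].

Let skorohod_openT : skorohod_open setT.
Proof. by move=> x _; exists 0, 1, setT; split => //; exact: entourageT. Qed.

Let skorohod_openI : setI_closed skorohod_open.
Proof.
move=> A B oA oB x [/oA[T [e [U [e0 eU sA]]]] /oB[T' [e' [U' [e'0 eU' sB]]]]].
exists (Num.max T T'), (Num.min e e'), (U `&` U'); split.
- by rewrite lt_min e0.
- exact: filterI.
move=> y [l ll ly]; split.
  apply: sA; exists l => // t /andP[t0 tT].
  have [|] := ly t; first by rewrite t0 le_max tT.
  by rewrite lt_min => /andP[? _] [].
apply: sB; exists l => // t /andP[t0 tT].
have [|] := ly t; first by rewrite t0 le_max tT orbT.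
by rewrite lt_min => /andP[_ ?] [].
Qed.

Let skorohod_open_bigU (I : Type) (f : I -> set skorohod) :
  (forall i, skorohod_open (f i)) -> skorohod_open (\bigcup_i f i).
Proof.
move=> of_ x [i _ /of_[T [e [U [e0 eU sf]]]]].
by exists T, e, U; split => // y /sf; exists i.
Qed.

HB.instance Definition _ := isOpenTopological.Build skorohod
  skorohod_openT skorohod_openI skorohod_open_bigU.

End skorohod_space.

Section random_elements.
Variable R : realType.

(* Measurability with respect to the Borel sigma-algebra of S. *)
Definition random_element d (T : measurableType d) (S : topologicalType)
    (X : T -> S) : Prop :=
  forall A : set S, <<s @open S >> A -> measurable (X @^-1` A).

(* The X n may live on different probability spaces. *)
Definition cvg_in_distribution (S : topologicalType)
    (d : nat -> measure_display) (T : forall n, measurableType (d n))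
    (P : forall n, probability (T n) R) (X : forall n, T n -> S)
    d0 (T0 : measurableType d0) (P0 : probability T0 R) (X0 : T0 -> S) : Prop :=
  [/\ forall n, random_element (X n), random_element X0 &
    forall f : S -> R, continuous f -> (exists C, forall x, `|f x| <= C) ->
      ('E_(P n)[fun w => f (X n w)] @[n --> \oo] -->
       'E_P0[fun w => f (X0 w)])%E].

Definition mutually_independent d (T : measurableType d)
    (P : probability T R) (X : nat -> {RV P >-> R}) : Prop :=
  forall (n : nat) (A : nat -> set R), (forall i, measurable (A i)) ->
    P (\bigcap_(i < n) (X i @^-1` A i)) =
    (\prod_(i < n) P (X i @^-1` A i))%E.

(* The interarrival times are u 0 (the delay), u 1, u 2, ..., and E t counts the
   arrival epochs in [0, t]. *)
Definition delayed_renewal d (T : measurableType d) (P : probability T R)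
    (a : R) (E : R -> T -> nat) : Prop :=
  exists u : nat -> {RV P >-> R},
  [/\ mutually_independent u,
      forall i w, 0 <= u i w,
      forall i A, measurable A ->
        distribution P (u i.+1) A = distribution P (u 1%N) A,
      ('E_P[u 1%N] = (a^-1)%:E)%E
    & forall t w n, 0 <= t ->
        (n < E t w)%N = (\sum_(i < n.+1) u i w <= t)].

End random_elements.

(* A sample path is determined by the initial batch b0, the arrival counting
   function E, and the service times v 0, v 1, ... of the arriving jobs, with
   v i the service time of the (i + 1)-st arrival. *)
Section gated_processor_sharing.
Variables (R : realType) (b0 : M1 R) (E : R -> nat) (v : nat -> R).

Definition arrivals (t : R) : M1 R := point_masses v 0 (E t).

(* The measure arrivals t - arrivals s, for s <= t. *)
Definition arrivals_between (s t : R) : M1 R := point_masses v (E s) (E t).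

Definition netput (t : R) : R :=
  first_moment b0 + first_moment (arrivals t) - t.

Definition idle_time (t : R) : R :=
  sup [set Num.max (- netput s) 0 | s in `[0, t]].

Definition workload (t : R) : R := netput t + idle_time t.

(* The value is +oo if there are fewer than k batches after the initial one. *)
Fixpoint batch_start (k : nat) : \bar R :=
  if k is j.+1 then
    ereal_inf [set s%:E | s in
      [set s | (batch_start j + (workload (fine (batch_start j)))%:E <= s%:E)%E
               /\ 0 < workload s]]
  else 0%E.

Definition batch (k : nat) : M1 R :=
  if k is j.+1 then
    arrivals_between (fine (batch_start j)) (fine (batch_start k))
  else b0.

Definition last_batch_start (t : R) : R :=
  fine (ereal_sup
    [set batch_start k | k in [set k | (batch_start k <= t%:E)%E]]).

Definition last_batch (t : R) : nat :=
  xget 0%N [set l | (batch_start l <= t%:E)%E /\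
    forall j, (batch_start j <= t%:E)%E -> (j <= l)%N].

Definition current_batch (t : R) : M1 R := batch (last_batch t).

Definition service (t : R) : \bar R :=
  truncated_moment_inv (current_batch t) (t - last_batch_start t).

Definition in_service (t : R) : M1 R :=
  M1_shift (current_batch t) (service t).

Definition in_waiting (t : R) : M1 R :=
  arrivals_between (last_batch_start t) t.

End gated_processor_sharing.

Record gps_model (R : realType) := MkGpsModel {
  gps_display : measure_display ;
  gps_space : measurableType gps_display ;
  gps_P : probability gps_space R ;
  gps_rate : R ;
  gps_rate_gt0 : 0 < gps_rate ;
  gps_E : R -> gps_space -> nat ;
  gps_E0 : forall w, gps_E 0 w = 0%N ;
  gps_E_renewal : delayed_renewal gps_P gps_rate gps_E ;
  gps_nu : M1 R ;
  gps_nu_prob : gps_nu setT = 1%E ;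
  gps_nu0 : gps_nu [set 0] = 0%E ;
  gps_v : nat -> {RV gps_P >-> R} ;
  gps_v_ge0 : forall i w, 0 <= gps_v i w ;
  gps_v_indep : mutually_independent gps_v ;
  gps_v_dist : forall i A, measurable A ->
    distribution gps_P (gps_v i) A = gps_nu A ;
  gps_Z0 : {RV gps_P >-> nat} ;
  gps_v0 : nat -> {RV gps_P >-> R} ;
  gps_v0_gt0 : forall j w, 0 < gps_v0 j w ;
  gps_v0_mean :
    ('E_gps_P[fun w => (\sum_(j < gps_Z0 w) gps_v0 j w)%R] < +oo)%E }.

Section fluid_scaling.
Variables (R : realType) (r : R) (Q : gps_model R) (w : gps_space Q).

Let b0 : M1 R := point_masses (fun j => gps_v0 Q j w) 0 (gps_Z0 Q w).
Let E (t : R) : nat := gps_E t w.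
Let v (i : nat) : R := gps_v Q i w.

Definition scaled_arrivals (t : R) : M1 R :=
  M1_scale r^-1 (arrivals E v (r * t)).

Definition scaled_initial : M1 R := M1_scale r^-1 b0.

Definition scaled_in_service (t : R) : M1 R :=
  M1_scale r^-1 (in_service b0 E v (r * t)).

Definition scaled_in_waiting (t : R) : M1 R :=
  M1_scale r^-1 (in_waiting b0 E v (r * t)).

End fluid_scaling.

Section fluid_model.
Variables (R : realType) (alpha : R) (nu xi : M1 R).

Definition remainder (w t : R) : R :=
  if w == 0 then 0 else t - (Num.floor (t / w))%:~R * w.

Definition fluid_in_service (t : R) : M1 R :=
  let w := first_moment xi in
  let z := M1_scale (alpha * w) nu in
  if t < w then M1_shift xi (truncated_moment_inv xi t)
  else M1_shift z (truncated_moment_inv z (remainder w t)).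

Definition fluid_in_waiting (t : R) : M1 R :=
  M1_scale (alpha * remainder (first_moment xi) t) nu.

Definition fluid_model_path (x : skorohod R (M1 R) * skorohod R (M1 R)) : Prop :=
  forall t, 0 <= t -> x.1 t = fluid_in_service t /\ x.2 t = fluid_in_waiting t.

End fluid_model.

(* Main.v *)
Require Import Defs.
From mathcomp Require Import all_boot all_order all_algebra.
From mathcomp Require Import all_classical all_reals all_analysis.
From mathcomp Require Import measurable_realfun ring lra.

Set Implicit Arguments.
Unset Strict Implicit.
Unset Printing Implicit Defensive.
Import Order.TTheory GRing.Theory Num.Theory.
Import numFieldNormedType.Exports.
Local Open Scope classical_set_scope.
Local Open Scope ring_scope.

(* Weak convergence reduces to a deterministic statement: if the scaled initial
   measure is close to an atomless xi and the scaled arrival process is close to the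
   fluid arrivals on a long time interval, then the sample path is J1-close to the
   fluid path of xi. Given this, E f(X_n) is bounded above by E L_k(B_n) plus an
   error term, where L_k(z) is the supremum of f over all sample paths, penalized by
   the distances of their initial measures to z and of their arrival processes to the
   fluid arrivals. L_k is bounded and continuous, the error term vanishes by (ii), and
   limsup_k L_k(z) <= f(fluid path of z) when z is atomless.

   Closeness in M_1 is measured by countably many coordinates: the first moment and
   the truncated moments F_z(q), q rational. The batch structure is determined by the
   arrivals through one rule: the batch after the one started at time b with work w
   starts as soon as b + w is reached and work has arrived since b. When
   w = <chi, xi> > 0 the starting times thus converge to the multiples of w, and
   piecewise affine time changes align them. Within a batch one uses that
   (z, t) |-> z(. +_0 F_z^{-1}(t)) is continuous at atomless z, uniformly over compact
   time intervals. When w = 0 all batches become small. *)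

(** * Integration against finite measures on R_+ *)

(** The models live on different probability spaces, and the laws of the initial measures and of the
    arrivals converge separately. Since the arrival limit is deterministic, the mean of one
    continuous penalty accounts for the arrivals, and no joint law is formed. The supremum in L_k
    runs over the sample paths of all the models: this makes L_k a single function, to which the
    convergence in law of B_n applies. The supremum is uncountable, but the penalties make L_k
    Lipschitz in the coordinates, hence measurable. The argument is run for f and for -f.

    The delicate quantity is the total mass. The mass left after service up to level x is the tail
    of z beyond x, which jumps at atoms of z, whereas truncated moments at nonnegative levels do not
    see mass at 0. Convergence of the mass thus requires an argument of its own, which rests on
    atomlessness. Sample paths do have atoms, and their regularity rests on monotonicity of the mass
    in time.

    Path-valued maps are shown to be measurable by rebuilding a path, up to a small J1 error, from
    integer parts of finitely many coordinates on a dyadic time grid. *)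

Section pairing.
Variable R : realType.
Implicit Types (z : M1 R) (f g : R -> R).

Definition Rplus : set R := `[0, +oo[%classic.

Lemma RplusE (x : R) : Rplus x = (0 <= x) :> Prop.
Proof. by rewrite /Rplus /= in_itv /= andbT. Qed.

Lemma measurable_Rplus : measurable Rplus.
Proof. exact: measurable_itv. Qed.
Hint Resolve measurable_Rplus : core.

Lemma m1_fin z A : measurable A -> z A \is a fin_num.
Proof.
move=> mA; rewrite ge0_fin_numE ?measure_ge0//.
by apply: le_lt_trans (m1_finite z); apply: le_measure; rewrite ?inE.
Qed.

(** Such functions are integrable against every element of [M1 R], whose mass and first moment are
    finite. The class contains the test functions of the topology, and [pairing] is linear on it. *)
Definition linear_growth f : Prop :=
  measurable_fun Rplus f /\ exists C, forall x, 0 <= x -> `|f x| <= C * (1 + x).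

Lemma linear_growth_integrable z f : linear_growth f ->
  z.-integrable Rplus (EFin \o f).
Proof.
move=> [mf [C hC]].
have iid : z.-integrable Rplus (EFin \o id).
  apply/integrableP; split; first exact/measurable_EFinP.
  rewrite (eq_integral EFin); first exact: m1_moment.
  by move=> x /[!inE]; rewrite RplusE => x0; rewrite /= ger0_norm.
have icst : z.-integrable Rplus (EFin \o cst 1).
  apply/integrableP; split; first exact/measurable_EFinP.
  rewrite (eq_integral (cst 1%E)); last by move=> x _; rewrite /= normr1.
  by rewrite integral_cst// mul1e ltey_eq m1_fin.
have ig : z.-integrable Rplus (fun x : R => `|C|%:E * (1%:E + x%:E))%E.
  by apply: integrableZl => //; exact: (integrableD _ icst iid).
apply: le_integrable ig => //; first exact/measurable_EFinP.
move=> x; rewrite RplusE => x0 /=; rewrite lee_fin.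
apply: le_trans (hC _ x0) _.
rewrite normrM normr_id (ger0_norm (addr_ge0 ler01 x0)).
by rewrite ler_wpM2r ?addr_ge0// ler_norm.
Qed.

Lemma linear_growth_bounded f C : measurable_fun Rplus f ->
  (forall x, 0 <= x -> `|f x| <= C) -> linear_growth f.
Proof.
move=> mf fC; split => //; exists `|C| => x x0.
apply: (le_trans (fC _ x0)); apply: (le_trans (ler_norm _)).
by rewrite ler_peMr// lerDl.
Qed.

Lemma linear_growth_cst c : linear_growth (cst c).
Proof. by apply: (@linear_growth_bounded _ `|c|). Qed.

Lemma linear_growth_id : linear_growth id.
Proof.
by split; [|exists 1 => x x0; rewrite mul1r ger0_norm// lerDr].
Qed.

Lemma linear_growth_le f g : measurable_fun Rplus f -> linear_growth g ->
  (forall x, 0 <= x -> `|f x| <= `|g x|) -> linear_growth f.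
Proof.
move=> mf [_ [C gC]] fg; split => //; exists C => x x0.
exact: le_trans (fg _ x0) (gC _ x0).
Qed.

Lemma linear_growthD f g : linear_growth f -> linear_growth g ->
  linear_growth (fun x => f x + g x).
Proof.
move=> [mf [C fC]] [mg [D gD]]; split; first exact: measurable_funD.
exists (C + D) => x x0; rewrite mulrDl.
by apply: (le_trans (ler_normD _ _)); rewrite lerD ?fC ?gD.
Qed.

Lemma linear_growthZ c f : linear_growth f -> linear_growth (fun x => c * f x).
Proof.
move=> [mf [C fC]]; split; first exact: measurable_funM.
by exists (`|c| * C) => x x0; rewrite normrM -mulrA ler_wpM2l ?fC.
Qed.

Lemma linear_growthB f g : linear_growth f -> linear_growth g ->
  linear_growth (fun x => f x - g x).
Proof.
move=> hf hg; have := linear_growthD hf (linear_growthZ (-1) hg).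
by congr linear_growth; apply/funext => x; rewrite mulN1r.
Qed.

Lemma linear_growth_norm f : linear_growth f -> linear_growth (fun x => `|f x|).
Proof.
move=> hf; apply: (linear_growth_le _ hf) => [|x _]; last by rewrite normr_id.
by apply: measurableT_comp hf.1; exact: normr_measurable.
Qed.

Lemma linear_growth_minr c : linear_growth (fun y => Num.min y c).
Proof.
split; first exact: measurable_minr.
exists (1 + `|c|) => x x0; rewrite mulrDl mul1r.
case: (leP x c) => xc.
  rewrite ger0_norm//.
  have : 0 <= `|c| * (1 + x) by rewrite mulr_ge0// addr_ge0.
  lra.
have : `|c| <= `|c| * (1 + x) by rewrite ler_peMr// lerDl.
lra.
Qed.
Hint Resolve linear_growth_cst linear_growth_id linear_growth_minr : core.

Lemma pairingD z f g : linear_growth f -> linear_growth g ->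
  pairing (fun x => f x + g x) z = pairing f z + pairing g z.
Proof. by move=> *; apply: RintegralD => //; exact: linear_growth_integrable. Qed.

Lemma pairingB z f g : linear_growth f -> linear_growth g ->
  pairing (fun x => f x - g x) z = pairing f z - pairing g z.
Proof. by move=> *; apply: RintegralB => //; exact: linear_growth_integrable. Qed.

Lemma pairingZ z c f : linear_growth f ->
  pairing (fun x => c * f x) z = c * pairing f z.
Proof. by move=> *; apply: RintegralZl => //; exact: linear_growth_integrable. Qed.

Lemma le_pairing z f g : linear_growth f -> linear_growth g ->
  (forall x, 0 <= x -> f x <= g x) -> pairing f z <= pairing g z.
Proof.
move=> hf hg fg; apply: le_Rintegral => //; try exact: linear_growth_integrable.
by move=> x; rewrite -/Rplus RplusE; exact: fg.
Qed.

Lemma eq_pairing z f g : (forall x, 0 <= x -> f x = g x) ->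
  pairing f z = pairing g z.
Proof.
move=> fg; apply: eq_Rintegral => x; rewrite inE -/Rplus RplusE; exact: fg.
Qed.

Lemma le_normr_pairing z f : linear_growth f ->
  `|pairing f z| <= pairing (fun x => `|f x|) z.
Proof. by move=> hf; apply: le_normr_Rintegral => //; exact: linear_growth_integrable. Qed.

Lemma pairing_ge0 z f : (forall x, 0 <= x -> 0 <= f x) -> 0 <= pairing f z.
Proof. by move=> f0; apply: Rintegral_ge0 => x; rewrite -/Rplus RplusE; exact: f0. Qed.

Definition mass z : R := fine (z Rplus).

Lemma pairing_cst z c : pairing (cst c) z = c * mass z.
Proof. by rewrite /pairing Rintegral_cst. Qed.

Lemma mass_ge0 z : 0 <= mass z.
Proof. by rewrite /mass fine_ge0// measure_ge0. Qed.

Lemma m1_setT z : z setT = z Rplus.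
Proof.
have -> : [set: R] = `]-oo, 0[%classic `|` Rplus.
  apply/seteqP; split => x //= _; rewrite RplusE in_itv/=.
  by case: (ltP x 0) => ?; [left|right].
rewrite measureU//.
  by rewrite [X in (X + _)%E](m1_neg z) add0e.
apply/seteqP; split => x //= [] /=; rewrite RplusE in_itv/= => x0 x1.
by move: (lt_le_trans x0 x1); rewrite ltxx.
Qed.

(** The right derivative of [truncated_moment z] at [x]; for negative [x] it is the mass. *)
Definition tail z (x : R) : R := fine (z `]x, +oo[%classic).

Lemma tail_ge0 z x : 0 <= tail z x.
Proof. by rewrite /tail fine_ge0// measure_ge0. Qed.

Lemma le_tail z x y : x <= y -> tail z y <= tail z x.
Proof.
move=> xy; rewrite /tail fine_le// ?m1_fin//.
apply: le_measure; rewrite ?inE//.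
by move=> u /=; rewrite !in_itv/= !andbT; exact: le_lt_trans.
Qed.

Lemma tail_neg z x : x < 0 -> tail z x = mass z.
Proof.
move=> x0; rewrite /tail /mass; congr fine; apply/eqP.
rewrite eq_le -[X in (_ <= X)%E]m1_setT; apply/andP; split.
  by apply: le_measure; rewrite ?inE.
apply: le_measure; rewrite ?inE// => u.
by rewrite RplusE /= in_itv/= andbT; exact: lt_le_trans.
Qed.

Lemma pairing_tail z x : 0 <= x ->
  pairing (\1_(`]x, +oo[%classic)) z = tail z x.
Proof.
move=> x0; rewrite /pairing /Rintegral integral_indic//; congr (fine (z _)).
apply/seteqP; split => u //=; rewrite !in_itv/= !andbT; first by case.
by move=> xu; split => //; rewrite (le_trans x0)// ltW.
Qed.

Lemma linear_growth_indic (A : set R) : measurable A -> linear_growth \1_A.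
Proof.
move=> mA; apply: (@linear_growth_bounded _ 1).
  exact: measurable_funTS.
by move=> x _; rewrite indicE; case: (_ \in _); rewrite ?normr1 ?normr0.
Qed.

End pairing.
#[global] Hint Resolve linear_growth_cst linear_growth_id linear_growth_minr
  measurable_Rplus : core.

(** * Truncated moments, tails and shifted measures *)

Section truncated_moments.
Variable R : realType.
Implicit Types (z : M1 R) (f g : R -> R).

Lemma pairing_indic_tail z x : pairing (\1_(`]x, +oo[%classic)) z = tail z x.
Proof.
have [x0|x0] := leP 0 x; first exact: pairing_tail.
rewrite tail_neg// -[RHS]mul1r -pairing_cst; apply: eq_pairing => u u0.
by rewrite indicE mem_set// /= in_itv/= andbT (lt_le_trans x0).
Qed.

Lemma linear_growth_itv (x : R) : linear_growth (\1_(`]x, +oo[%classic)).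
Proof. exact: linear_growth_indic. Qed.
Hint Resolve linear_growth_itv : core.

(** The increment [min u y - min u x] lies between [y - x] times the indicator of [u > y] and
    [y - x] times that of [u > x]. These two-sided bounds stand in for differentiating the concave
    function [truncated_moment z], at negative arguments as well. *)
Lemma truncated_moment_slope z (x y : R) : x <= y ->
  (y - x) * tail z y <= truncated_moment z y - truncated_moment z x
    <= (y - x) * tail z x.
Proof.
move=> xy; rewrite /truncated_moment -pairingB//.
rewrite -!pairing_indic_tail -!pairingZ//.
apply/andP; split; apply: le_pairing; try exact: linear_growthZ;
  try exact: linear_growthB; move=> u u0; rewrite indicE.
- case: (boolP (u \in _)) => [|_] /=.
    rewrite inE/= in_itv/= andbT => yu.
    by rewrite mulr1; case: (leP u y) => uy; case: (leP u x) => ux; lra.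
  by rewrite mulr0; case: (leP u y) => uy; case: (leP u x) => ux; lra.
- case: (boolP (u \in _)) => [_|] /=.
    rewrite mulr1; case: (leP u y) => uy; case: (leP u x) => ux; lra.
  rewrite notin_setE/= in_itv/= andbT => /negP; rewrite -leNgt => ux.
  by rewrite !min_l ?subrr ?mulr0// (le_trans ux).
Qed.

Lemma le_truncated_moment z (x y : R) : x <= y ->
  truncated_moment z x <= truncated_moment z y.
Proof.
move=> xy; have /andP[h _] := truncated_moment_slope z xy.
by rewrite -subr_ge0; apply: le_trans h; rewrite mulr_ge0 ?tail_ge0 ?subr_ge0.
Qed.

Lemma tail_le_mass z x : tail z x <= mass z.
Proof.
rewrite -(@tail_neg _ z (Num.min x 0 - 1)).
  by apply: le_tail; case: (leP x 0); lra.
by case: (leP x 0); lra.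
Qed.

Lemma truncated_moment_lip z (x y : R) :
  `|truncated_moment z y - truncated_moment z x| <= `|y - x| * mass z.
Proof.
wlog xy : x y / x <= y.
  move=> h; have [/h//|/ltW/h] := leP x y.
  by rewrite distrC (distrC y).
rewrite !ger0_norm ?subr_ge0 ?le_truncated_moment//.
have /andP[_ h] := truncated_moment_slope z xy.
by apply: (le_trans h); rewrite ler_wpM2l ?subr_ge0// tail_le_mass.
Qed.

Lemma truncated_moment_le0 z (x : R) : x <= 0 ->
  truncated_moment z x = x * mass z.
Proof.
move=> x0; rewrite -pairing_cst; apply: eq_pairing => u u0.
by rewrite min_r// (le_trans x0).
Qed.

Lemma truncated_moment0 z : truncated_moment z 0 = 0.
Proof. by rewrite truncated_moment_le0// mul0r. Qed.

Lemma truncated_moment_ge0 z (x : R) : 0 <= x -> 0 <= truncated_moment z x.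
Proof. by move=> x0; rewrite -(truncated_moment0 z) le_truncated_moment. Qed.

Lemma truncated_moment_le_first z (x : R) : truncated_moment z x <= first_moment z.
Proof. by apply: le_pairing => // u u0; rewrite ge_min lexx. Qed.

Lemma first_moment_ge0 z : 0 <= first_moment z.
Proof. exact: pairing_ge0. Qed.

Lemma truncated_moment_cvg z :
  truncated_moment z n%:R @[n --> \oo] --> first_moment z.
Proof.
pose f_ (n : nat) (x : R) := (Num.min x n%:R)%:E.
have mR := @measurable_Rplus R.
have [|||||_ _ h] := @dominated_convergence _ _ R z _ mR f_
  (fun x => x%:E) (fun x => x%:E).
- by move=> n; apply/measurable_EFinP/measurable_minr.
- exact/measurable_EFinP.
- apply: aeW => x _; apply: cvg_near_cst.
  exists (Num.truncn x).+1 => // n /= xn; rewrite /f_ min_l//.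
  by rewrite (le_trans (ltW (truncnS_gt x)))// ler_nat.
- exact: (linear_growth_integrable _ (@linear_growth_id R)).
- apply: aeW => x n; rewrite RplusE => x0; rewrite /f_ lee_fin.
  by rewrite ger0_norm ?ge_min ?lexx// le_min x0 ler0n.
rewrite /truncated_moment /first_moment /pairing /Rintegral.
apply: fine_cvg; rewrite fineK.
  exact: h.
exact: (integrable_fin_num (@measurable_Rplus R) (linear_growth_integrable _ (@linear_growth_id R))).
Qed.

Lemma truncated_moment_approx z (e : R) : 0 < e ->
  exists n : nat, first_moment z - e < truncated_moment z n%:R.
Proof.
move=> e0; have /cvgrPdist_lt/(_ _ e0)[N _ hN] := @truncated_moment_cvg z.
exists N; have := hN N (leqnn N); rewrite ltr_norml => /andP[_]; lra.
Qed.

Lemma tail_right z (x e : R) : 0 < e -> exists2 h, 0 < h & tail z x - e < tail z (x + h).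
Proof.
move=> e0; pose F (n : nat) : set R := `]x + n.+1%:R^-1, +oo[%classic.
have bF : \bigcup_n F n = `]x, +oo[%classic.
  apply/seteqP; split => u /=; rewrite in_itv/= andbT.
    by move=> [n _]; rewrite /F/= in_itv/= andbT; apply: lt_trans; rewrite ltrDl.
  move=> xu; have /ltr_add_invr[k hk] := xu.
  by exists k => //; rewrite /F/= in_itv/= andbT.
have /fine_cvgP[_ /cvgrPdist_lt/(_ _ e0)[N _ hN]] :
    z \o F @ \oo --> (tail z x)%:E.
  rewrite /tail fineK ?m1_fin// -bF; apply: nondecreasing_cvg_mu => //.
  - by move=> i; exact: measurable_itv.
  - by rewrite bF.
  - move=> m n mn; apply/subsetPset => u; rewrite /F/= !in_itv/= !andbT.
    by apply: le_lt_trans; rewrite lerD2l lef_pV2 ?posrE// ler_nat.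
exists N.+1%:R^-1 => //; have := hN N (leqnn N).
by rewrite ltr_norml => /andP[_]; rewrite /F /tail /=; lra.
Qed.

(** The intervals starting at [x - 1/(n+1)] decrease to [[x, +oo[], which has the mass of []x, +oo[]
    when [x] is not an atom. Absence of atoms enters the whole development through this lemma. *)
Lemma tail_left z (x e : R) : z [set x] = 0%E -> 0 < e ->
  exists2 h, 0 < h & tail z (x - h) < tail z x + e.
Proof.
move=> zx e0; pose F (n : nat) : set R := `]x - n.+1%:R^-1, +oo[%classic.
have bF : \bigcap_n F n = `[x, +oo[%classic.
  apply/seteqP; split => u /=; rewrite in_itv/= andbT; last first.
    move=> xu n _; rewrite /F/= in_itv/= andbT; apply: lt_le_trans xu.
    by rewrite ltrBlDr ltrDl.
  move=> Fu; rewrite leNgt; apply/negP => /ltr_add_invr[k hk].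
  have := Fu k Logic.I; rewrite /F/= in_itv/= andbT ltrBlDr.
  by move=> /(lt_trans hk); rewrite ltxx.
have zx' : z `[x, +oo[%classic = z `]x, +oo[%classic.
  rewrite -(@setU1itv _ _ _ x false)// measureU//=; last first.
    by apply/seteqP; split => u //= [->]; rewrite in_itv/= ltxx.
  by rewrite [X in (X + _)%E]zx add0e.
have /fine_cvgP[_ /cvgrPdist_lt/(_ _ e0)[N _ hN]] :
    z \o F @ \oo --> (tail z x)%:E.
  rewrite /tail fineK ?m1_fin// -zx' -bF; apply: nonincreasing_cvg_mu => //.
  - by rewrite ltey_eq m1_fin//; exact: measurable_itv.
  - by move=> i; exact: measurable_itv.
  - by rewrite bF; exact: measurable_itv.
  - move=> m n mn; apply/subsetPset => u; rewrite /F/= !in_itv/= !andbT.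
    by apply: le_lt_trans; rewrite lerD2l lerN2 lef_pV2 ?posrE// ler_nat.
exists N.+1%:R^-1 => //; have := hN N (leqnn N).
by rewrite ltr_norml => /andP[]; rewrite /F /tail /=; lra.
Qed.

Lemma tail_infty z (e : R) : 0 < e -> exists n : nat, tail z n%:R < e.
Proof.
move=> e0; pose F (n : nat) : set R := `]n%:R, +oo[%classic.
have bF : \bigcap_n F n = set0.
  apply/seteqP; split => u //= /(_ (Num.truncn u).+1 Logic.I).
  by rewrite /F/= in_itv/= andbT ltNge (ltW (truncnS_gt u)).
have /fine_cvgP[_ /cvgrPdist_lt/(_ _ e0)[N _ hN]] : z \o F @ \oo --> 0%:E.
  have -> : 0%:E = z set0 by rewrite measure0.
  rewrite -bF; apply: nonincreasing_cvg_mu => //.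
  - by rewrite ltey_eq m1_fin//; exact: measurable_itv.
  - by move=> i; exact: measurable_itv.
  - by rewrite bF.
  - move=> m n mn; apply/subsetPset => u; rewrite /F/= !in_itv/= !andbT.
    by apply: le_lt_trans; rewrite ler_nat.
exists N; have := hN N (leqnn N).
by rewrite ltr_norml => /andP[]; rewrite /F /tail /=; lra.
Qed.

Lemma pairing_scale z c f : 0 <= c -> linear_growth f ->
  (forall x, 0 <= x -> 0 <= f x) ->
  pairing f (M1_scale c z) = c * pairing f z.
Proof.
move=> c0 hf f0; rewrite /pairing /Rintegral ge0_integral_mscale//=; last 2 first.
- by apply/measurable_EFinP; exact: hf.1.
- by move=> x /=; rewrite in_itv/= andbT lee_fin; exact: f0.
rewrite fineM//; first by rewrite ger0_norm.
exact: (integrable_fin_num (@measurable_Rplus R) (linear_growth_integrable _ hf)).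
Qed.

Lemma mass_scale z c : 0 <= c -> mass (M1_scale c z) = c * mass z.
Proof.
move=> c0; rewrite -[LHS]mul1r -pairing_cst pairing_scale//.
by rewrite pairing_cst mul1r.
Qed.

Lemma first_moment_scale z c : 0 <= c ->
  first_moment (M1_scale c z) = c * first_moment z.
Proof. by move=> c0; rewrite /first_moment pairing_scale. Qed.

Lemma truncated_moment_scale z c x : 0 <= c ->
  truncated_moment (M1_scale c z) x = c * truncated_moment z x.
Proof.
move=> c0; have [x0|/ltW x0] := leP 0 x.
  by rewrite /truncated_moment pairing_scale// => u u0; rewrite le_min u0.
by rewrite !truncated_moment_le0// mass_scale// mulrCA.
Qed.

Lemma pairing_point_masses v m n f : measurable_fun setT f ->
    (forall x, 0 <= x -> 0 <= f x) ->
  pairing f (point_masses v m n) = \sum_(m <= i < n) f (Num.max 0 (v i)).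
Proof.
move=> mf f0; rewrite /pairing /Rintegral ge0_integral_measure_sum//; last 2 first.
- by move=> x /=; rewrite in_itv/= andbT lee_fin; exact: f0.
- by apply/measurable_EFinP; exact: measurable_funTS.
have -> : \sum_(m <= i < n) f (Num.max 0 (v i)) =
    \sum_(i < n - m) f (Num.max 0 (v (m + i)%N)).
  rewrite -[in LHS](add0n m) big_addn big_mkord.
  by apply: eq_bigr => i _; rewrite addnC.
transitivity (fine (\sum_(i < n - m) f (Num.max 0 (v (m + i)%N)))%:E) => //.
congr fine; rewrite -sumEFin.
apply: eq_bigr => i _; rewrite integral_dirac//; last first.
  by apply/measurable_EFinP; exact: measurable_funTS.
rewrite diracE mem_set/= ?mul1e ?in_itv/= ?andbT ?le_max ?lexx//.
Qed.

Lemma mass_point_masses v m n : mass (point_masses v m n) = (n - m)%:R :> R.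
Proof.
rewrite -[LHS]mul1r -pairing_cst pairing_point_masses//.
by rewrite big_const_nat iter_addr addr0.
Qed.

Lemma first_moment_point_masses v m n :
  first_moment (point_masses v m n) = \sum_(m <= i < n) Num.max 0 (v i) :> R.
Proof. by rewrite /first_moment pairing_point_masses. Qed.

Lemma truncated_moment_point_masses v m n x : 0 <= x ->
  truncated_moment (point_masses v m n) x =
  \sum_(m <= i < n) Num.min (Num.max 0 (v i)) x :> R.
Proof.
move=> x0; rewrite /truncated_moment pairing_point_masses//.
- exact: measurable_minr.
- by move=> u u0; rewrite le_min u0.
Qed.

Lemma pairing_shift z s f : linear_growth f -> (forall x, 0 <= x -> 0 <= f x) ->
  0 <= s ->
  pairing f (M1_shift z s%:E) =
  fine (\int[z]_(y in `]s, +oo[) (f (y - s))%:E).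
Proof.
move=> hf f0 s0; rewrite /pairing /Rintegral; congr fine.
have mdom : measurable [set y : R | (s%:E < y%:E)%E].
  rewrite (_ : [set y | _] = `]s, +oo[%classic); first exact: measurable_itv.
  by apply/seteqP; split => y /=; rewrite in_itv/= andbT lte_fin.
pose m' : {measure set R -> \bar R} := mrestr z mdom.
have mphi : measurable_fun setT (fun y : R => y - s) by exact: measurable_funB.
rewrite [LHS](_ : _ = \int[pushforward m' (fun y : R => y - s)%R]_(y in `[0%R, +oo[) (f y)%:E)%E//.
rewrite ge0_integral_pushforward//; last 2 first.
- by apply/measurable_EFinP; exact: hf.1.
- by move=> x; rewrite inE/= in_itv/= andbT lee_fin; exact: f0.
have mf' : measurable_fun `[s, +oo[ (fun y => (f (y - s))%:E).
  apply/measurable_EFinP; rewrite -[X in measurable_fun _ X]/(f \o (fun y => y - s)).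
  refine (@measurable_comp _ _ _ _ _ _ (@Rplus R) f _ (fun y : R => y - s) _ _ _ _) => //.
  - exact: measurable_Rplus.
  - by move=> _ [y /= ys <-]; move: ys; rewrite RplusE in_itv/= andbT subr_ge0.
  - exact: hf.1.
  - exact: measurable_funTS.
have -> : (fun y : R => y - s) @^-1` `[0, +oo[ = `[s, +oo[%classic.
  by apply/seteqP; split => y /=; rewrite !in_itv/= !andbT subr_ge0.
(* The preimage of [[0, +oo[] under the translation contains [s], whose mass the shift removes; the
   two domains of integration differ by a null set of [m']. *)
have m's : m' [set s] = 0%E.
  rewrite /m' /= /mrestr (_ : _ `&` _ = set0) ?measure0//.
  by apply/seteqP; split => y //= [->]; rewrite ltxx.
rewrite (@ge0_negligible_integral _ _ _ m' _ [set s])//; last first.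
  move=> x /=; rewrite in_itv/= andbT => sx; rewrite lee_fin f0// subr_ge0//.
rewrite (_ : _ `\` _ = `]s, +oo[%classic); last first.
  apply/seteqP; split => y /=; rewrite !in_itv/= !andbT.
    by move=> [sy /eqP ys]; rewrite lt_neqAle eq_sym ys.
  by move=> sy; split; [exact: ltW|apply/eqP; rewrite gt_eqF].
apply: eq_measure_integral => A mA As; rewrite /m' /= /mrestr; congr (z _).
apply/seteqP; split => y /=; first by case.
by move=> Ay; split => //; have := As _ Ay; rewrite /= in_itv/= andbT lte_fin.
Qed.

(** For [y > s], [min (y - s) q] equals [min y (s + q) - min y s], and the latter vanishes for
    [y <= s]. Shifting a measure thus takes increments of its truncated moment. *)
Lemma truncated_moment_shift z s q : 0 <= s -> 0 <= q ->
  truncated_moment (M1_shift z s%:E) q =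
  truncated_moment z (s + q) - truncated_moment z s.
Proof.
move=> s0 q0; rewrite /truncated_moment pairing_shift//; last first.
  by move=> x x0; rewrite le_min x0.
rewrite -pairingB// /pairing /Rintegral.
rewrite [in RHS]integral_mkcond [in LHS]integral_mkcond.
congr fine; apply: eq_integral => y _; rewrite !patchE.
case: ifPn => [|]; rewrite ?inE ?notin_setE/= ?in_itv/= ?andbT.
  move=> sy; rewrite ifT; last by rewrite inE/= in_itv/= andbT (le_trans s0)// ltW.
  by congr EFin; case: (leP y (s + q)); case: (leP y s); case: (leP (y - s) q); lra.
move=> /negP; rewrite -leNgt => ys; case: ifPn => // _.
by congr EFin; case: (leP y (s + q)); case: (leP y s); lra.
Qed.

Lemma first_moment_shift z s : 0 <= s ->
  first_moment (M1_shift z s%:E) = first_moment z - truncated_moment z s.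
Proof.
move=> s0; rewrite /first_moment pairing_shift//.
rewrite -pairingB// /pairing /Rintegral.
rewrite [in RHS]integral_mkcond [in LHS]integral_mkcond.
congr fine; apply: eq_integral => y _; rewrite !patchE.
case: ifPn => [|]; rewrite ?inE ?notin_setE/= ?in_itv/= ?andbT.
  move=> sy; rewrite ifT; last by rewrite inE/= in_itv/= andbT (le_trans s0)// ltW.
  by rewrite min_r// ltW.
move=> /negP; rewrite -leNgt => ys; case: ifPn => // _.
by rewrite min_l// subrr.
Qed.

Lemma mass_shift z s : 0 <= s -> mass (M1_shift z s%:E) = tail z s.
Proof.
move=> s0; rewrite /mass /tail /= /shift_mass; congr (fine (z _)).
apply/seteqP; split => y /=; rewrite !in_itv/= !andbT lte_fin; first by case.
by move=> sy; rewrite RplusE subr_ge0 ltW.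
Qed.

Lemma pairing_null z f : mass z = 0 -> linear_growth f -> pairing f z = 0.
Proof.
move=> z0 hf; rewrite /pairing /Rintegral null_set_integral//.
- by apply/measurable_EFinP; exact: hf.1.
- by rewrite -(fineK (m1_fin z _))//; congr EFin.
Qed.

Lemma truncated_moment_null z x : mass z = 0 -> truncated_moment z x = 0.
Proof. by move=> z0; rewrite /truncated_moment pairing_null. Qed.

Lemma first_moment_null z : mass z = 0 -> first_moment z = 0.
Proof. by move=> z0; rewrite /first_moment pairing_null. Qed.

End truncated_moments.
#[global] Hint Resolve linear_growth_itv : core.

(** * Coordinates of the Wasserstein topology *)

(** Real induction: the supremum of the points satisfying [Q], if finite, is reached from its left
    by the local hypothesis and then passed to its right. It is used where a finite subdivision of
    [[0, T]] has to be built recursively. *)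
Lemma real_chain (R : realType) (P : R -> R -> Prop) (Q : R -> Prop) :
  (forall t, 0 <= t -> exists2 d, 0 < d & (forall b, t < b < t + d -> P t b) /\
     (forall a, 0 <= a -> t - d < a < t -> P a t)) ->
  Q 0 ->
  (forall a b, 0 <= a -> a < b -> Q a -> P a b -> Q b) ->
  forall T, exists2 t, T <= t & 0 <= t /\ Q t.
Proof.
move=> HP Q0 QP T; apply: contrapT => nQ.
pose S := [set t : R | 0 <= t /\ Q t].
have S0 : S 0 by [].
have Sub : ubound S T.
  by move=> t [t0 Qt]; rewrite leNgt; apply/negP => Tt; apply: nQ; exists t => //; exact: ltW.
have hS : has_sup S by split; [exists 0|exists T].
have s0 : 0 <= sup S by apply: ub_le_sup => //; exists T.
have [d d0 [Pr Pl]] := HP _ s0.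
have [a [a0 Qa] ha] := sup_adherent d0 hS.
have as_ : a <= sup S by apply: ub_le_sup => //; exists T.
have Qs : Q (sup S).
  move: as_; rewrite le_eqVlt => /orP[/eqP <-//|as_].
  by apply: (QP _ _ a0 as_ Qa); apply: Pl => //; rewrite ha.
have : sup S + d / 2 <= sup S.
  apply: ub_le_sup; first by exists T.
  split; first by rewrite addr_ge0// ltW// divr_gt0.
  by apply: (QP (sup S)) => //; [lra|apply: Pr; lra].
lra.
Qed.

Lemma near_dist_lt (R : realType) (T : Type) (F : set_system T) (FF : Filter F)
    (f : T -> R) (l e : R) :
  f @ F --> l -> 0 < e -> \forall s \near F, `|l - f s| < e.
Proof. by move=> /cvgrPdist_lt h e0; exact: h. Qed.

Lemma near_ltr_cvg (R : realType) (T : Type) (F : set_system T) (FF : Filter F)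
    (f g : T -> R) (a b : R) :
  f @ F --> a -> g @ F --> b -> a < b -> \forall s \near F, f s < g s.
Proof.
move=> fa gb ab; have d0 : 0 < (b - a) / 2 by lra.
apply: filterS2 (near_dist_lt FF fa d0) (near_dist_lt FF gb d0) => s.
by rewrite !ltr_norml => /andP[? ?] /andP[? ?]; lra.
Qed.

Lemma near_dist_subr (R : realType) (T : Type) (F : set_system T) (FF : Filter F)
    (f g : T -> R) (a b e : R) :
  f @ F --> a -> g @ F --> b -> 0 < e ->
  \forall s \near F, `|(a - b) - (f s - g s)| < e.
Proof.
move=> fa gb e0; have d0 : 0 < e / 2 by lra.
apply: filterS2 (near_dist_lt FF fa d0) (near_dist_lt FF gb d0) => s.
by rewrite !ltr_norml => /andP[? ?] /andP[? ?]; apply/andP; split; lra.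
Qed.

Lemma dist_sub_le (R : realType) (a b a' b' d : R) : `|a - a'| < d / 2 -> `|b - b'| < d / 2 ->
  a - b <= d -> a' - b' <= 2 * d.
Proof. by rewrite !ltr_norml => /andP[? ?] /andP[? ?] ?; lra. Qed.

Section topology.
Variable R : realType.
Implicit Types (z : M1 R) (f g : R -> R).

(* Along the negative numbers the truncated moment is a multiple of the mass, so
   that these coordinates determine the mass as well. *)
Definition m1_coord (j : nat) z : R :=
  if j is i.+1 then truncated_moment z (ratr (odflt 0 (unpickle i)))
  else first_moment z.

Lemma m1_coord_ratr (q : rat) : exists j, forall z, m1_coord j z = truncated_moment z (ratr q).
Proof. by exists (pickle q).+1 => z; rewrite /m1_coord pickleK. Qed.

Lemma linear_growth_test f : w1_test f -> linear_growth f.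
Proof.
move=> [->//|[cf [C fC]]]; apply: (@linear_growth_bounded _ _ C) => //.
by apply: subspace_continuous_measurable_fun => //; exact: measurable_itv.
Qed.

Lemma w1_test_min (q : R) : w1_test (fun x => Num.min x q).
Proof.
right; split.
  apply: continuous_subspaceT => x.
  by apply: (@continuous_min R R id (cst _) x); [exact: cvg_id|exact: cvg_cst].
exists `|q| => x x0; have [|qx] := leP x q => //.
by move=> xq; rewrite ger0_norm// (le_trans xq)// ler_norm.
Qed.

Section cvg_pairing.
Variables (T : Type) (F : set_system T) (FF : Filter F) (zs : T -> M1 R) (z : M1 R).
Hypothesis cvg_coord : forall j, m1_coord j (zs s) @[s --> F] --> m1_coord j z.

(** The coordinate at [q = -1] is minus the mass. *)
Lemma cvg_mass : mass (zs s) @[s --> F] --> mass z.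
Proof.
have [j hj] := m1_coord_ratr (-1).
have N1 : ratr (-1)%Q <= 0 :> R by rewrite rmorphN1 lerN10.
have e z' : mass z' = - m1_coord j z'.
  by rewrite hj truncated_moment_le0// rmorphN1 mulN1r opprK.
by under eq_fun do rewrite e; rewrite e; exact: cvgN.
Qed.

Lemma cvg_truncated_moment x : truncated_moment (zs s) x @[s --> F] --> truncated_moment z x.
Proof.
apply/cvgrPdist_lt => e e0.
(* Truncated moments are Lipschitz with the mass as constant. The masses of [z] and, eventually, of
   [zs s] are at most [mass z + 1], so replacing [x] by a rational within [d] costs at most [e / 4]
   in each of them. *)
pose d := e / (4 * (mass z + 1)).
have mz := mass_ge0 z.
have mz1 : 0 < 4 * (mass z + 1) by lra.
have d0 : 0 < d by rewrite divr_gt0.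
have dmz : d * (4 * (mass z + 1)) = e by rewrite divfK// gt_eqF.
have xd : x < x + d by rewrite ltrDl.
have [q] := rat_in_itvoo xd; rewrite in_itv/= => /andP[xq qd].
have [j hj] := m1_coord_ratr q.
have h1 : \forall s \near F, `|m1_coord j z - m1_coord j (zs s)| < e / 4.
  by move/cvgrPdist_lt : (cvg_coord (j := j)); apply; rewrite divr_gt0.
have h2 : \forall s \near F, `|mass z - mass (zs s)| < 1.
  by move/cvgrPdist_lt : cvg_mass; apply.
near=> s.
have H1 : `|m1_coord j z - m1_coord j (zs s)| < e / 4 by near: s.
have H2 : `|mass z - mass (zs s)| < 1 by near: s.
have L1 := truncated_moment_lip z x (ratr q).
have L2 := truncated_moment_lip (zs s) x (ratr q).
rewrite !hj in H1.
have xq' : `|ratr q - x| < d by rewrite gtr0_norm; lra.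
have M1 : `|ratr q - x| * mass z <= d * mass z by rewrite ler_wpM2r// ltW.
have M2 : `|ratr q - x| * mass (zs s) <= d * (mass z + 1).
  by rewrite ler_pM// ?mass_ge0 ?ltW// ; move: H2; rewrite ltr_norml; lra.
by move: L1 L2 H1; rewrite !ler_norml !ltr_norml => /andP[? ?] /andP[? ?] /andP[? ?];
  apply/andP; split; lra.
Unshelve. all: by end_near. Qed.

Definition cvg_test g := linear_growth g /\ pairing g (zs s) @[s --> F] --> pairing g z.

Lemma cvg_test_lincomb g h c : cvg_test g -> cvg_test h -> cvg_test (fun x => g x + c * h x).
Proof.
move=> [lg cg] [lh ch]; split; first exact: linear_growthD (linear_growthZ _ _).
have e z' : pairing (fun x => g x + c * h x) z' = pairing g z' + c * pairing h z'.
  by rewrite pairingD// ?pairingZ//; exact: linear_growthZ.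
under eq_fun do rewrite e; rewrite e.
by apply: cvgD => //; apply: cvgM => //; exact: cvg_cst.
Qed.

Lemma cvg_test_cst c : cvg_test (cst c).
Proof.
split => //; under eq_fun do rewrite pairing_cst; rewrite pairing_cst.
by apply: cvgM; [exact: cvg_cst|exact: cvg_mass].
Qed.

Lemma cvg_test_min x : cvg_test (fun y => Num.min y x).
Proof. by split => //; exact: cvg_truncated_moment. Qed.

(** [g] interpolates [f] linearly between the points of a subdivision of [[0, t]] and is constant
    beyond [t]. It is a linear combination of constants and functions [min y x], whose pairings are
    known to converge. *)
Lemma approx_cvg_test f (e : R) : 0 < e -> {within `[0, +oo[, continuous f} ->
  forall K, exists2 t, K <= t & 0 <= t /\
  exists2 g, cvg_test g & (forall y, 0 <= y -> y <= t -> `|f y - g y| <= e) /\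
                          (forall y, t <= y -> g y = f t).
Proof.
move=> e0 cf; pose P a b := forall y, a <= y <= b -> `|f y - f a| <= e / 4.
apply: (@real_chain _ P).
- move=> t t0.
  have /cvgrPdist_lt ft : f x @[x --> within `[0, +oo[%classic (nbhs t)] --> f t.
    by move/subspace_continuousP : cf; apply; rewrite /= in_itv/= t0.
  have e8 : 0 < e / 8 by rewrite divr_gt0.
  have := ft _ e8; rewrite near_withinE => /nbhs_ballP[d /= d0 hd].
  have hd' y : 0 <= y -> `|t - y| < d -> `|f t - f y| < e / 8.
    by move=> y0 ty; apply: hd => //=; rewrite in_itv/= y0.
  exists d => //; split.
    move=> b /andP[tb bt] y /andP[ty yb].
    have : `|f t - f y| < e / 8.
      by apply: hd'; [lra|rewrite ler0_norm ?opprB; lra].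
    by rewrite distrC; lra.
  move=> a a0 /andP[da at_] y /andP[ay yt].
  have h1 : `|f t - f y| < e / 8 by apply: hd'; [lra|rewrite ger0_norm; lra].
  have h2 : `|f t - f a| < e / 8 by apply: hd'; [lra|rewrite ger0_norm; lra].
  by move: h1 h2; rewrite !ltr_norml ler_norml => /andP[? ?] /andP[? ?]; apply/andP; split; lra.
- exists (cst (f 0)); first exact: cvg_test_cst.
  split => // y y0 y1; have -> : y = 0 by apply/eqP; rewrite eq_le y0 y1.
  by rewrite /= subrr normr0 ltW.
move=> a b a0 ab [g gP [ga gb]] Pab.
pose c := (f b - f a) / (b - a).
have ba : b - a != 0 by rewrite gt_eqF// subr_gt0.
have cba : c * (b - a) = f b - f a by rewrite divfK.
(* The added term is 0 up to [a], has slope [c] on [[a, b]] and is constant after [b]. *)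
exists (fun y => (g y + c * Num.min y b) + (- c) * Num.min y a).
  by apply: cvg_test_lincomb (cvg_test_min _); exact: cvg_test_lincomb (cvg_test_min _).
split=> [y y0 yb|y yb].
  have [ya|ay] := leP y a.
    rewrite (min_l yb) mulNr addrK; exact: ga.
  have hy : `|f y - f a| <= e / 4 by apply: Pab; rewrite yb ltW.
  have hb : `|f b - f a| <= e / 4 by apply: Pab; rewrite lexx ltW.
  rewrite (min_l yb) gb ?(ltW ay)//.
  have -> : f a + c * y + - c * a = f a + (f b - f a) * ((y - a) / (b - a)).
    rewrite -cba -mulrA (mulrC (b - a)) divfK//; lra.
  set th := (y - a) / (b - a).
  have th0 : 0 <= th by rewrite divr_ge0; lra.
  have th1 : th <= 1 by rewrite ler_pdivrMr; lra.
  have h3 : `|(f b - f a) * th| <= e / 4.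
    rewrite normrM (ger0_norm th0); apply: le_trans hb; exact: ler_piMr.
  by move: hy h3; rewrite !ler_norml => /andP[? ?] /andP[? ?]; apply/andP; split; lra.
rewrite (min_r yb) min_r; last lra.
by rewrite gb; last lra; rewrite -addrA mulNr -mulrBr cba addrCA subrr addr0.
Qed.

Lemma cvg_pairing f : w1_test f -> pairing f (zs s) @[s --> F] --> pairing f z.
Proof.
move=> [->|[cf [C fC]]]; first exact: (cvg_coord (j := 0)).
have lf : linear_growth f by apply: linear_growth_test; right; split => //; exists C.
have C0 : 0 <= C by exact: le_trans (fC 0 (lexx _)).
apply/cvgrPdist_lt => e e0.
have mz := mass_ge0 z.
pose d := e / (8 * (mass z + 1)).
have mz1 : 0 < 8 * (mass z + 1) by lra.
have d0 : 0 < d by rewrite divr_gt0.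
have dmz : d * (8 * (mass z + 1)) = e by rewrite divfK// gt_eqF.
pose d' := e / (16 * (C + 1)).
have C1 : 0 < 16 * (C + 1) by lra.
have d'0 : 0 < d' by rewrite divr_gt0.
have dC : d' * (16 * (C + 1)) = e by rewrite divfK// gt_eqF.
have [n hn] := tail_infty z d'0.
have [t nt [t0 [g [lg cg] [fg gt]]]] := approx_cvg_test d0 cf (n%:R + 1).
(* Beyond [t] the error [f - g] is only bounded by [2 * C], so little mass of [zs s] may lie there.
   The difference of minima dominates the indicator of []t, +oo[]; its pairings converge, and the
   one with [z] is at most the tail at [t - 1]. *)
pose psi y := d + (2 * C) * (Num.min y t - Num.min y (t - 1)).
have lpsi0 : linear_growth (fun y : R => Num.min y t - Num.min y (t - 1)).
  exact: linear_growthB.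
have lpsi : linear_growth psi.
  exact: (linear_growthD (linear_growth_cst d) (linear_growthZ _ lpsi0)).
have fpsi y : 0 <= y -> `|f y - g y| <= psi y.
  move=> y0; rewrite /psi; have [yt|ty] := leP y t.
    apply: (le_trans (fg _ y0 yt)); rewrite lerDl mulr_ge0//; first lra.
    by case: (leP y (t - 1)); lra.
  rewrite (gt _ (ltW ty)) [Num.min y (t - 1)]min_r; last lra.
  have := fC _ y0; have := fC _ t0; rewrite !ler_norml.
  by move=> /andP[? ?] /andP[? ?]; apply/andP; split; lra.
have Epsi z' : `|pairing f z' - pairing g z'| <=
    d * mass z' + 2 * C * (truncated_moment z' t - truncated_moment z' (t - 1)).
  rewrite -pairingB//; apply: (le_trans (le_normr_pairing _ (linear_growthB lf lg))).
  apply: (@le_trans _ _ (pairing psi z')).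
    by apply: le_pairing => //; exact/linear_growth_norm/linear_growthB.
  rewrite /psi (pairingD _ (linear_growth_cst d) (linear_growthZ _ lpsi0)).
  by rewrite pairingZ// pairingB// pairing_cst.
have tz : truncated_moment z t - truncated_moment z (t - 1) <= d'.
  have tt : t - 1 <= t by lra.
  have /andP[_] := truncated_moment_slope z tt.
  rewrite subKr mul1r => h; apply: (le_trans h).
  by apply: ltW; apply: le_lt_trans hn; apply: le_tail; lra.
have B1 : d * mass z <= e / 8 by lra.
have Cd : C * d' * 16 <= e by rewrite -dC; have := mulr_ge0 C0 (ltW d'0); lra.
near=> s.
have h1 : `|pairing g z - pairing g (zs s)| < e / 8.
  by near: s; move/cvgrPdist_lt : cg; apply; rewrite divr_gt0.
have h2 : `|mass z - mass (zs s)| < 1.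
  by near: s; move/cvgrPdist_lt : cvg_mass; apply.
have h3 : `|truncated_moment z t - truncated_moment (zs s) t| < d' / 2.
  by near: s; move/cvgrPdist_lt : (@cvg_truncated_moment t); apply; rewrite divr_gt0.
have h4 : `|truncated_moment z (t - 1) - truncated_moment (zs s) (t - 1)| < d' / 2.
  by near: s; move/cvgrPdist_lt : (@cvg_truncated_moment (t - 1)); apply; rewrite divr_gt0.
have E1 := Epsi z; have E2 := Epsi (zs s).
have B2 : d * mass (zs s) <= e / 8.
  rewrite -dmz -[X in _ <= X]mulrA (mulrC 8) mulfK//.
  apply: ler_wpM2l; first exact: ltW.
  by move: h2; rewrite distrC => /ltr_normlW; rewrite ltrBlDl => /ltW.
have B3 : 2 * C * (truncated_moment z t - truncated_moment z (t - 1)) <= 2 * C * d'.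
  by rewrite ler_wpM2l// mulr_ge0.
have B4 : 2 * C * (truncated_moment (zs s) t - truncated_moment (zs s) (t - 1)) <= 2 * C * (2 * d').
  by apply: ler_wpM2l; [rewrite mulr_ge0|exact: dist_sub_le h3 h4 tz].
have E1' : `|pairing f z - pairing g z| <= e / 4.
  by apply: (le_trans E1); move: B1 B3 Cd; clear; lra.
have E2' : `|pairing f (zs s) - pairing g (zs s)| <= e * 3 / 8.
  by apply: (le_trans E2); move: B2 B4 Cd; clear; lra.
move: E1' E2' h1 (e0); clear; rewrite !ler_norml !ltr_norml.
by move=> /andP[? ?] /andP[? ?] /andP[? ?] ?; apply/andP; split; lra.
Unshelve. all: by end_near. Qed.

End cvg_pairing.

(** Convergence in the initial topology is convergence of the pairings with all test functions. The
    coordinates are countably many of these, and [cvg_pairing] recovers the others. *)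
Lemma cvg_M1P (T : Type) (F : set_system T) (FF : Filter F) (zs : T -> M1 R) z :
  zs @ F --> z <-> forall j, m1_coord j (zs s) @[s --> F] --> m1_coord j z.
Proof.
have wP : (zs @ F --> z) <-> (@w1_map R \o zs @ F --> w1_map z).
  split; first by move=> h; apply: cvg_comp h _; exact: initial_continuous.
  move=> h A [B [[C oC CB] Bz BA]].
  apply: filterS BA _; rewrite -CB; apply: h.
  by apply: open_nbhs_nbhs; split => //; move: Bz; rewrite -CB.
have pP : (@w1_map R \o zs @ F --> w1_map z) <->
    forall f : set_type (@w1_test R), w1_map (zs s) f @[s --> F] --> w1_map z f.
  split=> [h f|h].
    by move=> A hA; apply: (h _ (@proj_continuous _ (fun=> R) f (w1_map z) _ hA)).
  apply/cvg_sup => f; apply/cvg_image.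
    by rewrite eqEsubset; split=> v // _; exists (cst v).
  move=> W /h hW; exists ((fun g : set_type (@w1_test R) -> R => g f) @^-1` W); first exact: hW.
  by rewrite eqEsubset; split => [u [? + <-//]|u Wu]; exists (cst u).
split=> [/wP/pP h|h].
  have hp f : w1_test f -> pairing f (zs s) @[s --> F] --> pairing f z.
    by move=> wf; exact: (h (exist _ f (mem_set wf))).
  by case=> [|i]; apply: hp; [left|exact: w1_test_min].
apply/wP/pP => -[f wf]; apply: cvg_pairing => //; exact: set_mem.
Qed.

(** For varying [k] these sets form a countable base of neighbourhoods of [z], by [nbhs_m1_close]
    and [m1_close_nbhs]. The triangle inequality costs one unit of [k]. *)
Definition m1_close k z z' := forall j, (j <= k)%N -> `|m1_coord j z - m1_coord j z'| < 2^-1 ^+ k.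

Lemma m1_close_refl k z : m1_close k z z.
Proof. by move=> j _; rewrite subrr normr0 exprn_gt0. Qed.

Lemma m1_close_sym k z z' : m1_close k z z' -> m1_close k z' z.
Proof. by move=> h j /h; rewrite distrC. Qed.

Lemma m1_close_trans k z2 z1 z3 :
  m1_close k.+1 z1 z2 -> m1_close k.+1 z2 z3 -> m1_close k z1 z3.
Proof.
move=> h1 h2 j jk; have := h1 j (leqW jk); have := h2 j (leqW jk).
rewrite exprS !ltr_norml => /andP[? ?] /andP[? ?]; apply/andP; split; lra.
Qed.

Lemma m1_close_le k l z z' : (k <= l)%N -> m1_close l z z' -> m1_close k z z'.
Proof.
move=> kl h j jk; apply: (lt_le_trans (h j (leq_trans jk kl))).
by rewrite ler_wiXn2l// invf_le1// ler1n.
Qed.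

Lemma half_exp_lt (e : R) : 0 < e -> exists k, 2^-1 ^+ k < e.
Proof.
move=> e0; have h : (fun n => 2^-1 ^+ n) @ \oo --> (0 : R).
  by apply: cvg_expr; rewrite ger0_norm// invf_lt1// ltr1n.
have /cvgrPdist_lt/(_ _ e0)[N _ hN] := h.
by exists N; have := hN N (leqnn N); rewrite sub0r normrN ger0_norm// exprn_ge0.
Qed.

Lemma m1_close_cvg (T : Type) (F : set_system T) (FF : Filter F) (zs : T -> M1 R) z :
  (forall k, \forall s \near F, m1_close k (zs s) z) <->
  forall j, m1_coord j (zs s) @[s --> F] --> m1_coord j z.
Proof.
split=> [h j|h k].
  apply/cvgrPdist_lt => e /half_exp_lt[k ke].
  apply: filterS (h (maxn j k)) => s /(_ j (leq_maxl _ _)); rewrite distrC => hs.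
  apply: (lt_trans hs); apply: le_lt_trans ke.
  by rewrite ler_wiXn2l// ?leq_maxr// invf_le1// ler1n.
have : \forall s \near F, forall j : 'I_k.+1,
    `|m1_coord j z - m1_coord j (zs s)| < 2^-1 ^+ k.
  apply: filter_forall => j; move/cvgrPdist_lt : (h j); apply.
  by rewrite exprn_gt0.
apply: filterS => s hs j jk; rewrite distrC.
by have := hs (Ordinal (jk : (j < k.+1)%N)).
Qed.

Lemma nbhs_m1_close z k : \forall z' \near z, m1_close k z' z.
Proof.
have h : id @ (nbhs z) --> z by exact: cvg_id.
exact: ((m1_close_cvg _ id z).2 ((cvg_M1P _ id z).1 h)).
Qed.

(** The filter generated by the sets [m1_close k] converges to [z] by the coordinate criterion,
    hence it refines the neighbourhood filter. *)
Lemma m1_close_nbhs z (V : set (M1 R)) : nbhs z V ->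
  exists k, forall z', m1_close k z' z -> V z'.
Proof.
pose F := filter_from [set: nat] (fun k => [set z' | m1_close k z' z]).
have FF : Filter F.
  apply: filter_from_filter; first by exists 0%N.
  move=> i j _ _; exists (maxn i j) => // z' /= h.
  by split; apply: m1_close_le h; rewrite ?leq_maxl ?leq_maxr.
have Fz : id @ F --> z.
  by apply/cvg_M1P/m1_close_cvg => k; exists k.
by move=> /Fz[k _ hk]; exists k => z' /hk.
Qed.

Lemma m1_coord_continuous j : continuous (m1_coord j : M1 R -> R).
Proof.
move=> z; have h : id @ (nbhs z) --> z by exact: cvg_id.
exact: ((cvg_M1P _ id z).1 h).
Qed.

End topology.

(** * Continuity of processor sharing service *)

Section served.
Variable R : realType.
Implicit Types (z : M1 R) (f g : R -> R).

Definition served z (t : R) : M1 R := M1_shift z (truncated_moment_inv z t).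

Lemma truncated_moment_continuous z : continuous (truncated_moment z).
Proof.
move=> x; apply/cvgrPdist_lt => e e0; have mz := mass_ge0 z.
have m1 : 0 < mass z + 1 by lra.
exists (e / (mass z + 1)) => /=; first by rewrite divr_gt0.
move=> y /=; rewrite ltr_pdivlMr// => xy.
apply: le_lt_trans (truncated_moment_lip z y x) _; apply: le_lt_trans xy.
by rewrite ler_wpM2l//; lra.
Qed.

(** Points beyond the support have null neighbourhoods, and [real_chain] glues null intervals until
    the remaining tail is smaller than any prescribed number. The boundary case follows by right
    continuity of the tail. *)
Lemma tail_support z (x : R) : (support_sup z <= x%:E)%E -> tail z x = 0.
Proof.
have tail0 (y : R) : (support_sup z < y%:E)%E -> tail z y = 0.
  move=> zy.
  pose Q t := z `]y, y + t]%classic = 0%E.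
  pose P a b := z `]y + a, y + b]%classic = 0%E.
  have chain := @real_chain R P Q.
  have H T : exists2 t, T <= t & 0 <= t /\ Q t.
    apply: chain => [t t0| |a b a0 ab Qa Pab].
    - have : ~ msupport z (y + t).
        move=> st; have : ((y + t)%:E <= support_sup z)%E by apply: ereal_sup_ubound; exists (y + t).
        move=> /le_lt_trans/(_ zy); rewrite lte_fin; lra.
      move=> /existsNP[U /not_implyP[oU /not_implyP[Uy zU]]].
      have zU0 : z U = 0%E.
        by apply/eqP; rewrite eq_le measure_ge0 andbT leNgt; exact/negP.
      have : nbhs (y + t) U by apply: open_nbhs_nbhs.
      move=> /nbhs_ballP[d /= d0 dU].
      have null a b : y + t - d < a -> b < y + t + d -> z `]a, b]%classic = 0%E.
        move=> ha hb; apply/eqP; rewrite eq_le measure_ge0 andbT -zU0.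
        apply: le_measure; rewrite ?inE//; first exact: open_measurable.
        move=> u /=; rewrite in_itv/= => /andP[au ub]; apply: dU => /=.
        by rewrite /ball/= ltr_norml; apply/andP; split; lra.
      exists d => //; split; first by move=> b /andP[? ?]; apply: null; lra.
      by move=> a a0 /andP[? ?]; apply: null; lra.
    - by rewrite /Q addr0 set_itv_ge ?measure0// -leNgt bnd_simp.
    rewrite /Q; apply/eqP; rewrite eq_le measure_ge0 andbT.
    apply: (@le_trans _ _ (z (`]y, y + a] `|` `]y + a, y + b])%classic)).
      apply: le_measure; rewrite ?inE//; first exact: measurableU.
      move=> u /=; rewrite !in_itv/= => /andP[yu ub].
      by have [ua|au] := leP u (y + a); [left|right]; rewrite ?yu ?ub.
    apply: le_trans (measureU2 _ _ _) _ => //.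
    by rewrite [X in (X + _)%E](_ : _ = 0%E)// [X in (_ + X)%E](_ : _ = 0%E)// adde0.
  apply/eqP; rewrite eq_le tail_ge0 andbT leNgt; apply/negP => zy0.
  have [n zn] := tail_infty z zy0.
  have [t nt [t0 Qt]] := H (n%:R - y).
  suff : tail z y <= tail z (y + t).
    have : tail z (y + t) <= tail z n%:R by apply: le_tail; lra.
    lra.
  rewrite /tail fine_le// ?m1_fin//.
  apply: (@le_trans _ _ (z (`]y, y + t] `|` `]y + t, +oo[)%classic)).
    apply: le_measure; rewrite ?inE//; first exact: measurableU.
    move=> u /=; rewrite !in_itv/= !andbT => yu.
    by have [ua|au] := leP u (y + t); [left|right]; rewrite ?yu.
  apply: le_trans (measureU2 _ _ _) _ => //.
  by rewrite [X in (X + _)%E](_ : _ = 0%E)// add0e.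
move=> zx; apply/eqP; rewrite eq_le tail_ge0 andbT leNgt; apply/negP => zx0.
have [h h0 hh] := tail_right z x zx0.
have : tail z (x + h) = 0.
  by apply: tail0; apply: le_lt_trans zx _; rewrite lte_fin ltrDl.
lra.
Qed.

Lemma lt_truncated_moment z (x y : R) : x < y -> 0 < tail z y ->
  truncated_moment z x < truncated_moment z y.
Proof.
move=> xy zy; have /andP[h _] := truncated_moment_slope z (ltW xy).
rewrite -subr_gt0; apply: lt_le_trans h; rewrite mulr_gt0//; lra.
Qed.

Lemma truncated_moment_tail0 z x : tail z x = 0 -> truncated_moment z x = first_moment z.
Proof.
move=> zx; apply/eqP; rewrite eq_le truncated_moment_le_first/= leNgt.
apply/negP => h; have e0 : 0 < first_moment z - truncated_moment z x by lra.
have [n hn] := truncated_moment_approx z e0.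
have [nx|/ltW xn] := leP n%:R x; first by have := le_truncated_moment z nx; lra.
have /andP[_] := truncated_moment_slope z xn; rewrite zx mulr0; lra.
Qed.

(** While work is left, the inverse is a point where the truncated moment crosses level [t] strictly
    on both sides, which is what locates the inverses of nearby measures. Once the work is exhausted
    the inverse may be 0, finite or infinite, and it only matters that no mass is left. *)
Variant inv_spec z t : Prop :=
| InvLt s of t < first_moment z & truncated_moment_inv z t = s%:E & 0 <= s
  & truncated_moment z s = t & (forall x, x < s -> truncated_moment z x < t)
  & (forall x, s < x -> t < truncated_moment z x)
| InvGe of first_moment z <= t & mass (served z t) = 0.

Lemma mass_null z : z setT = 0%E -> mass z = 0.
Proof. by rewrite m1_setT /mass => ->. Qed.

Lemma invP z t : 0 <= t -> inv_spec z t.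
Proof.
move=> t0; have [tw|wt] := ltP t (first_moment z).
  have z0 : z setT != 0%E.
    apply/negP => /eqP/mass_null/first_moment_null h; lra.
  pose A := [set x | [/\ 0 <= x, (x%:E < support_sup z)%E & truncated_moment z x = t]].
  have [s As] : A !=set0.
    have e0 : 0 < first_moment z - t by lra.
    have [n hn] := truncated_moment_approx z e0.
    have n0 : (0 : R) <= n%:R by [].
    have cF : {within `[0, n%:R], continuous (truncated_moment z)}.
      exact/continuous_subspaceT/truncated_moment_continuous.
    have [|c] := @IVT _ _ _ _ t n0 cF.
      rewrite truncated_moment0; apply/andP; split.
        by rewrite ge_min t0.
      by rewrite le_max (_ : t <= truncated_moment z n%:R) ?orbT//; lra.
    rewrite in_itv/= => /andP[c0 _] ct; exists c; split => //.
    rewrite ltNge; apply/negP => /tail_support/truncated_moment_tail0; lra.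
  have [s0 ss st] := xgetPex 0 (ex_intro _ s As : exists s, A s).
  set x := xget 0 A in s0 ss st; rename s0 into x0, ss into xs, st into xt.
  have [y sy xy] : exists2 y, msupport z y & x < y.
    have /ereal_sup_gt[_ [y sy <-]] := xs.
    by rewrite lte_fin => ?; exists y.
  (* The open half-line beyond [m] contains the support point [y], so the tail is positive up to
     [m], and the truncated moment increases strictly there. *)
  pose m := (x + y) / 2.
  have [xm my] : x < m /\ m < y by rewrite /m; split; lra.
  have tm0 : 0 < tail z m.
    apply: fine_gt0; rewrite ltey_eq m1_fin// andbT.
    apply: sy; first exact: interval_open.
    by rewrite /= in_itv/= andbT.
  have tx0 : 0 < tail z x by apply: lt_le_trans tm0 _; apply/le_tail/ltW.
  apply: (InvLt (s := x)) => //.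
  - by rewrite /truncated_moment_inv (negbTE z0) tw.
  - by move=> u ux; rewrite -xt; exact: lt_truncated_moment.
  - move=> u xu; rewrite -xt; have [um|mu] := leP u m.
      by apply: lt_truncated_moment => //; apply: lt_le_trans tm0 _; exact: le_tail.
    apply: (@lt_le_trans _ _ (truncated_moment z m)); first exact: lt_truncated_moment.
    exact/le_truncated_moment/ltW.
apply: InvGe => //; rewrite /served /truncated_moment_inv ltNge wt/=.
(* Whatever form the inverse takes once the work is exhausted, the shift retains only the points of
   some null set [A]. *)
have sub (x : \bar R) (A : set R) : measurable A ->
    z A = 0%E -> ([set y : R | (x < y%:E)%E] `<=` A) ->
    mass (M1_shift z x) = 0.
  move=> mA zA xA; rewrite /mass /= /shift_mass.
  have mx : measurable [set y : R | (x < y%:E)%E].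
    by rewrite -[X in measurable X]setTI; apply: emeasurable_fun_o_infty => //; exact/measurable_EFinP.
  have mp : measurable ((fun y : R => y - fine x) @^-1` (@Rplus R)).
    rewrite -[X in measurable X]setTI.
    have : measurable_fun setT (fun y : R => y - fine x) by exact: measurable_funB.
    by apply => //; exact: measurable_Rplus.
  rewrite (_ : z _ = 0%E)//; apply/eqP; rewrite eq_le measure_ge0 andbT -zA.
  apply: le_measure; rewrite ?inE//; first exact: measurableI.
  by move=> u /= [_]; exact: xA.
case: ifPn => [/eqP z0|z0]; first exact: (sub _ setT).
case zS : (support_sup z) => [s| |].
- have ts : tail z s = 0 by apply: tail_support; rewrite zS.
  apply: (sub _ `]s, +oo[%classic) => //.
    by rewrite -[LHS]fineK ?m1_fin//; congr EFin.
  by move=> u /=; rewrite lte_fin in_itv/= andbT.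
- apply: (sub _ set0) => //.
- have : tail z (-1) = 0 by apply: tail_support; rewrite zS leNye.
  rewrite tail_neg; last by rewrite ltrN10.
  move=> mz; apply: (sub _ setT) => //.
  by rewrite m1_setT -[LHS](fineK (m1_fin z (@measurable_Rplus R))); congr EFin.
Qed.

Lemma first_moment_served z t : 0 <= t ->
  first_moment (served z t) = Num.max (first_moment z - t) 0.
Proof.
move=> t0; case: (invP z t0) => [s tw E s0 st _ _|wt m0].
  by rewrite /served E first_moment_shift// st max_l// subr_ge0 ltW.
by rewrite first_moment_null// max_r// subr_le0.
Qed.

Lemma le_mass_served z t : 0 <= t -> mass (served z t) <= mass z.
Proof.
move=> t0; case: (invP z t0) => [s tw E s0 st _ _|wt m0].
  by rewrite /served E mass_shift// tail_le_mass.
by rewrite m0 mass_ge0.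
Qed.

Lemma le_mass_served2 z t t' : 0 <= t -> t <= t' ->
  mass (served z t') <= mass (served z t).
Proof.
move=> t0 tt'; have t'0 := le_trans t0 tt'.
case: (invP z t'0) => [s' tw' E' s'0 st' _ _|wt m0]; last by rewrite m0 mass_ge0.
case: (invP z t0) => [s tw E s0 st h _|wt m0]; last lra.
rewrite /served E E' !mass_shift//; apply: le_tail.
by rewrite leNgt; apply/negP => /h; lra.
Qed.

Lemma tail_served z t : 0 <= t -> tail (served z t) 0 = mass (served z t).
Proof.
move=> t0; case: (invP z t0) => [s tw E s0 st h _|wt m0]; last first.
  by apply/eqP; rewrite eq_le tail_le_mass m0 tail_ge0.
rewrite /served E mass_shift// /tail /= /shift_mass; congr (fine (z _)).
apply/seteqP; split => y /=; rewrite !in_itv/= !andbT lte_fin subr_gt0; first by case.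
by move=> sy; split.
Qed.

(** Without mass at 0, the mass is the slope of the truncated moment at 0. Truncated moments then
    bound it from below, whence its lower semicontinuity. *)
Lemma mass_from_truncated_moment z (e : R) : tail z 0 = mass z -> 0 < e ->
  exists2 h, 0 < h & mass z - e < truncated_moment z h / h.
Proof.
move=> z0 e0; have [h h0] := tail_right z 0 e0; rewrite add0r z0 => hh.
exists h => //; apply: (lt_le_trans hh); rewrite ler_pdivlMr// mulrC.
have /andP[+ _] := truncated_moment_slope z (ltW h0).
by rewrite truncated_moment0 !subr0.
Qed.

Lemma truncated_moment_le_mass z h : 0 <= h -> truncated_moment z h <= h * mass z.
Proof.
move=> h0; have := truncated_moment_lip z 0 h.
by rewrite truncated_moment0 !subr0 (ger0_norm h0) => /(le_trans (ler_norm _)).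
Qed.

(** An atomless tail cannot drop to 0 at the very point [x0] where it first gets below [e]; by right
    continuity it is still positive a little further on. *)
Lemma tail_approx z (e : R) : (forall x, z [set x] = 0%E) -> 0 < mass z -> 0 < e ->
  exists x y, [/\ y < x, 0 < tail z x & tail z y < e].
Proof.
(* The bound -2 keeps [A] bounded below even if [mass z < e]. It leaves room for the step to the
   left of [x0], made by at most 1 and only when [x0 >= 0]. *)
move=> z0 mz e0; pose A := [set x : R | -2 <= x /\ tail z x < e].
have [n zn] := tail_infty z e0.
have A0 : A !=set0 by exists n%:R; split => //; apply: (@le_trans _ _ 0) => //; lra.
have hA : has_inf A by split => //; exists (-2) => x [].
set x0 := inf A.
have [h h0 hh] : exists2 h, 0 < h & 0 < tail z (x0 + h).
  suff x0p : 0 < tail z x0.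
    by have [h h0 hh] := tail_right z x0 x0p; exists h => //; lra.
  rewrite ltNge; apply/negP => xle.
  have x00 : tail z x0 = 0 by apply/eqP; rewrite eq_le xle tail_ge0.
  have x0N : 0 <= x0.
    rewrite leNgt; apply/negP => x0n; move: x00; rewrite tail_neg//; lra.
  have [h h0] := tail_left (z0 x0) e0; rewrite x00 add0r => hh.
  pose h' := Num.min h 1.
  have h'0 : 0 < h' by rewrite lt_min h0 ltr01.
  have : x0 <= x0 - h'.
    apply: ge_inf; first exact: hA.2.
    split; first by have h'1 : h' <= 1 by [rewrite ge_min lexx orbT]; lra.
    apply: le_lt_trans hh; apply: le_tail; rewrite lerD2l lerN2.
    by rewrite ge_min lexx.
  lra.
exists (x0 + h), (x0 + h / 2); split => //; first lra.
have h20 : 0 < h / 2 by rewrite divr_gt0.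
have [a [_ a1] a2] := inf_adherent h20 hA.
by apply: le_lt_trans a1; apply: le_tail; exact: ltW.
Qed.

Section cvg_served.
Variables (T : Type) (F : set_system T) (FF : Filter F).
Variables (zs : T -> M1 R) (ts : T -> R) (z : M1 R) (t : R).
Hypothesis cz : forall j, m1_coord j (zs s) @[s --> F] --> m1_coord j z.
Hypothesis ct : ts s @[s --> F] --> t.
Hypothesis t0 : 0 <= t.
Hypothesis ts0 : \forall s \near F, 0 <= ts s.

Let cF x : truncated_moment (zs s) x @[s --> F] --> truncated_moment z x.
Proof. exact: cvg_truncated_moment. Qed.

Lemma cvg_first_moment_served :
  first_moment (served (zs s) (ts s)) @[s --> F] --> first_moment (served z t).
Proof.
have cw : first_moment (zs s) @[s --> F] --> first_moment z by exact: (cz (j := 0)).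
rewrite first_moment_served//.
apply: cvg_trans (_ : Num.max (first_moment (zs s) - ts s) 0 @[s --> F] --> _).
  apply: near_eq_cvg; near=> s; rewrite first_moment_served//; near: s; exact: ts0.
apply/cvgrPdist_lt => e e0.
apply: filterS (near_dist_subr FF cw ct e0) => s.
rewrite !ltr_norml => /andP[? ?].
by case: (leP (first_moment z - t) 0) => ?; case: (leP (first_moment (zs s) - ts s) 0) => ?;
  apply/andP; split; lra.
Unshelve. all: by end_near. Qed.

(** The strict inequalities at [x < s < x'] persist for nearby measures and trap their inverses
    between [x] and [x']; continuity of the truncated moment at [s + q] concludes. In the exhausted
    case the first moment, which tends to 0, dominates. *)
Lemma cvg_truncated_moment_served q : 0 <= q ->
  truncated_moment (served (zs s) (ts s)) q @[s --> F] --> truncated_moment (served z t) q.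
Proof.
move=> q0; apply/cvgrPdist_lt => e e0.
case: (invP z t0) => [s tw E s0 st hl hr|wt m0]; last first.
  rewrite (truncated_moment_null _ m0).
  have /cvgrPdist_lt/(_ _ e0) := cvg_first_moment_served.
  rewrite (first_moment_null m0); apply: filterS2 ts0 => u u0.
  rewrite !sub0r !normrN !ger0_norm ?first_moment_ge0 ?truncated_moment_ge0//.
  by apply: le_lt_trans; exact: truncated_moment_le_first.
have := truncated_moment_continuous (z := z) (x := s + q).
move=> /cvgrPdist_lt/(_ (e / 4)); rewrite divr_gt0// => /(_ isT) /nbhs_ballP[d /= d0 hd].
pose x := s - d / 2; pose x' := s + d / 2.
have xt : truncated_moment z x < t by apply: hl; rewrite /x; lra.
have x't : t < truncated_moment z x' by apply: hr; rewrite /x'; lra.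
have hx : `|truncated_moment z (s + q) - truncated_moment z (x + q)| < e / 4.
  by apply: hd; rewrite /ball/= /x ger0_norm; lra.
have hx' : `|truncated_moment z (s + q) - truncated_moment z (x' + q)| < e / 4.
  by apply: hd; rewrite /ball/= /x' ler0_norm; lra.
have e4 : 0 < e / 4 by rewrite divr_gt0.
near=> u.
have u0 : 0 <= ts u by near: u; exact: ts0.
have tu : `|t - ts u| < e / 4.
  by near: u; move/cvgrPdist_lt : ct; apply.
have xu : truncated_moment (zs u) x < ts u.
  near: u; exact: (near_ltr_cvg FF (@cF x) ct xt).
have x'u : ts u < truncated_moment (zs u) x'.
  near: u; exact: (near_ltr_cvg FF ct (@cF x') x't).
have c1 : `|truncated_moment z (x + q) - truncated_moment (zs u) (x + q)| < e / 4.
  by near: u; move/cvgrPdist_lt : (@cF (x + q)); apply.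
have c2 : `|truncated_moment z (x' + q) - truncated_moment (zs u) (x' + q)| < e / 4.
  by near: u; move/cvgrPdist_lt : (@cF (x' + q)); apply.
case: (invP (zs u) u0) => [su tuw Eu su0 su_t _ _|wtu _]; last first.
  have := le_trans (truncated_moment_le_first (zs u) x') wtu.
  by rewrite leNgt x'u.
rewrite /served E Eu !truncated_moment_shift// st su_t.
have xsu : x <= su.
  by rewrite leNgt; apply/negP => /ltW/(le_truncated_moment (zs u)); rewrite su_t leNgt xu.
have sux' : su <= x'.
  by rewrite leNgt; apply/negP => /ltW/(le_truncated_moment (zs u)); rewrite su_t leNgt x'u.
have l1 : truncated_moment (zs u) (x + q) <= truncated_moment (zs u) (su + q).
  by apply: le_truncated_moment; rewrite lerD2r.
have l2 : truncated_moment (zs u) (su + q) <= truncated_moment (zs u) (x' + q).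
  by apply: le_truncated_moment; rewrite lerD2r.
move: hx hx' c1 c2 tu l1 l2; clear; rewrite !ltr_norml.
move=> /andP[? ?] /andP[? ?] /andP[? ?] /andP[? ?] /andP[? ?] ? ?.
by apply/andP; split; lra.
Unshelve. all: by end_near. Qed.

Lemma mass_served_lower (e : R) : 0 < e ->
  \forall s \near F, mass (served z t) - e < mass (served (zs s) (ts s)).
Proof.
move=> e0; have e2 : 0 < e / 2 by rewrite divr_gt0.
have [h h0 hh] := mass_from_truncated_moment (tail_served z t0) e2.
have /cvgrPdist_lt/(_ (h * (e / 2)))/(_ (mulr_gt0 h0 e2)) :=
  cvg_truncated_moment_served (ltW h0).
apply: filterS => u; rewrite ltr_norml => /andP[_ hu].
have := truncated_moment_le_mass (served (zs u) (ts u)) (ltW h0).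
move: hh; rewrite ltr_pdivlMr// => hh hm.
rewrite -(ltr_pM2l h0); lra.
Qed.

(** Lower semicontinuity is [mass_served_lower]. The upper bound needs a point [y] not yet served
    whose tail hardly exceeds the remaining mass, and only the absence of an atom at the current
    level provides it. *)
Lemma cvg_mass_served : (forall x, z [set x] = 0%E) ->
  mass (served (zs s) (ts s)) @[s --> F] --> mass (served z t).
Proof.
move=> z0.
suff upper e : 0 < e -> \forall s \near F, mass (served (zs s) (ts s)) < mass (served z t) + e.
  apply/cvgrPdist_lt => e e0; apply: filterS2 (upper _ e0) (mass_served_lower e0) => s.
  by move=> ? ?; rewrite ltr_norml; apply/andP; split; lra.
move=> e0; have [mz0|mz] := leP (mass z) 0.
  have mz : mass z = 0 by apply/eqP; rewrite eq_le mz0 mass_ge0.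
  have := near_dist_lt FF (cvg_mass FF cz) e0.
  apply: filterS2 ts0 => u u0; rewrite mz sub0r normrN ger0_norm ?mass_ge0// => hu.
  by have := le_mass_served (zs u) u0; have := mass_ge0 (served z t); lra.
(* Nearby inverses are at least [x], and the tail at [x] is at most the slope of the truncated
   moment between [y] and [x]. This slope converges to that of [z], which is at most [tail z y]. *)
have key x y : y < x -> truncated_moment z x < t -> tail z y < mass (served z t) + e ->
    \forall s \near F, mass (served (zs s) (ts s)) < mass (served z t) + e.
  move=> yx xt zy.
  pose d := mass (served z t) + e - tail z y.
  have d0 : 0 < (x - y) * (d / 2) by rewrite mulr_gt0// ?divr_gt0// /d; lra.
  near=> u.
  have u0 : 0 <= ts u by near: u; exact: ts0.
  have xu : truncated_moment (zs u) x < ts u.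
    near: u; exact: (near_ltr_cvg FF (@cF x) ct xt).
  have c1 : `|(truncated_moment z x - truncated_moment z y) -
      (truncated_moment (zs u) x - truncated_moment (zs u) y)| < (x - y) * (d / 2).
    by near: u; exact: (near_dist_subr FF (@cF x) (@cF y) d0).
  case: (invP (zs u) u0) => [su tuw Eu su0 su_t _ _|wtu ->]; last first.
    by have := mass_ge0 (served z t); lra.
  rewrite /served Eu mass_shift//.
  have xsu : x <= su.
    by rewrite leNgt; apply/negP => /ltW/(le_truncated_moment (zs u)); rewrite su_t leNgt xu.
  apply: le_lt_trans (le_tail _ xsu) _.
  have /andP[a1 _] := truncated_moment_slope (zs u) (ltW yx).
  have /andP[_ a2] := truncated_moment_slope z (ltW yx).
  have xy0 : 0 < x - y by lra.
  rewrite -(ltr_pM2l xy0); move: c1; rewrite ltr_norml => /andP[? ?].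
  have : (x - y) * d = (x - y) * (mass (served z t) + e) - (x - y) * tail z y.
    by rewrite /d mulrBr.
  by rewrite -/(served z t); move: (d0); lra.
case: (invP z t0) => [s tw E s0 st hl hr|wt m0]; last first.
  (* With no work left the level has no definite position. The midpoint lies where the tail is
     already small but the truncated moment is still below [first_moment z]. *)
  have [x [y [yx tx ty]]] := tail_approx z0 mz e0.
  apply: (key ((x + y) / 2) y); [lra| |by rewrite m0 add0r].
  have : truncated_moment z ((x + y) / 2) < truncated_moment z x.
    by apply: lt_truncated_moment => //; lra.
  by have := truncated_moment_le_first z x; lra.
have [h h0 hh] := tail_left (z0 s) e0.
apply: (key (s - h / 2) (s - h)); [lra|by apply: hl; lra|].
by rewrite /served E mass_shift.
Unshelve. all: by end_near. Qed.

Lemma cvg_coord_of (zs' : T -> M1 R) z' :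
  first_moment (zs' s) @[s --> F] --> first_moment z' ->
  mass (zs' s) @[s --> F] --> mass z' ->
  (forall q, 0 <= q -> truncated_moment (zs' s) q @[s --> F] --> truncated_moment z' q) ->
  forall j, m1_coord j (zs' s) @[s --> F] --> m1_coord j z'.
Proof.
move=> cw cm ctm [|i]//=; set q := ratr _; have [q0|/ltW q0] := leP 0 q; first exact: ctm.
rewrite truncated_moment_le0//; under eq_fun do rewrite truncated_moment_le0//.
by apply: cvgM => //; exact: cvg_cst.
Qed.

Lemma cvg_served : (forall x, z [set x] = 0%E) ->
  forall j, m1_coord j (served (zs s) (ts s)) @[s --> F] --> m1_coord j (served z t).
Proof.
move=> z0; apply: cvg_coord_of.
- exact: cvg_first_moment_served.
- exact: cvg_mass_served.
- exact: cvg_truncated_moment_served.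
Qed.

End cvg_served.

(* Joint continuity, made uniform over [0, T] by compactness. *)
Lemma m1_close_served z T k : (forall x, z [set x] = 0%E) -> 0 <= T ->
  exists n, forall z' t t', m1_close n z' z -> 0 <= t <= T -> 0 <= t' ->
    `|t' - t| < 2^-1 ^+ n -> m1_close k (served z' t') (served z t).
Proof.
move=> z0 T0.
pose F := filter_from [set: nat] (fun n => [set zt : M1 R * R |
  m1_close n zt.1 z /\ `|zt.2| < 2^-1 ^+ n]).
have expn_le (m n : nat) : (m <= n)%N -> (2^-1 ^+ n : R) <= 2^-1 ^+ m.
  by move=> mn; rewrite ler_wiXn2l// invf_le1// ler1n.
have FF : Filter F.
  apply: filter_from_filter; first by exists 0%N.
  move=> i j _ _; exists (maxn i j) => // -[z' e] /= [h he].
  split; split; try (by apply: m1_close_le h; rewrite ?leq_maxl ?leq_maxr);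
    by apply: (lt_le_trans he); apply: expn_le; rewrite ?leq_maxl ?leq_maxr.
have Fz j : m1_coord j zt.1 @[zt --> F] --> m1_coord j z.
  by apply: (m1_close_cvg _ (fun zt : M1 R * R => zt.1) z).1 => n; exists n => // zt [].
have Fe : zt.2 @[zt --> F] --> (0 : R).
  apply/cvgrPdist_lt => e /half_exp_lt[n ne]; exists n => // -[z' u] /= [_].
  by rewrite sub0r normrN => /lt_trans; apply.
have /compact_near_coveringP cpt := @segment_compact R 0 T.
have [|n _ hn] := cpt _ F (fun zt t => 0 <= t -> 0 <= t + zt.2 ->
    m1_close k (served zt.1 (t + zt.2)) (served z t)) FF.
- move=> t; rewrite /= in_itv/= => /andP[t0 tT].
  (* Negative times are excluded, since [served] is controlled at nonnegative ones only. *)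
  pose G := within [set p : R * (M1 R * R) | 0 <= p.1 /\ 0 <= p.1 + p.2.2]
    (filter_prod (nbhs t) F).
  have G1 : p.1 @[p --> G] --> t.
    apply: cvg_trans (cvg_fst (F := nbhs t) (G := F)).
    by apply: cvg_app; exact: cvg_within.
  have G2 : p.2 @[p --> G] --> F.
    apply: cvg_trans (cvg_snd (F := nbhs t) (G := F)).
    by apply: cvg_app; exact: cvg_within.
  have Gz j : m1_coord j p.2.1 @[p --> G] --> m1_coord j z.
    exact: cvg_comp G2 (Fz j).
  have Gt : p.1 + p.2.2 @[p --> G] --> t.
    rewrite -[X in _ --> X]addr0; apply: cvgD => //; exact: cvg_comp G2 Fe.
  have Gpos (Q : R * (M1 R * R) -> Prop) :
      (forall p, 0 <= p.1 -> 0 <= p.1 + p.2.2 -> Q p) -> \forall p \near G, Q p.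
    by move=> h; rewrite /G near_withinE; apply: nearW => p [? ?]; exact: h.
  have c1 : \forall p \near G, m1_close k.+1 (served p.2.1 (p.1 + p.2.2)) (served z t).
    apply: (m1_close_cvg _ _ _).2; apply: cvg_served => //.
    by apply: Gpos.
  (* The near-covering property lets the reference time [p.1] vary as well, so the unperturbed state
     is also compared with the one at the centre [t]. *)
  have c2 : \forall p \near G, m1_close k.+1 (served z p.1) (served z t).
    apply: (m1_close_cvg _ _ _).2; apply: cvg_served => //; last by apply: Gpos.
    by move=> j; exact: cvg_cst.
  refine (@filterS _ (filter_prod (nbhs t) F) _ _ _ _ (filterI c1 c2)).
  move=> -[t' [z' e]] /= h t'0 te0.
  by have [] := h (conj t'0 te0) => h1 h2; apply: m1_close_trans h1 (m1_close_sym h2).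
exists n => z' t t' zz' /andP[t0 tT] t'0 tt'.
have := hn (z', t' - t) (conj zz' tt') t; rewrite /= in_itv/= t0 tT addrC subrK.
exact.
Qed.

End served.

(** * One-sided limits of the service path *)

Section m1_add.
Variables (R : realType) (z1 z2 : M1 R).

Let add : {measure set R -> \bar R} := measure_add z1 z2.

Let addE A : add A = (z1 A + z2 A)%E.
Proof. by rewrite /add /= /measure_add /msum/= !big_ord_recl big_ord0 adde0. Qed.

Let neg : add `]-oo, 0[%classic = 0%E.
Proof. by rewrite addE [X in (X + _)%E]m1_neg [X in (_ + X)%E]m1_neg adde0. Qed.

Let fin : (add setT < +oo)%E.
Proof. by rewrite addE lte_add_pinfty ?m1_finite. Qed.

Let mom : (\int[add]_(x in `[0%R, +oo[) x%:E < +oo)%E.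
Proof.
rewrite ge0_integral_measure_add//.
  by rewrite lte_add_pinfty ?m1_moment.
by move=> x /=; rewrite in_itv/= andbT lee_fin.
Qed.

Definition M1_add : M1 R := MkM1 neg fin mom.

Lemma pairing_add f : linear_growth f -> (forall x, 0 <= x -> 0 <= f x) ->
  pairing f M1_add = pairing f z1 + pairing f z2.
Proof.
move=> hf f0; rewrite /pairing /Rintegral /= ge0_integral_measure_add//; last 2 first.
- by move=> x /=; rewrite in_itv/= andbT lee_fin; exact: f0.
- by apply/measurable_EFinP; exact: hf.1.
by rewrite fineD//; apply: (integrable_fin_num (@measurable_Rplus R)); exact: linear_growth_integrable.
Qed.

Lemma mass_add : mass M1_add = mass z1 + mass z2.
Proof.
by rewrite -[LHS]mul1r -pairing_cst pairing_add// !pairing_cst !mul1r.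
Qed.

Lemma first_moment_add : first_moment M1_add = first_moment z1 + first_moment z2.
Proof. by rewrite /first_moment pairing_add. Qed.

Lemma truncated_moment_add q : 0 <= q ->
  truncated_moment M1_add q = truncated_moment z1 q + truncated_moment z2 q.
Proof. by move=> q0; rewrite /truncated_moment pairing_add// => x x0; rewrite le_min x0. Qed.

End m1_add.

Section served_cadlag.
Variable R : realType.
Implicit Types z : M1 R.

Lemma m1_coord_scale j z c : 0 <= c -> m1_coord j (M1_scale c z) = c * m1_coord j z.
Proof.
by case: j => [|j] c0; rewrite /= ?first_moment_scale ?truncated_moment_scale.
Qed.

Lemma cvg_M1_scale (T : Type) (F : set_system T) (FF : Filter F) (zs : T -> M1 R) z c :
  0 <= c -> zs @ F --> z -> M1_scale c (zs s) @[s --> F] --> M1_scale c z.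
Proof.
move=> c0 /cvg_M1P h; apply/cvg_M1P => j; rewrite m1_coord_scale//.
under eq_fun do rewrite m1_coord_scale//.
by apply: cvgM; [exact: cvg_cst|exact: h].
Qed.

(* The left limits of t |-> served z t may charge 0, where no truncated moment
   sees it. *)
Definition atom0 (c : R) : M1 R := M1_scale c (point_masses (fun=> 0) 0 1).

Lemma mass_atom0 c : 0 <= c -> mass (atom0 c) = c.
Proof. by move=> c0; rewrite /atom0 mass_scale// mass_point_masses subn0 mulr1. Qed.

Lemma first_moment_atom0 c : 0 <= c -> first_moment (atom0 c) = 0.
Proof.
move=> c0; rewrite /atom0 first_moment_scale// first_moment_point_masses.
by rewrite big_nat1 maxxx mulr0.
Qed.

Lemma truncated_moment_atom0 c q : 0 <= c -> 0 <= q -> truncated_moment (atom0 c) q = 0.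
Proof.
move=> c0 q0; rewrite /atom0 truncated_moment_scale// truncated_moment_point_masses//.
by rewrite big_nat1 maxxx min_l// mulr0.
Qed.

Variables (r a : R).
Hypothesis r0 : 0 < r.
(** In the batch started at time [a], the scaled path at time [s] has received service for
    [r * s - a]. *)
Let tau s := r * s - a.

Let tau_cvg t : tau s @[s --> t] --> tau t.
Proof. by apply: cvgB; [apply: cvgM; [exact: cvg_cst|exact: cvg_id]|exact: cvg_cst]. Qed.

Let tau_lt s s' : s < s' -> tau s < tau s'.
Proof. by move=> ss; rewrite /tau ltrD2r ltr_pM2l. Qed.

(** Here [z] may have atoms, being in particular the empirical profile of a batch. The mass
    decreases in time, which together with its lower semicontinuity yields right continuity. *)
Lemma served_cvg_right z t : 0 <= tau t ->
  served z (tau s) @[s --> t^'+] --> served z (tau t).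
Proof.
move=> t0; have ct : tau s @[s --> t^'+] --> tau t.
  by apply: cvg_trans (@tau_cvg t); apply: cvg_app; exact: cvg_within.
have near0 : \forall s \near t^'+, 0 <= tau s.
  by apply: filterS (nbhs_right_gt t) => s /tau_lt h; lra.
have cz j : m1_coord j z @[s --> t^'+] --> m1_coord j z by exact: cvg_cst.
apply/cvg_M1P; apply: cvg_coord_of => //.
- exact: cvg_first_moment_served.
- apply/cvgrPdist_lt => e e0.
  apply: filterS2 (nbhs_right_gt t) (mass_served_lower _ cz ct t0 near0 e0) => s ts hs.
  have := le_mass_served2 z t0 (ltW (tau_lt ts)).
  by rewrite ltr_norml => h; apply/andP; split; lra.
- move=> q q0; exact: cvg_truncated_moment_served.
Qed.

(** By monotonicity the mass has the left limit [inf A]. Its excess over the value at [t] belongs to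
    jobs completed exactly at [t], whose residual service times tend to 0, and is placed at 0 as an
    atom. *)
Lemma served_cvg_left z t : 0 < tau t ->
  exists l : M1 R, served z (tau s) @[s --> t^'-] --> l.
Proof.
move=> t0; have ct : tau s @[s --> t^'-] --> tau t.
  by apply: cvg_trans (@tau_cvg t); apply: cvg_app; exact: cvg_within.
have near0 : \forall s \near t^'-, 0 <= tau s.
  by apply: filterS (near_ltr_cvg _ (cvg_cst (0 : R)) ct t0) => s /ltW.
have cz j : m1_coord j z @[s --> t^'-] --> m1_coord j z by exact: cvg_cst.
pose A := [set mass (served z (tau s)) | s in [set s | 0 <= tau s /\ s < t]].
have [s0 [s00 s0t]] : exists s, 0 <= tau s /\ s < t.
  exists (t - tau t / r); split; last by rewrite ltrBlDr ltrDl divr_gt0.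
  have : r * (tau t / r) = tau t by rewrite mulrC divfK ?gt_eqF.
  by rewrite {3}/tau mulrBr; rewrite {2}/tau; lra.
have hA : has_inf A.
  split; first by exists (mass (served z (tau s0))), s0.
  by exists 0 => _ [s _ <-]; exact: mass_ge0.
pose c := inf A - mass (served z (tau t)).
have c0 : 0 <= c.
  rewrite subr_ge0; apply: lb_le_inf; first exact: hA.1.
  by move=> _ [s [st0 st] <-]; apply: le_mass_served2 => //; exact/ltW/tau_lt.
exists (M1_add (served z (tau t)) (atom0 c)).
apply/cvg_M1P; apply: cvg_coord_of => //.
- rewrite first_moment_add first_moment_atom0// addr0.
  by apply: cvg_first_moment_served => //; exact: ltW.
- rewrite mass_add mass_atom0// /c addrC subrK.
  apply/cvgrPdist_lt => e e0.
  have [_ [s [s1 st] <-] hs] := inf_adherent e0 hA.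
  apply: filterS2 (nbhs_left_gt st) (nbhs_left_lt t) => u su ut.
  have u0 : 0 <= tau u by apply: (le_trans s1); exact/ltW/tau_lt.
  have h1 : inf A <= mass (served z (tau u)).
    by apply: ge_inf; [exact: hA.2|exists u].
  have h2 := le_mass_served2 z s1 (ltW (tau_lt su)).
  by rewrite ltr_norml; apply/andP; split; lra.
- move=> q q0; rewrite truncated_moment_add// truncated_moment_atom0// addr0.
  by apply: cvg_truncated_moment_served => //; exact: ltW.
Qed.

End served_cadlag.

(** * Skorohod neighbourhoods and measurability *)

Section time_change.
Variable R : realType.
Implicit Types l : R -> R.

Lemma time_change_ge0 l t : time_change l -> 0 <= t -> 0 <= l t.
Proof.
move=> [_ li] t0; have : (l @` `[0, +oo[%classic) (l t).
  by exists t; rewrite //= in_itv/= t0.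
by rewrite li /= in_itv/= andbT.
Qed.

Lemma time_change_lt l s t : time_change l -> 0 <= s -> 0 <= t -> (l s < l t) = (s < t).
Proof. by move=> [lm _] s0 t0; apply: lm; rewrite in_itv/= andbT. Qed.

Lemma time_change_surj l s : time_change l -> 0 <= s -> exists2 t, 0 <= t & l t = s.
Proof.
move=> [_ li] s0; have : `[0, +oo[%classic s by rewrite /= in_itv/= s0.
by rewrite -li => -[t /=]; rewrite in_itv/= andbT; exists t.
Qed.

Lemma time_change_id : time_change (id : R -> R).
Proof. by split=> //; rewrite image_id. Qed.

Lemma time_changeP l :
  (forall s t, 0 <= s -> s < t -> l s < l t) -> (forall t, 0 <= t -> 0 <= l t) ->
  (forall s, 0 <= s -> exists2 t, 0 <= t & l t = s) -> time_change l.
Proof.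
move=> lm l0 ls; split.
  move=> s t; rewrite !in_itv/= !andbT => s0 t0.
  case: (ltgtP s t) => [st|ts|->]; last by rewrite ltxx.
    by rewrite lm.
  by apply/negbTE; rewrite -leNgt ltW// lm.
apply/seteqP; split => [_ [t /= + <-]|s /=]; rewrite !in_itv/= !andbT; first exact: l0.
by move=> /ls[t t0 <-]; exists t => //; rewrite /= in_itv/= t0.
Qed.

(** After [c] the time change is continued with the constant slope [k] that takes [c'] to [b]. On
    the new segment [l' t - t] is a convex combination of its values at the two ends, whence the
    last bound. *)
Lemma time_change_extend l (c a c' b : R) : time_change l -> 0 <= c -> l c = a ->
  c < c' -> a < b ->
  exists l', [/\ time_change l', (forall t, t <= c -> l' t = l t), l' c' = b,
    (forall t, c <= t -> t < c' -> a <= l' t < b) &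
    (forall t e, c <= t <= c' -> `|a - c| < e -> `|b - c'| < e -> `|l' t - t| < e)].
Proof.
move=> tl c0 lc cc' ab; pose k := (b - a) / (c' - c).
have k0 : 0 < k by rewrite divr_gt0 ?subr_gt0.
have kE : k * (c' - c) = b - a by rewrite divfK// gt_eqF// subr_gt0.
have a0 : 0 <= a by rewrite -lc; exact: time_change_ge0.
pose l' t := if t <= c then l t else a + k * (t - c).
have l'c t : c <= t -> l' t = a + k * (t - c).
  move=> ct; rewrite /l'; case: ifPn => // tc.
  have -> : t = c by apply/eqP; rewrite eq_le tc ct.
  by rewrite lc subrr mulr0 addr0.
exists l'; split.
- apply: time_changeP => [s t s0 st|t t0|s s0].
  + have [tc|ct] := leP t c.
      by rewrite /l' tc (le_trans (ltW st) tc) time_change_lt// (le_trans s0 (ltW st)).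
    have [sc|cs] := leP s c.
      apply: (@le_lt_trans _ _ a).
        rewrite /l' sc -lc leNgt time_change_lt// -?leNgt//.
      by rewrite l'c 1?ltW// ltrDl mulr_gt0// subr_gt0.
    by rewrite !l'c 1?ltW// ltrD2l ltr_pM2l// ltrD2r.
  + rewrite /l'; case: ifPn => [_|]; first exact: time_change_ge0.
    by rewrite -ltNge => ct; rewrite addr_ge0// mulr_ge0// ltW// subr_gt0.
  + have [sa|as_] := leP s a.
      have [t t0 ts] := time_change_surj tl s0; exists t => //; rewrite /l' ifT//.
      by rewrite leNgt -(time_change_lt tl)// lc ts -leNgt.
    exists (c + (s - a) / k); first by rewrite addr_ge0// divr_ge0// ?ltW// subr_gt0.
    rewrite l'c; last by rewrite lerDl divr_ge0// ?ltW// subr_gt0.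
    by rewrite addrAC subrr add0r mulrC divfK ?gt_eqF// addrC subrK.
- by move=> t tc; rewrite /l' tc.
- by rewrite l'c 1?ltW// kE addrC subrK.
- move=> t ct tc'; rewrite l'c// lerDl mulr_ge0// ?(ltW k0)// ?subr_ge0//=.
  have : k * (t - c) < k * (c' - c) by rewrite ltr_pM2l// ltrD2r.
  by rewrite kE; lra.
- move=> t e /andP[ct tc'] ea eb; rewrite l'c//.
  pose th := (t - c) / (c' - c).
  have th0 : 0 <= th by rewrite divr_ge0// subr_ge0// ltW.
  have th1 : th <= 1 by rewrite ler_pdivrMr ?subr_gt0// mul1r lerD2r.
  have thE : th * (c' - c) = t - c by rewrite divfK// gt_eqF// subr_gt0.
  have -> : k * (t - c) = th * (b - a) by rewrite -thE -kE mulrCA.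
  have -> : a + th * (b - a) - t = (1 - th) * (a - c) + th * (b - c').
    have -> : t = c + th * (c' - c) by rewrite thE addrC subrK.
    by rewrite !mulrBr !mulrBl; lra.
  have : `|a - c| * (1 - th) + `|b - c'| * th < e.
    have [->|/eqP thn] := th =P 1; first by rewrite subrr mulr0 add0r mulr1.
    have th1' : 0 < 1 - th by rewrite subr_gt0 lt_neqAle thn.
    have h2 : `|a - c| * (1 - th) < e * (1 - th) by rewrite ltr_pM2r.
    have h3 : `|b - c'| * th <= e * th by rewrite ler_wpM2r// ltW.
    by move: h2 h3; rewrite mulrBr mulr1; lra.
  apply: le_lt_trans; apply: le_trans (ler_normD _ _) _.
  have n1 : `|(1 - th) * (a - c)| = `|a - c| * (1 - th).
    by rewrite normrM ger0_norm 1?mulrC// subr_ge0.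
  have n2 : `|th * (b - c')| = `|b - c'| * th by rewrite normrM ger0_norm 1?mulrC.
  by rewrite n1 n2.
Qed.

End time_change.

Section skorohod_close.
Variable R : realType.
Implicit Types x y z : skorohod R (M1 R).

(** A J1 neighbourhood of [x] in which one integer controls the horizon, the deformation of time and
    the precision of the values. *)
Definition sk_close k x y := exists2 l : R -> R, time_change l &
  forall t, 0 <= t -> t <= k%:R -> `|l t - t| < 2^-1 ^+ k /\ m1_close k (y t) (x (l t)).

Lemma half_exp_le (m n : nat) : (m <= n)%N -> (2^-1 ^+ n : R) <= 2^-1 ^+ m.
Proof. by move=> mn; rewrite ler_wiXn2l// invf_le1// ler1n. Qed.

Lemma half_exp_le1 (n : nat) : (2^-1 ^+ n : R) <= 1.
Proof. by rewrite exprn_ile1// invf_le1// ler1n. Qed.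

Lemma half_exp_gt0 (n : nat) : 0 < (2^-1 ^+ n : R).
Proof. by rewrite exprn_gt0// invr_gt0. Qed.

(** Inverting the time change costs one unit of horizon: [l] moves points by at most 1, so the
    preimage of a time up to [k] is at most [k + 1]. *)
Lemma sk_close_sym k x y : sk_close k.+1 x y -> sk_close k y x.
Proof.
move=> [l tl h].
have inv s : exists t, 0 <= s -> 0 <= t /\ l t = s.
  have [s0|s0] := leP 0 s; last by exists 0.
  by have [t t0 ts] := time_change_surj tl s0; exists t.
pose l' s := projT1 (cid (inv s)).
have l'P s : 0 <= s -> 0 <= l' s /\ l (l' s) = s by exact: (projT2 (cid (inv s))).
exists l'.
  apply: time_changeP => [s t s0 st|t /l'P[]//|s s0].
    have [s'0 ls] := l'P s s0; have [t'0 lt] := l'P t (le_trans s0 (ltW st)).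
    by rewrite -(time_change_lt tl)// ls lt.
  exists (l s); first exact: time_change_ge0.
  have [ls0 lls] := l'P _ (time_change_ge0 tl s0).
  case: (ltgtP (l' (l s)) s) => //.
    by rewrite -(time_change_lt tl)// lls ltxx.
  by rewrite -(time_change_lt tl)// lls ltxx.
move=> s s0 sk; have [t0 lt] := l'P s s0; set t := l' s in t0 lt *.
have tk : t <= k.+1%:R.
  rewrite leNgt -(time_change_lt tl)// lt -leNgt.
  have [+ _] := h k.+1%:R (ler0n _ _) (lexx _).
  have := half_exp_le1 k.+1; rewrite ltr_norml -natr1.
  by move=> ? /andP[? ?]; lra.
have [h1 h2] := h t t0 tk; rewrite lt in h1 h2; split.
  by rewrite distrC (lt_le_trans h1)// half_exp_le.
by apply/m1_close_sym; apply: m1_close_le h2.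
Qed.

Lemma sk_close_trans k x y z : sk_close k.+1 x y -> sk_close k.+1 y z -> sk_close k x z.
Proof.
move=> [l tl hl] [m tm hm]; exists (l \o m).
  apply: time_changeP => [s t s0 st|t t0|s s0] /=.
  - by rewrite !(time_change_lt tl) ?(time_change_lt tm)//;
      try apply: (time_change_ge0 tm); rewrite // (le_trans s0)// ltW.
  - by apply: time_change_ge0 => //; exact: time_change_ge0.
  - have [u u0 <-] := time_change_surj tl s0.
    by have [t t0 <-] := time_change_surj tm u0; exists t.
move=> t t0 tk; have tk1 : t <= k.+1%:R by rewrite (le_trans tk)// ler_nat.
have [h1 h2] := hm t t0 tk1.
have mk : m t <= k.+1%:R.
  have := half_exp_le1 k.+1; move: h1; rewrite ltr_norml -natr1.
  by move=> /andP[? ?]; lra.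
have [h3 h4] := hl (m t) (time_change_ge0 tm t0) mk.
split; last exact: m1_close_trans h2 h4.
move: h1 h3; rewrite /= !exprS !ltr_norml => /andP[? ?] /andP[? ?].
by apply/andP; split; lra.
Qed.

Lemma cadlag_near (x : R -> M1 R) t k : cadlag x -> 0 <= t ->
  exists2 d, 0 < d & exists p : M1 R,
    (forall s, t <= s < t + d -> m1_close k (x s) (x t)) /\
    (forall s, 0 <= s -> t - d < s < t -> m1_close k (x s) p).
Proof.
move=> cx t0; have [xr xl] := cx t t0.
have : \forall s \near t^'+, m1_close k (x s) (x t).
  exact: (xr _ (nbhs_m1_close (x t) k)).
move=> /nbhs_ballP[d1 /= d10 h1].
have [d2 d20 [p hp]] : exists2 d, 0 < d & exists p : M1 R,
    forall s, 0 <= s -> t - d < s < t -> m1_close k (x s) p.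
  move: t0; rewrite le_eqVlt => /orP[/eqP<-|/xl[p hp]].
    by exists 1 => //; exists (x 0) => s s0 /andP[_]; lra.
  have : \forall s \near t^'-, m1_close k (x s) p.
    exact: (hp _ (nbhs_m1_close p k)).
  move=> /nbhs_ballP[d2 /= d20 h2]; exists d2 => //; exists p => s s0 /andP[ds st].
  by apply: h2 => //; rewrite /ball/= ltr_norml; apply/andP; split; lra.
exists (Num.min d1 d2); first by rewrite lt_min d10.
exists p; split.
  move=> s /andP[]; rewrite le_eqVlt => /orP[/eqP<- _|ts]; first exact: m1_close_refl.
  rewrite -ltrBlDl lt_min => /andP[sd _]; apply: h1 => //.
  by rewrite /ball/= ltr_norml; apply/andP; split; lra.
move=> s s0 /andP[+ st]; rewrite ltrBlDr -ltrBlDl lt_min => /andP[_ h].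
by apply: hp => //; rewrite st andbT; lra.
Qed.

(* A cadlag path is relatively compact on [0, T], hence any entourage contains a
   uniform [m1_close]-neighbourhood of its values there. *)
Lemma entourage_m1_close (x : R -> M1 R) (U : set (M1 R * M1 R)) (T : R) : cadlag x -> entourage U ->
  exists k, forall s (z : M1 R), 0 <= s <= T -> m1_close k z (x s) -> U (z, x s).
Proof.
move=> cx eU; have /compact_near_coveringP cpt := @segment_compact R 0 T.
have nb (p : M1 R) : exists k, forall z : M1 R, m1_close k z p -> split_ent U (z, p) /\ split_ent U (p, z).
  apply: m1_close_nbhs; have := entourage_split_ent eU => eV.
  apply: filterS2 (nbhs_entourage p eV) (nbhs_entourage p (entourage_inv eV)) => z'.
  by rewrite /xsection/= !inE => h1 h2; split.
have [|K _ hK] := cpt _ \oo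
    (fun k s => 0 <= s -> forall z : M1 R, m1_close k z (x s) -> U (z, x s)) _.
  move=> t; rewrite /= in_itv/= => /andP[t0 tT].
  have key (p : M1 R) : exists k, forall s (z : M1 R), m1_close k (x s) p -> m1_close k z (x s) ->
      U (z, x s).
    have [k hk] := nb p; exists k.+1 => s z h1 h2.
    apply: (entourage_split p eU); first exact: (hk _ (m1_close_trans h2 h1)).1.
    by apply: (hk _ _).2; apply: m1_close_le h1.
  have [k1 hk1] := key (x t).
  have [d1 d10 [p1 [h1 _]]] := cadlag_near k1 cx t0.
  have [k2 [d2 d20 h2]] : exists k2, exists2 d2, 0 < d2 & forall s (z : M1 R), 0 <= s -> t - d2 < s < t ->
      m1_close k2 z (x s) -> U (z, x s).
    move: t0; rewrite le_eqVlt => /orP[/eqP<-|t0].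
      by exists 0%N, 1 => // s z s0 /andP[_]; lra.
    have [l hl] := (cx t (ltW t0)).2 t0; have [k hk] := key l.
    have : \forall s \near t^'-, m1_close k (x s) l.
      exact: (hl _ (nbhs_m1_close l k)).
    move=> /nbhs_ballP[d /= d0 hd]; exists k, d => // s z s0 /andP[ds st].
    have hs : m1_close k (x s) l.
      by apply: (hd s _ st); rewrite /ball/= ltr_norml; apply/andP; split; lra.
    exact: (hk s z hs).
  have dm : 0 < Num.min d1 d2 by rewrite lt_min d10.
  exists ([set s | `|t - s| < Num.min d1 d2], [set k | (maxn k1 k2 <= k)%N]) => /=.
    split; first by apply/nbhs_ballP; exists (Num.min d1 d2).
    by exists (maxn k1 k2).
  move=> [s k] /= []; rewrite lt_min !ltr_norml => /andP[/andP[a1 b1] /andP[a2 b2]].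
  rewrite geq_max => /andP[k1k k2k] s0 z hz.
  have [ts|st] := leP t s.
    have hs : m1_close k1 (x s) (x t) by apply: h1; rewrite ts/=; lra.
    exact: (hk1 s z hs (m1_close_le k1k hz)).
  have st' : t - d2 < s < t by apply/andP; split; lra.
  exact: (h2 s z s0 st' (m1_close_le k2k hz)).
exists K => s z /andP[s0 sT] hz; have := hK K (leqnn K) s.
by rewrite /= in_itv/= s0 sT => /(_ isT isT); apply.
Qed.

Lemma sk_close_open (O : set (skorohod R (M1 R))) x : open O -> O x ->
  exists k, forall y, sk_close k x y -> O y.
Proof.
move=> oO Ox; have [T [e [U [e0 eU sO]]]] := oO x Ox.
(* The horizon is [T + 1] because [l] may take points of [[0, T]] past [T], by at most 1. *)
have [k1 hk1] := entourage_m1_close (T + 1) (@skorohod_cadlag _ _ x) eU.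
have [k2 hk2] := half_exp_lt e0.
pose k3 := (Num.truncn `|T|).+1.
pose k := maxn k1 (maxn k2 k3).
have [kk1 kk2 kk3] : [/\ (k1 <= k)%N, (k2 <= k)%N & (k3 <= k)%N].
  by rewrite /k !leq_max !leqnn !orbT.
exists k => y [l tl h]; apply: sO; exists l => // t /andP[t0 tT].
have Tk : T <= k%:R.
  apply: (le_trans (ler_norm T)); apply: (le_trans (ltW (truncnS_gt _))).
  by rewrite ler_nat.
have [h1 h2] := h t t0 (le_trans tT Tk).
split; first by apply: (lt_trans _ hk2); apply: (lt_le_trans h1); exact: half_exp_le.
apply: hk1; last exact: m1_close_le h2.
rewrite time_change_ge0//=; have := half_exp_le1 k; move: h1; rewrite ltr_norml.
by move=> /andP[? ?]; lra.
Qed.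

Lemma sk_close_open2 (O : set (skorohod R (M1 R) * skorohod R (M1 R)))
    (x : skorohod R (M1 R) * skorohod R (M1 R)) : open O -> O x ->
  exists k, forall y : skorohod R (M1 R) * skorohod R (M1 R), sk_close k x.1 y.1 -> sk_close k x.2 y.2 -> O y.
Proof.
move=> oO Ox; have : nbhs x O by exact: open_nbhs_nbhs.
case: x Ox => x1 x2 Ox [[A B] [/= nA nB] AB].
have [A' [oA' A'x] sA] : exists2 A', open_nbhs x1 A' & A' `<=` A.
  by move: nA; rewrite nbhsE => -[A' ? ?]; exists A'.
have [B' [oB' B'x] sB] : exists2 B', open_nbhs x2 B' & B' `<=` B.
  by move: nB; rewrite nbhsE => -[B' ? ?]; exists B'.
have [k1 h1] := sk_close_open oA' A'x; have [k2 h2] := sk_close_open oB' B'x.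
have mono k k' x y : (k <= k')%N -> sk_close k' x y -> sk_close k x y.
  move=> kk [l tl h]; exists l => // t t0 tk.
  have kk' : k%:R <= k'%:R :> R by rewrite ler_nat.
  have [h3 h4] := h t t0 (le_trans tk kk').
  split; first exact: (lt_le_trans h3 (half_exp_le kk)).
  exact: m1_close_le h4.
exists (maxn k1 k2) => -[y1 y2] /= hy1 hy2; apply: AB; split => /=.
  by apply: sA; apply: h1; apply: mono hy1; rewrite leq_maxl.
by apply: sB; apply: h2; apply: mono hy2; rewrite leq_maxr.
Qed.

End skorohod_close.

(** * Dyadic time grids and step paths *)

Section grid.
Variable R : realType.

Definition grid (m i : nat) : R := i%:R * 2^-1 ^+ m.

Definition grid_index (m : nat) (t : R) : nat := Num.truncn (t * 2 ^+ m).

Let two_exp_gt0 m : 0 < 2 ^+ m :> R. Proof. by rewrite exprn_gt0. Qed.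

Let gridE m i : grid m i * 2 ^+ m = i%:R.
Proof. by rewrite /grid -mulrA -exprMn mulVf// expr1n mulr1. Qed.

Lemma grid_le m (t : R) i : (grid m i <= t) = (i%:R <= t * 2 ^+ m).
Proof. by rewrite -(ler_pM2r (two_exp_gt0 m)) gridE. Qed.

Lemma grid_lt m (t : R) i : (t < grid m i) = (t * 2 ^+ m < i%:R).
Proof. by rewrite -(ltr_pM2r (two_exp_gt0 m)) gridE. Qed.

Lemma grid_ge0 m i : 0 <= grid m i.
Proof. by rewrite mulr_ge0// exprn_ge0. Qed.

Lemma gridS m i : grid m i.+1 = grid m i + 2^-1 ^+ m.
Proof. by rewrite /grid -natr1 mulrDl mul1r. Qed.

Lemma le_grid m i j : (grid m i <= grid m j) = (i <= j)%N.
Proof. by rewrite grid_le gridE ler_nat. Qed.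

Lemma grid_index_itv m (t : R) : 0 <= t ->
  grid m (grid_index m t) <= t < grid m (grid_index m t).+1.
Proof.
move=> t0; rewrite grid_le grid_lt; apply: truncn_itv.
by rewrite mulr_ge0// ltW.
Qed.

Lemma grid_index_eq m (t : R) i : grid m i <= t < grid m i.+1 -> grid_index m t = i.
Proof. by rewrite grid_le grid_lt; exact: truncn_def. Qed.

Lemma grid_ceil m (t : R) : 0 <= t -> exists i, t <= grid m i < t + 2^-1 ^+ m.
Proof.
move=> t0; have /andP[h1 h2] := grid_index_itv m t0.
have [e|ne] := eqVneq (grid m (grid_index m t)) t.
  by exists (grid_index m t); rewrite e lexx ltrDl exprn_gt0.
exists (grid_index m t).+1; rewrite (ltW h2) gridS ltrD2r.
by rewrite lt_neqAle ne.
Qed.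

Variable V : uniformType.

Lemma step_path_cadlag m (g : nat -> V) : cadlag (g \o grid_index m).
Proof.
move=> t t0; split.
  have /andP[h1 h2] := grid_index_itv m t0.
  apply: cvg_near_cst; apply: filterS2 (nbhs_right_gt t) (nbhs_right_lt h2) => s ts s2 /=.
  by congr g; apply: grid_index_eq; rewrite s2 andbT (le_trans h1)// ltW.
move=> t0'; have [[|i] /andP[ti it]] := grid_ceil m t0.
  by move: ti; rewrite /grid mul0r leNgt t0'.
have hi : grid m i < t by move: it; rewrite gridS ltrD2r.
exists (g i); apply: cvg_near_cst.
apply: filterS2 (nbhs_left_lt t) (nbhs_left_gt hi) => s st si /=.
by congr g; apply: grid_index_eq; rewrite (ltW si) (lt_le_trans st).
Qed.

Definition step_path m (g : nat -> V) : skorohod R V := MkSkorohod (@step_path_cadlag m g).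

End grid.

(** * Approximation of a path by its samples *)

Section sampling.
Variable R : realType.
Implicit Types x y : skorohod R (M1 R).

(** On a subdivision whose half-open pieces carry small oscillations of [x], the time change maps
    the first grid point after each division point to that division point. The samples seen by [y]
    on a segment then come from the piece of [x] it is compared with. [real_chain] builds
    subdivision and time change together. *)
Lemma sk_close_grid x k : exists M, forall m, (M <= m)%N -> forall y,
  (forall i t, grid R m i <= t < grid R m i.+1 -> t <= k%:R ->
     m1_close k.+1 (y t) (x (grid R m i))) -> sk_close k x y.
Proof.
pose P a b := forall s s', a <= s < b -> a <= s' < b -> m1_close k.+1 (x s) (x s').
pose Q (T : R) := exists M, forall m, (M <= m)%N -> forall y,
  (forall i t, grid R m i <= t < grid R m i.+1 -> t <= k%:R ->
     m1_close k.+1 (y t) (x (grid R m i))) ->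
  exists l i, [/\ time_change l, T <= grid R m i <= T + 2^-1 ^+ m, l (grid R m i) = T &
    forall t, 0 <= t -> t < grid R m i -> t <= k%:R ->
      `|l t - t| < 2^-1 ^+ k /\ m1_close k (y t) (x (l t))].
have [|||T kT [T0 [M hM]]] := @real_chain R P Q _ _ _ (k%:R + 1).
- move=> t t0; have [d d0 [p [hr hl]]] := cadlag_near k.+2 (@skorohod_cadlag _ _ x) t0.
  exists d => //; split.
    move=> b /andP[tb bt] s s' /andP[ts sb] /andP[ts' s'b].
    apply: (m1_close_trans (hr s _)); first by rewrite ts; lra.
    by apply/m1_close_sym/hr; rewrite ts'; lra.
  move=> a a0 /andP[da at_] s s' /andP[as_ st] /andP[as' s't].
  apply: (m1_close_trans (hl s _ _)); [lra|by rewrite st andbT; lra|].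
  by apply/m1_close_sym/hl; [lra|rewrite s't andbT; lra].
- exists 0%N => m _ y hy; exists id, 0%N; split => //.
  + exact: time_change_id.
  + by rewrite /grid mul0r lexx add0r exprn_ge0.
  + by rewrite /grid mul0r.
  + by move=> t t0; rewrite /grid mul0r; lra.
- move=> a b a0 ab [M hM] Pab.
  have ba : 0 < b - a by lra.
  have [n hn] := half_exp_lt ba.
  exists (maxn M (maxn n k.+1)) => m; rewrite !geq_max => /andP[Mm /andP[nm km]] y hy.
  have [l [i [tl /andP[ai ia] li hl]]] := hM m Mm y hy.
  have b0 : 0 <= b by lra.
  have [i' /andP[bi' i'b]] := grid_ceil m b0.
  have mn : (2^-1 ^+ m : R) <= 2^-1 ^+ n by exact: half_exp_le.
  have ii' : grid R m i < grid R m i' by lra.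
  have [l' [tl' l'l l'b l'ab l'd]] := time_change_extend tl (grid_ge0 _ _ _) li ii' ab.
  exists l', i'; split => //; first by rewrite bi' ltW.
  move=> t t0 ti' tk; have [ti|it] := ltP t (grid R m i).
    by rewrite l'l ?ltW//; exact: hl.
  have km1 : (2^-1 ^+ m : R) < 2^-1 ^+ k.
    apply: (le_lt_trans (half_exp_le R km)); rewrite exprS.
    by have := half_exp_gt0 R k; lra.
  split.
    apply: l'd; first by rewrite it ltW.
      by rewrite ler0_norm; lra.
    by rewrite ler0_norm; lra.
  have /andP[j1 j2] := grid_index_itv m t0; set j := grid_index m t in j1 j2.
  have jx : m1_close k.+1 (y t) (x (grid R m j)) by apply: hy => //; rewrite j1.
  apply: (m1_close_trans jx); apply: Pab; last exact: l'ab.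
  (* The grid point before [t] lies between the grid points [i] and [i' - 1], hence in [[a, b[]. *)
  have ij : (i <= j)%N.
    by rewrite -ltnS ltnNge -(le_grid R m) -ltNge (le_lt_trans it).
  have ji' : (j.+1 <= i')%N.
    by rewrite ltnNge -(le_grid R m) -ltNge (le_lt_trans j1).
  apply/andP; split; first by rewrite (le_trans ai)// le_grid.
  by move: ji'; rewrite -(le_grid R m) gridS; lra.
exists M => m Mm y hy; have [l [i [tl /andP[Ti _] li hl]]] := hM m Mm y hy.
by exists l => // t t0 tk; apply: hl => //; lra.
Qed.

(* A representative of a cell of the partition of the space of measures by the
   integer parts of 2^m times the first m + 1 coordinates. *)
Definition cell_rep m (f : nat -> int) : M1 R :=
  xget (point_masses (fun=> 0) 0 0)
    [set z : M1 R | forall j, (j <= m)%N -> Num.floor (2 ^+ m * m1_coord j z) = f j].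

Lemma cell_rep_close m (f : nat -> int) (z : M1 R) :
  (forall j, (j <= m)%N -> Num.floor (2 ^+ m * m1_coord j z) = f j) ->
  m1_close m (cell_rep m f) z.
Proof.
pose A := [set z : M1 R | forall j, (j <= m)%N -> Num.floor (2 ^+ m * m1_coord j z) = f j].
move=> zf; have h : A (cell_rep m f) := xgetPex _ (ex_intro A z zf).
move=> j jm; have := h j jm; rewrite -(zf j jm); set a := m1_coord j (cell_rep m f); set b := m1_coord j z.
move=> e; have t0 : 0 < 2 ^+ m :> R by rewrite exprn_gt0.
have /andP[h1 h2] := floor_itv (2 ^+ m * a); have /andP[h3 h4] := floor_itv (2 ^+ m * b).
rewrite e in h1 h2; rewrite -(ltr_pM2l t0) -exprMn divff// expr1n.
rewrite -[X in X * `|_|](gtr0_norm t0) -normrM mulrBr ltr_norml.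
move: h2 h4; rewrite !intrD; move=> h2 h4; apply/andP; split; lra.
Qed.

End sampling.

(** * Measurability of path-valued maps *)

Section measurable_skorohod.
Variables (R : realType) (d : measure_display) (T : measurableType d).
Local Notation S := (skorohod R (M1 R) * skorohod R (M1 R))%type.

Lemma random_element_open (U : topologicalType) (X : T -> U) :
  (forall A, open A -> measurable (X @^-1` A)) -> random_element X.
Proof.
move=> h; apply: smallest_sub; last exact: h.
split=> [|A mA|F mF].
- by rewrite preimage_set0.
- by rewrite setTD preimage_setC; exact: measurableC.
- by rewrite preimage_bigcup; exact: bigcupT_measurable.
Qed.

Variable X : T -> S.
Hypothesis mX1 : forall t j, 0 <= t -> measurable_fun setT (fun w => m1_coord j ((X w).1 t)).
Hypothesis mX2 : forall t j, 0 <= t -> measurable_fun setT (fun w => m1_coord j ((X w).2 t)).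

Let sk2 k (x y : S) := sk_close k x.1 y.1 /\ sk_close k x.2 y.2.

Let N m := (m * 2 ^ m).+1.

Let idx m : finType := ('I_(N m).+1 * 'I_m.+1 * bool)%type.

Let sample m (w : T) (p : idx m) : R :=
  m1_coord p.1.2 ((if p.2 then (X w).1 else (X w).2) (grid R m p.1.1)).

(** Finitely many integers extracted from the two paths. [decode] turns them back into step paths,
    which are J1-close to the originals for large [m]. *)
Let key m (w : T) : {ffun idx m -> int} := [ffun p => Num.floor (2 ^+ m * sample w p)].

Let decode1 m (k : {ffun idx m -> int}) (b : bool) : skorohod R (M1 R) :=
  step_path R m (fun i => cell_rep R m (fun j => k (inord i, inord j, b))).

Let decode m (k : {ffun idx m -> int}) : S := (decode1 k true, decode1 k false).

Let decode1_close (w : T) k b : exists M, forall m, (M <= m)%N ->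
  sk_close k (if b then (X w).1 else (X w).2) (decode1 (key m w) b).
Proof.
set x := (if b then _ else _); have [M hM] := sk_close_grid x k.
exists (maxn M k.+1) => m; rewrite geq_max => /andP[Mm km]; apply: (hM m Mm) => i t it tk.
have tm : t <= m%:R by rewrite (le_trans tk)// ler_nat ltnW.
rewrite /decode1 /= (grid_index_eq it); apply: m1_close_le km _; apply: cell_rep_close => j jm.
have iN : (i <= N m)%N.
  rewrite -(ler_nat R); move: it => /andP[]; rewrite grid_le => it _.
  apply: (le_trans it); apply: (@le_trans _ _ (m%:R * 2 ^+ m)).
    by rewrite ler_wpM2r ?exprn_ge0.
  by rewrite /N -natrX -natrM ler_nat.
by rewrite /key ffunE /sample /= !inordK.
Qed.

Let decode_close (w : T) k : exists M, forall m, (M <= m)%N -> sk2 k (X w) (decode (key m w)).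
Proof.
have [M1 h1] := decode1_close w k true; have [M2 h2] := decode1_close w k false.
exists (maxn M1 M2) => m; rewrite geq_max => /andP[m1 m2].
by split; [exact: h1|exact: h2].
Qed.

Let measurable_key m (G : set {ffun idx m -> int}) : measurable (@key m @^-1` G).
Proof.
have -> : @key m @^-1` G = \bigcup_(k in setT) [set w | G k /\ key m w = k].
  apply/seteqP; split=> [w Gw|w [k _ [Gk kw]]]; first by exists (key m w).
  by rewrite /preimage/= kw.
apply: countable_bigcupT_measurable; first exact: countableP.
move=> k; have [Gk|nG] := pselect (G k); last first.
  rewrite (_ : [set w | _] = set0)//; apply/seteqP; split => w //= [].
  by move=> /nG.
have -> : [set w | G k /\ key m w = k] = \bigcap_(p in [set: idx m])
    [set w | (k p)%:~R <= 2 ^+ m * sample w p < (k p + 1)%:~R].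
  apply/seteqP; split=> w /=.
    by move=> [_ <-] p _; rewrite /= ffunE; exact: floor_itv.
  move=> h; split => //; apply/ffunP => p; rewrite ffunE.
  by apply: floor_def; exact: (h p Logic.I).
apply: fin_bigcap_measurable; first exact: finite_finset.
move=> p _; have ms : measurable_fun setT (fun w => 2 ^+ m * sample w p).
  apply: measurable_funM => //; rewrite /sample; case: (p.2).
    by apply: mX1; exact: grid_ge0.
  by apply: mX2; exact: grid_ge0.
have -> : [set w | (k p)%:~R <= 2 ^+ m * sample w p < (k p + 1)%:~R] =
    setT `&` (fun w => 2 ^+ m * sample w p) @^-1` `[(k p)%:~R, (k p + 1)%:~R[%classic.
  by rewrite setTI; apply/seteqP; split=> w /=; rewrite in_itv.
by apply: ms => //; exact: measurable_itv.
Qed.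

(** [X w] lies in the open set [O] if and only if, for some [k] and all large [m], every pair that
    is [k]-close to the decoded key lies in [O]. As keys range over a countable discrete set, these
    events are measurable whatever [G k] looks like. *)
Lemma random_element_skorohod : random_element X.
Proof.
apply: random_element_open => O oO.
pose G k := [set x : S | forall y, sk2 k x y -> O y].
have -> : X @^-1` O = \bigcup_k \bigcup_M \bigcap_(m in [set m | (M <= m)%N])
    (@key m @^-1` [set f | G k (decode f)]).
  apply/seteqP; split=> [w /= Xw|w [k _ [M _ h]]].
    have [k hk] := sk_close_open2 oO Xw.
    have [M hM] := decode_close w k.+1.
    exists k.+1 => //; exists M => // m Mm y [y1 y2].
    by have [h1 h2] := hM m Mm; apply: hk; [exact: sk_close_trans h1 y1|exact: sk_close_trans h2 y2].
  have [M' hM'] := decode_close w k.+1.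
  apply: (h (maxn M M')); first exact: leq_maxl.
  by have [h1 h2] := hM' _ (leq_maxr M M'); split; exact: sk_close_sym.
apply: bigcupT_measurable => k; apply: bigcupT_measurable => M.
apply: bigcap_measurableType => m _; exact: measurable_key.
Qed.

End measurable_skorohod.

(** * Batch starting times *)

Section queue.
Variables (R : realType) (b0 : M1 R) (E : R -> nat) (v : nat -> R).
Hypothesis E0 : E 0 = 0%N.
Hypothesis E_le : forall s t, 0 <= s -> s <= t -> (E s <= E t)%N.
Hypothesis E_right : forall t, 0 <= t -> exists2 e, 0 < e & forall s, t <= s < t + e -> E s = E t.

Definition work (t : R) : R := first_moment (arrivals E v t).

Lemma workE t : work t = \sum_(0 <= i < E t) Num.max 0 (v i).
Proof. by rewrite /work /arrivals first_moment_point_masses. Qed.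

Lemma first_moment_between s t : 0 <= s -> s <= t ->
  first_moment (arrivals_between E v s t) = work t - work s.
Proof.
move=> s0 st; rewrite /arrivals_between first_moment_point_masses !workE.
by rewrite (@big_cat_nat _ _ _ (E s) 0 (E t))//= ?E_le// [RHS]addrAC subrr add0r.
Qed.

Lemma work_le s t : 0 <= s -> s <= t -> work s <= work t.
Proof. by move=> s0 st; rewrite -subr_ge0 -first_moment_between// first_moment_ge0. Qed.

Lemma work_eq s t : E s = E t -> work s = work t.
Proof. by move=> e; rewrite !workE e. Qed.

Lemma work_ge0 t : 0 <= work t. Proof. exact: first_moment_ge0. Qed.

Local Notation W := (workload b0 E v).
Local Notation X := (netput b0 E v).
Local Notation I := (idle_time b0 E v).
Local Notation beta := (batch_start b0 E v).

Lemma idle_has_sup t : 0 <= t ->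
  has_sup [set Num.max (- X s) 0 | s in `[0, t]].
Proof.
move=> t0; split; first by exists (Num.max (- X 0) 0), 0; rewrite //= in_itv/= lexx.
exists t => _ [s /= + <-]; rewrite in_itv/= => /andP[s0 st].
rewrite ge_max t0 andbT /netput -/(work s).
by have := first_moment_ge0 b0; have := work_ge0 s; lra.
Qed.

Lemma idle_ub t s : 0 <= s -> s <= t -> - X s <= I t.
Proof.
move=> s0 st; apply: (@le_trans _ _ (Num.max (- X s) 0)); first by rewrite le_max lexx.
by apply: ub_le_sup; [exact: (idle_has_sup (le_trans s0 st)).2|exists s; rewrite //= in_itv/= s0].
Qed.

Lemma idle_ge0 t : 0 <= t -> 0 <= I t.
Proof.
move=> t0; apply: (@le_trans _ _ (Num.max (- X 0) 0)); first by rewrite le_max lexx orbT.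
by apply: ub_le_sup; [exact: (idle_has_sup t0).2|exists 0; rewrite //= in_itv/= lexx].
Qed.

Lemma idle_lub t m : 0 <= t -> 0 <= m -> (forall s, 0 <= s -> s <= t -> - X s <= m) -> I t <= m.
Proof.
move=> t0 m0 h; apply: ge_sup; first exact: (idle_has_sup t0).1.
by move=> _ [s /= + <-]; rewrite in_itv/= => /andP[s0 st]; rewrite ge_max m0 andbT h.
Qed.

Lemma workload_ge0 t : 0 <= t -> 0 <= W t.
Proof. by move=> t0; rewrite /workload; have := idle_ub t0 (lexx t); lra. Qed.

(** The work present at [b] is finished at [b + W b]. If nothing arrives after [b] and before [s],
    the idle time then grows at unit rate, and the workload at [s] is whatever arrives at [s]
    itself. *)
Lemma workload_next b s : 0 <= b -> b + W b <= s ->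
  (forall u, b + W b <= u -> u < s -> work u = work b) -> W s = work s - work b.
Proof.
move=> b0' bs hA; have Wb := workload_ge0 b0'; have s0 : 0 <= s by lra.
suff : I s = I b + (s - (b + W b)).
  by rewrite /workload /netput -/(work s) -/(work b) => ->; lra.
have Xu u : b <= u -> X u = X b + (work u - work b) - (u - b).
  by move=> bu; rewrite /netput -/(work u) -/(work b); lra.
have XW : X b = W b - I b by rewrite /workload; lra.
have Ib := idle_ge0 b0'.
apply/eqP; rewrite eq_le; apply/andP; split.
  apply: idle_lub => //; first lra.
  move=> u u0 us; have [ub|/ltW bu] := leP u b.
    by have := idle_ub u0 ub; lra.
  by rewrite Xu//; have := work_le b0' bu; lra.
have [st|ts] := leP s (b + W b).
  have -> : I b + (s - (b + W b)) = I b by lra.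
  apply: idle_lub => //; first by apply: idle_ge0; lra.
  by move=> u u0 ub; apply: idle_ub => //; lra.
rewrite leNgt; apply/negP => h.
pose d := Num.min (I b + (s - (b + W b)) - I s) (s - (b + W b)).
have d0 : 0 < d by rewrite lt_min; apply/andP; split; lra.
have [d1 d2] : d <= I b + (s - (b + W b)) - I s /\ d <= s - (b + W b).
  by rewrite /d !ge_min !lexx orbT.
(* The supremum defining the idle time is only approached from the left of [s], since work may
   arrive at [s]. *)
pose u := s - d / 2.
have hu : work u = work b by apply: hA; rewrite /u; lra.
have u0 : 0 <= u by rewrite /u; lra.
have us : u <= s by rewrite /u; lra.
have bu : b <= u by rewrite /u; lra.
by have := idle_ub u0 us; rewrite Xu// hu /u; lra.
Qed.

Lemma batch_start_infty k : beta k = +oo%E -> beta k.+1 = +oo%E.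
Proof.
move=> bk /=; rewrite bk (_ : [set s | _] = set0) ?image_set0 ?ereal_inf0//.
by apply/seteqP; split => s //= [].
Qed.

(** Past [b + W b], the workload first becomes positive when work has arrived since [b]. As [E] is
    right continuous, this time is attained, and the infimum becomes a condition at the single time
    [t]. *)
Let batch_start_step k b : beta k = b%:E -> 0 <= b ->
  (forall t, (beta k.+1 <= t%:E)%E <-> b + W b <= t /\ work b < work t).
Proof.
move=> bk b0' t; have Wb := workload_ge0 b0'.
rewrite [beta k.+1]/= bk /=.
set Sk := [set s | _].
have SkE s : Sk s = (b + W b <= s /\ 0 < W s).
  by rewrite /Sk /= -EFinD lee_fin.
split=> [h|[tau_t At]].
(* Since the infimum is at most [t], no interval to the right of [t] separates it from the
   admissible times. *)
- have gap e : t < e -> ~ (forall s, Sk s -> e <= s).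
    move=> te he; have : (e%:E <= ereal_inf [set s%:E | s in Sk])%E.
      by apply: le_ereal_inf_tmp => _ [s Ss <-]; rewrite lee_fin; exact: he.
    by move=> /le_trans/(_ h); rewrite lee_fin; lra.
  have tau_t : b + W b <= t.
    rewrite leNgt; apply/negP => /gap; apply => s; rewrite SkE; by case.
  split => //; rewrite ltNge; apply/negP => At.
  have t0 : 0 <= t by lra.
  have [e e0 he] := E_right t0.
  apply: (gap (t + e)); first lra.
  move=> s; rewrite SkE => -[ts Ws]; rewrite leNgt; apply/negP => se.
  have bt : b <= t by lra.
  have Ab u : b + W b <= u -> u < t + e -> work u = work b.
    move=> bu ue; have bu' : b <= u by lra.
    apply/eqP; rewrite eq_le (work_le b0' bu') andbT; have [ut|/ltW tu] := leP u t.
      by apply: le_trans At; apply: work_le => //; lra.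
    by rewrite (@work_eq u t)//; apply: he; rewrite tu.
  have := workload_next b0' ts; rewrite (Ab s ts se) subrr => h'.
  by move: Ws; rewrite h' ?ltxx// => u bu us; apply: Ab => //; lra.
- pose B := [set s | b + W b <= s /\ work b < work s].
  have hB : has_inf B by split; [exists t|exists (b + W b) => s []].
  set s0 := inf B.
  have ts0 : b + W b <= s0 by apply: lb_le_inf; [exact: hB.1|move=> s []].
  have s0t : s0 <= t by apply: ge_inf; [exact: hB.2|].
  have s00 : 0 <= s0 by lra.
  have Bs0 : work b < work s0.
    rewrite ltNge; apply/negP => As0; have [e e0 he] := E_right s00.
    have [s [ts As] se] := inf_adherent e0 hB.
    have ss : s0 <= s by apply: ge_inf; [exact: hB.2|].
    have : work s = work s0 by apply: work_eq; apply: he; rewrite ss.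
    lra.
  have : W s0 = work s0 - work b.
    apply: workload_next => // u tu us.
    have bu : b <= u by lra.
    apply/eqP; rewrite eq_le (work_le b0' bu) andbT.
    rewrite leNgt; apply/negP => Au; have : s0 <= u by apply: ge_inf; [exact: hB.2|].
    lra.
  move=> Ws0; apply: (@le_trans _ _ s0%:E); last by rewrite lee_fin.
  by apply: ereal_inf_lbound; exists s0 => //; rewrite SkE; split => //; lra.
Qed.

(** When a batch starts, the previous one has been served completely, so the workload is exactly the
    work of the new profile. This eliminates the workload from the recursion. *)
Lemma batch_startP k : beta k = +oo%E \/
  exists2 b, 0 <= b & beta k = b%:E /\ W b = first_moment (batch b0 E v k).
Proof.
elim: k => [|k [/batch_start_infty ->|[b b0' [bk Wb]]]]; [right|by left|].
  exists 0 => //; split => //; rewrite /workload /netput -/(work 0).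
  have w0 : work 0 = 0 by rewrite workE E0 big_geq.
  have I0 : I 0 = 0.
    apply/eqP; rewrite eq_le idle_ge0// andbT; apply: idle_lub => // u u0 u1.
    have -> : u = 0 by apply/eqP; rewrite eq_le u0 u1.
    by rewrite /netput -/(work 0) w0; have := first_moment_ge0 b0; lra.
  by rewrite w0 I0 addr0 subr0 addr0.
have step := batch_start_step bk b0'.
case bk1 : (beta k.+1) => [c| |]; [right|by left|]; last first.
  have /step[+ _] : (beta k.+1 <= (b + W b - 1)%:E)%E by rewrite bk1 leNye.
  by move=> h; exfalso; lra.
have [tc Ac] : b + W b <= c /\ work b < work c by apply/step; rewrite bk1.
have Wb0 := workload_ge0 b0'.
have bc : b <= c by lra.
exists c; first lra; split => //.
rewrite [batch _ _ _ _]/= -/(beta k.+1) bk1 bk /= first_moment_between//.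
apply: workload_next => // u tu uc.
have bu : b <= u by lra.
apply/eqP; rewrite eq_le (work_le b0' bu) andbT.
rewrite leNgt; apply/negP => Au.
have : (beta k.+1 <= u%:E)%E by apply/step.
by rewrite bk1 lee_fin; lra.
Qed.

Lemma batch_start_ge0 k b : beta k = b%:E -> 0 <= b.
Proof. by case: (batch_startP k) => [->//|[b' ? [-> _]] [<-]]. Qed.

Lemma batch_start_next k b t : beta k = b%:E ->
  (beta k.+1 <= t%:E)%E <-> b + first_moment (batch b0 E v k) <= t /\ work b < work t.
Proof.
move=> bk; have b0' := batch_start_ge0 bk.
rewrite (batch_start_step bk b0').
case: (batch_startP k) => [|[c c0 [bkc <-]]]; first by rewrite bk.
by move: bkc; rewrite bk => -[->].
Qed.

Lemma batch_start_lt k b c : beta k = b%:E -> beta k.+1 = c%:E ->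
  [/\ b + first_moment (batch b0 E v k) <= c, b < c, (E b < E c)%N & work b < work c].
Proof.
move=> bk ck; have [h1 h2] : b + first_moment (batch b0 E v k) <= c /\ work b < work c.
  by apply/(batch_start_next c bk); rewrite ck.
have b0' := batch_start_ge0 bk.
have := first_moment_ge0 (batch b0 E v k) => w0.
have bc : b < c.
  rewrite lt_neqAle; apply/andP; split; last lra.
  by apply: contraPneq h2 => ->; rewrite ltxx.
split => //; rewrite ltn_neqAle E_le// ?ltW// andbT.
by apply: contraPneq h2 => /work_eq ->; rewrite ltxx.
Qed.

Lemma batch_start_le k : (beta k <= beta k.+1)%E.
Proof.
case: (batch_startP k) => [bk|[b b0' [bk _]]]; first by rewrite (batch_start_infty bk) leey.
case: (batch_startP k.+1) => [->|[c c0' [ck _]]]; first by rewrite leey.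
by rewrite bk ck lee_fin; have [_ /ltW] := batch_start_lt bk ck.
Qed.

Lemma batch_start_mono j k : (j <= k)%N -> (beta j <= beta k)%E.
Proof.
elim: k => [|k ih]; first by rewrite leqn0 => /eqP ->.
rewrite leq_eqVlt => /orP[/eqP -> //|jk]; exact: le_trans (ih jk) (batch_start_le k).
Qed.

(** Each batch after the initial one contains an arrival. Hence finitely many batches start in
    bounded time, and the maximum that defines the current batch exists. *)
Lemma batch_start_count k b : beta k = b%:E -> (k <= E b)%N.
Proof.
elim: k b => // k ih c ck.
case: (batch_startP k) => [/batch_start_infty|[b b0' [bk _]]]; first by rewrite ck.
by have [_ _ h _] := batch_start_lt bk ck; exact: leq_ltn_trans (ih _ bk) h.
Qed.

Lemma last_batch_eq t k b : beta k = b%:E -> b <= t -> (t%:E < beta k.+1)%E ->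
  last_batch b0 E v t = k /\ last_batch_start b0 E v t = b.
Proof.
move=> bk bt tk; pose P l := (beta l <= t%:E)%E /\ forall j, (beta j <= t%:E)%E -> (j <= l)%N.
have Pk : P k.
  split; first by rewrite bk lee_fin.
  move=> j jt; rewrite leqNgt; apply/negP => /batch_start_mono kj.
  by move: (lt_le_trans tk (le_trans kj jt)); rewrite ltxx.
have [h1 h2] : P (last_batch b0 E v t) := xgetPex _ (ex_intro P k Pk).
have lk : last_batch b0 E v t = k.
  by apply/eqP; rewrite eqn_leq (Pk.2 _ h1) (h2 _ Pk.1).
split => //; rewrite /last_batch_start.
suff -> : ereal_sup [set beta k | k in [set k | (beta k <= t%:E)%E]] = b%:E by [].
apply/eqP; rewrite eq_le; apply/andP; split.
  by apply: ge_ereal_sup => _ [j /= jt <-]; rewrite -bk; apply: batch_start_mono; exact: Pk.2.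
by apply: ereal_sup_ubound; exists k => //=; rewrite bk lee_fin.
Qed.

Lemma last_batchP t : 0 <= t -> exists b k, [/\ beta k = b%:E, 0 <= b, b <= t & (t%:E < beta k.+1)%E].
Proof.
move=> t0; have ex : exists k, (beta k <= t%:E)%E by exists 0%N; rewrite lee_fin.
have bnd k : (beta k <= t%:E)%E -> (k <= E t)%N.
  case: (batch_startP k) => [->//|[b b0' [bk _]]]; rewrite bk lee_fin => bt.
  exact: leq_trans (batch_start_count bk) (E_le b0' bt).
case: (ex_maxnP ex bnd) => k kt kmax.
case: (batch_startP k) => [bk|[b b0' [bk _]]]; first by rewrite bk in kt.
exists b, k; split => //; first by rewrite bk lee_fin in kt.
by rewrite ltNge; apply/negP => /kmax; rewrite ltnn.
Qed.

Lemma in_serviceE t k b : beta k = b%:E -> b <= t -> (t%:E < beta k.+1)%E ->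
  in_service b0 E v t = served (batch b0 E v k) (t - b).
Proof.
move=> bk bt tk; have [lk lb] := last_batch_eq bk bt tk.
by rewrite /in_service /served /service /current_batch lk lb.
Qed.

Lemma in_waitingE t k b : beta k = b%:E -> b <= t -> (t%:E < beta k.+1)%E ->
  in_waiting b0 E v t = arrivals_between E v b t.
Proof.
move=> bk bt tk; have [lk lb] := last_batch_eq bk bt tk.
by rewrite /in_waiting lb.
Qed.

End queue.

(** * Sample paths and fluid paths are cadlag *)

Lemma cadlag_pieces (R : realType) (V : uniformType) (x : R -> V) :
  (forall t, 0 <= t -> exists b y, [/\ t < b, (forall s, t <= s < b -> x s = y s)
     & y s @[s --> t^'+] --> y t]) ->
  (forall t, 0 < t -> exists a y, [/\ a < t, (forall s, 0 <= s -> a < s < t -> x s = y s)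
     & exists l : V, y s @[s --> t^'-] --> l]) ->
  cadlag x.
Proof.
move=> hr hl t t0; split.
  have [b [y [tb xy yt]]] := hr t t0.
  rewrite (xy t) ?lexx//; apply: cvg_trans yt; apply: near_eq_cvg.
  apply: filterS2 (nbhs_right_gt t) (nbhs_right_lt tb) => s ts sb.
  by rewrite xy// (ltW ts).
move=> t0'; have [a [y [at_ xy [l yl]]]] := hl t t0'; exists l.
apply: cvg_trans yl; apply: near_eq_cvg.
apply: filterS3 (nbhs_left_lt t) (nbhs_left_gt at_) (nbhs_left_gt t0') => s st as_ s0.
by rewrite xy ?(ltW s0)// as_.
Qed.

Section paths.
Variables (R : realType) (b0 : M1 R) (E : R -> nat) (v : nat -> R).
Hypothesis E0 : E 0 = 0%N.
Hypothesis E_le : forall s t, 0 <= s -> s <= t -> (E s <= E t)%N.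
Hypothesis E_right : forall t, 0 <= t -> exists2 e, 0 < e & forall s, t <= s < t + e -> E s = E t.
Variable r : R.
Hypothesis r0 : 0 < r.

Local Notation beta := (batch_start b0 E v).

(** Left limits at [t] are governed by the batch in service just before [t], which is the previous
    one if a batch starts at [t]. *)
Lemma last_batch_leftP t : 0 < t ->
  exists b k, [/\ beta k = b%:E, 0 <= b, b < t & (t%:E <= beta k.+1)%E].
Proof.
move=> t0; have [b [k [bk b0' bt tk]]] := last_batchP b0 v E0 E_le E_right (ltW t0).
move: bt; rewrite le_eqVlt => /orP[/eqP bt|bt]; last by exists b, k; split => //; exact: ltW.
case: k bk tk => [|k] bk tk; first by case: bk => bk; move: t0; rewrite -bt -bk ltxx.
case: (batch_startP b0 v E0 E_le E_right k) => [/batch_start_infty|[c c0 [ck _]]].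
  by rewrite bk.
have [_ cb _ _] := batch_start_lt E0 E_le E_right ck bk.
by exists c, k; split => //; [rewrite -bt|rewrite bk bt].
Qed.

(** An integer-valued monotone function attains its maximum [n] over [[0, t[] and stays there until
    [t]. *)
Lemma arrivals_left t : 0 < t -> exists a n, a < t /\ forall s, 0 <= s -> a < s < t -> E s = n.
Proof.
move=> t0; pose P n := `[< exists2 s, 0 <= s < t & E s = n >].
have ex : exists n, P n by exists (E 0); apply/asboolP; exists 0; rewrite ?lexx.
have bnd n : P n -> (n <= E t)%N.
  by move=> /asboolP[s /andP[s0 /ltW st] <-]; exact: E_le.
case: (ex_maxnP ex bnd) => n /asboolP[a /andP[a0 at_] an] nmax.
exists a, n; split => // s s0 /andP[as_ st]; apply/eqP; rewrite eqn_leq nmax.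
  by rewrite -an E_le// ltW.
by apply/asboolP; exists s => //; rewrite s0.
Qed.

Lemma scaled_service_cadlag : cadlag (fun t => M1_scale r^-1 (in_service b0 E v (r * t))).
Proof.
have ri0 : 0 <= r^-1 by rewrite invr_ge0 ltW.
have rlt s t : (r * s < t) = (s < t / r) by rewrite ltr_pdivlMr// mulrC.
have rgt s t : (t < r * s) = (t / r < s) by rewrite ltr_pdivrMr// mulrC.
have rle s t : (t <= r * s) = (t / r <= s) by rewrite ler_pdivrMr// mulrC.
apply: cadlag_pieces => t t0.
  have rt0 : 0 <= r * t by rewrite mulr_ge0// ltW.
  have [b [k [bk b0' bt tk]]] := last_batchP b0 v E0 E_le E_right rt0.
  have [c tc ck] : exists2 c, t < c & (c%:E <= (if beta k.+1 is x%:E then x / r else t + 1)%:E)%E.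
    case: (beta k.+1) tk => [x| |]//; last first.
      by move=> _; exists (t + 1) => //; rewrite ltrDl.
    rewrite lte_fin rlt => tx; exists (x / r) => //.
  exists c, (fun s => M1_scale r^-1 (served (batch b0 E v k) (r * s - b))); split => //.
    move=> s /andP[ts sc]; congr M1_scale; apply: in_serviceE => //.
      by rewrite (le_trans bt)// ler_pM2l.
    case: (beta k.+1) ck tk => [x| |] ck tk.
    - by rewrite lte_fin rlt; rewrite lee_fin in ck; exact: lt_le_trans ck.
    - by rewrite ltry.
    - by move: tk; rewrite ltNge leNye.
  by apply: cvg_M1_scale => //; apply: served_cvg_right => //; rewrite subr_ge0.
have rt0 : 0 < r * t by rewrite mulr_gt0.
have [b [k [bk b0' bt tk]]] := last_batch_leftP rt0.
exists (b / r), (fun s => M1_scale r^-1 (served (batch b0 E v k) (r * s - b))); split.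
- by rewrite -rgt.
- move=> s s0 /andP[bs st]; congr M1_scale; apply: in_serviceE => //.
    by rewrite ltW// rgt.
  by apply: lt_le_trans tk; rewrite lte_fin ltr_pM2l.
have : 0 < r * t - b by rewrite subr_gt0.
move=> /(served_cvg_left r0 (batch b0 E v k))[l hl].
by exists (M1_scale r^-1 l); exact: cvg_M1_scale.
Qed.

Lemma scaled_waiting_cadlag : cadlag (fun t => M1_scale r^-1 (in_waiting b0 E v (r * t))).
Proof.
have rlt s t : (r * s < t) = (s < t / r) by rewrite ltr_pdivlMr// mulrC.
have rgt s t : (t < r * s) = (t / r < s) by rewrite ltr_pdivrMr// mulrC.
apply: cadlag_pieces => t t0.
  have rt0 : 0 <= r * t by rewrite mulr_ge0// ltW.
  have [b [k [bk b0' bt tk]]] := last_batchP b0 v E0 E_le E_right rt0.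
  have [e e0 he] := E_right rt0.
  have [c tc ck] : exists2 c, t < c & (c%:E <= (if beta k.+1 is x%:E then x / r else t + 1)%:E)%E.
    case: (beta k.+1) tk => [x| |]//; last first.
      by move=> _; exists (t + 1) => //; rewrite ltrDl.
    rewrite lte_fin rlt => tx; exists (x / r) => //.
  exists (Num.min c (t + e / r)), (fun=> M1_scale r^-1 (arrivals_between E v b (r * t))); split => //.
  - by rewrite lt_min tc ltrDl divr_gt0.
  - move=> s /andP[ts]; rewrite lt_min => /andP[sc se]; congr M1_scale.
    have bs : b <= r * s by rewrite (le_trans bt)// ler_pM2l.
    have sk : ((r * s)%:E < beta k.+1)%E.
      case: (beta k.+1) ck tk => [x| |] ck tk.
      - by rewrite lte_fin rlt; rewrite lee_fin in ck; exact: lt_le_trans ck.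
      - by rewrite ltry.
      - by move: tk; rewrite ltNge leNye.
    rewrite (in_waitingE E0 E_le E_right bk bs sk) /arrivals_between (he (r * s))//.
    rewrite ler_pM2l// ts/= rlt; apply: (lt_le_trans se).
    by rewrite mulrDl (mulrC r) mulfK ?gt_eqF.
  - exact: cvg_cst.
have rt0 : 0 < r * t by rewrite mulr_gt0.
have [b [k [bk b0' bt tk]]] := last_batch_leftP rt0.
have [a [n [at_ an]]] := arrivals_left rt0.
exists (Num.max (b / r) (a / r)), (fun=> M1_scale r^-1 (point_masses v (E b) n)); split.
- by rewrite gt_max -!rgt bt.
- move=> s s0 /andP[+ st]; rewrite gt_max => /andP[bs as_]; congr M1_scale.
  have bs' : b <= r * s by rewrite ltW// rgt.
  have sk : ((r * s)%:E < beta k.+1)%E by apply: lt_le_trans tk; rewrite lte_fin ltr_pM2l.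
  rewrite (in_waitingE E0 E_le E_right bk bs' sk) /arrivals_between (an (r * s))//.
    by rewrite mulr_ge0// ltW.
  by rewrite rgt as_ ltr_pM2l.
by exists (M1_scale r^-1 (point_masses v (E b) n)); exact: cvg_cst.
Qed.

End paths.

(** * Regularity of renewal counting functions *)

Section renewal.
Variables (R : realType) (d : measure_display) (T : measurableType d) (P : probability T R).
Variables (a : R) (E : R -> T -> nat).
Hypothesis hE : delayed_renewal P a E.

Lemma renewal_le w s t : 0 <= s -> s <= t -> (E s w <= E t w)%N.
Proof.
have [u [_ _ _ _ hu]] := hE; move=> s0 st; have t0 := le_trans s0 st.
case Es : (E s w) => [//|n]; rewrite hu// (le_trans _ st)// -hu// Es.
exact: leqnn.
Qed.

Lemma renewal_right w t : 0 <= t -> exists2 e, 0 < e & forall s, t <= s < t + e -> E s w = E t w.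
Proof.
have [u [_ _ _ _ hu]] := hE; move=> t0.
pose n := E t w; pose m := \sum_(i < n.+1) u i w.
have tm : t < m by rewrite ltNge -hu// ltnn.
exists (m - t); first by rewrite subr_gt0.
move=> s /andP[ts sm]; apply/eqP; rewrite eqn_leq (renewal_le w t0 ts) andbT leqNgt.
rewrite hu ?(le_trans t0)//; rewrite -/n -/m -ltNge; lra.
Qed.

End renewal.

(** * Fluid paths as cadlag paths *)

Section fluid_path.
Variables (R : realType) (alpha : R) (nu xi : M1 R).
Hypothesis alpha0 : 0 < alpha.

Let w := first_moment xi.

Definition fluid_batch (k : nat) : M1 R :=
  if k is 0 then xi else M1_scale (alpha * first_moment xi) nu.

Lemma fluid_piece k t : 0 < w -> k%:R * w <= t < k.+1%:R * w ->
  fluid_in_service alpha nu xi t = served (fluid_batch k) (t - k%:R * w) /\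
  fluid_in_waiting alpha nu xi t = M1_scale (alpha * (t - k%:R * w)) nu.
Proof.
move=> w0 /andP[kt tk].
have fl : Num.floor (t / w) = k%:Z.
  apply: floor_def; rewrite ler_pdivlMr// ltr_pdivrMr//.
  by rewrite -[(k%:Z + 1)%:~R]/((k%:Z + 1%:Z)%:~R) -PoszD addn1 kt tk.
have rem : remainder w t = t - k%:R * w by rewrite /remainder gt_eqF// fl.
rewrite /fluid_in_waiting -/w rem; split => //.
rewrite /fluid_in_service -/w rem; case: k kt tk {fl rem} => [|k] kt tk /=.
  by rewrite mul0r subr0 ifT//; move: tk; rewrite mul1r.
rewrite ifF//; apply/negbTE; rewrite -leNgt; apply: le_trans kt.
by rewrite -natr1 mulrDl mul1r lerDr mulr_ge0// ltW.
Qed.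

Lemma fluid_index t : 0 < w -> 0 <= t -> exists k, k%:R * w <= t < k.+1%:R * w.
Proof.
move=> w0 t0; exists (Num.truncn (t / w)).
by rewrite -ler_pdivlMr// -ltr_pdivrMr//; apply: truncn_itv; rewrite divr_ge0// ltW.
Qed.

Lemma fluid_index_left t : 0 < w -> 0 < t -> exists k, k%:R * w < t <= k.+1%:R * w.
Proof.
move=> w0 t0; have [k /andP[kt tk]] := fluid_index w0 (ltW t0).
move: kt; rewrite le_eqVlt => /orP[/eqP kt|kt]; last by exists k; rewrite kt ltW.
case: k kt tk => [|k] kt tk; first by move: t0; rewrite -kt mul0r ltxx.
by exists k; rewrite -kt lexx andbT ltr_pM2r// ltr_nat.
Qed.

Lemma fluid_w0 t : w = 0 -> 0 <= t ->
  fluid_in_service alpha nu xi t = served (M1_scale (alpha * w) nu) 0 /\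
  fluid_in_waiting alpha nu xi t = M1_scale (alpha * 0) nu.
Proof.
move=> w0 t0; rewrite /fluid_in_service /fluid_in_waiting -/w /remainder w0 eqxx.
by rewrite ltNge t0.
Qed.

Lemma cvg_M1_scaler (T : Type) (F : set_system T) (FF : Filter F) (c : T -> R) (l : R)
    (z : M1 R) :
  (\forall s \near F, 0 <= c s) -> 0 <= l -> c @ F --> l ->
  M1_scale (c s) z @[s --> F] --> M1_scale l z.
Proof.
move=> c0 l0 cl; apply/cvg_M1P => j; rewrite m1_coord_scale//.
apply: cvg_trans (_ : c s * m1_coord j z @[s --> F] --> _).
  by apply: near_eq_cvg; apply: filterS c0 => s s0; rewrite m1_coord_scale.
by apply: cvgM => //; exact: cvg_cst.
Qed.

Lemma fluid_service_cadlag : cadlag (fluid_in_service alpha nu xi).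
Proof.
have := first_moment_ge0 xi; rewrite -/w le_eqVlt => /orP[/eqP w0|w0].
  apply: cadlag_pieces => t t0.
    exists (t + 1), (fun=> served (M1_scale (alpha * w) nu) 0); split; first by rewrite ltrDl.
      by move=> s /andP[ts _]; have [] := fluid_w0 (esym w0) (le_trans t0 ts).
    exact: cvg_cst.
  exists 0, (fun=> served (M1_scale (alpha * w) nu) 0); split=> //.
    by move=> s s0 _; have [] := fluid_w0 (esym w0) s0.
  by exists (served (M1_scale (alpha * w) nu) 0); exact: cvg_cst.
have l01 : 0 < 1 :> R by [].
apply: cadlag_pieces => t t0.
  have [k /andP[kt tk]] := fluid_index w0 t0.
  exists (k.+1%:R * w), (fun s => served (fluid_batch k) (1 * s - k%:R * w)); split => //.
    move=> s /andP[ts sk]; rewrite mul1r.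
    have /(fluid_piece w0)[-> //] : k%:R * w <= s < k.+1%:R * w.
    by rewrite sk (le_trans kt).
  by apply: served_cvg_right => //; rewrite mul1r subr_ge0.
have [k /andP[kt tk]] := fluid_index_left w0 t0.
exists (k%:R * w), (fun s => served (fluid_batch k) (1 * s - k%:R * w)); split => //.
  move=> s s0 /andP[ks st]; rewrite mul1r.
  have /(fluid_piece w0)[-> //] : k%:R * w <= s < k.+1%:R * w.
  by rewrite (ltW ks) (lt_le_trans st).
by apply: served_cvg_left => //; rewrite mul1r subr_gt0.
Qed.

Lemma fluid_waiting_cadlag : cadlag (fluid_in_waiting alpha nu xi).
Proof.
have := first_moment_ge0 xi; rewrite -/w le_eqVlt => /orP[/eqP w0|w0].
  apply: cadlag_pieces => t t0.
    exists (t + 1), (fun=> M1_scale (alpha * 0) nu); split; first by rewrite ltrDl.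
      by move=> s /andP[ts _]; have [] := fluid_w0 (esym w0) (le_trans t0 ts).
    exact: cvg_cst.
  exists 0, (fun=> M1_scale (alpha * 0) nu); split=> //.
    by move=> s s0 _; have [] := fluid_w0 (esym w0) s0.
  by exists (M1_scale (alpha * 0) nu); exact: cvg_cst.
have cts k t : (alpha * (s - k%:R * w)) @[s --> t] --> alpha * (t - k%:R * w).
  by apply: cvgM; [exact: cvg_cst|apply: cvgB; [exact: cvg_id|exact: cvg_cst]].
apply: cadlag_pieces => t t0.
  have [k /andP[kt tk]] := fluid_index w0 t0.
  exists (k.+1%:R * w), (fun s => M1_scale (alpha * (s - k%:R * w)) nu); split => //.
    move=> s /andP[ts sk]; have /(fluid_piece w0)[_ -> //] : k%:R * w <= s < k.+1%:R * w.
    by rewrite sk (le_trans kt).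
  apply: cvg_M1_scaler.
  - apply: filterS (nbhs_right_gt t) => s ts.
    by rewrite mulr_ge0 ?ltW// subr_gt0; lra.
  - by rewrite mulr_ge0 ?(ltW alpha0)// subr_ge0.
  - by apply: cvg_trans (@cts k t); apply: cvg_app; exact: cvg_within.
have [k /andP[kt tk]] := fluid_index_left w0 t0.
exists (k%:R * w), (fun s => M1_scale (alpha * (s - k%:R * w)) nu); split => //.
  move=> s s0 /andP[ks st]; have /(fluid_piece w0)[_ -> //] : k%:R * w <= s < k.+1%:R * w.
  by rewrite (ltW ks) (lt_le_trans st).
exists (M1_scale (alpha * (t - k%:R * w)) nu); apply: cvg_M1_scaler.
- apply: filterS (nbhs_left_gt kt) => s ts.
  by rewrite mulr_ge0 ?(ltW alpha0)// subr_ge0 ltW.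
- by rewrite mulr_ge0 ?(ltW alpha0)// subr_ge0 ltW.
- by apply: cvg_trans (@cts k t); apply: cvg_app; exact: cvg_within.
Qed.

Definition fluid_path : skorohod R (M1 R) * skorohod R (M1 R) :=
  (MkSkorohod fluid_service_cadlag, MkSkorohod fluid_waiting_cadlag).

End fluid_path.

(** * Measurability of sample paths and fluid paths *)

Section measurability.
Variables (R : realType) (d : measure_display) (T : measurableType d).
Implicit Types f g : T -> R.

Lemma measurable_lt_set f g : measurable_fun setT f -> measurable_fun setT g ->
  measurable [set w | f w < g w].
Proof.
move=> mf mg; have mt : measurable [set true] by [].
have := measurable_fun_ltr mf mg measurableT mt.
by rewrite setTI; congr measurable; apply/seteqP; split => w /=.
Qed.

Lemma measurable_le_set f g : measurable_fun setT f -> measurable_fun setT g ->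
  measurable [set w | f w <= g w].
Proof.
move=> mf mg; have mt : measurable [set true] by [].
have := measurable_fun_ler mf mg measurableT mt.
by rewrite setTI; congr measurable; apply/seteqP; split => w /=.
Qed.

Lemma measurable_fun_gt_sets f : (forall c, measurable [set w | c < f w]) ->
  measurable_fun setT f.
Proof.
move=> h; apply: (measurability _ (RGenOInfty.measurableE R)).
move=> _ [_ [x ->] <-]; rewrite setTI.
by rewrite (_ : _ @^-1` _ = [set w | x < f w])//; apply/seteqP; split => w /=; rewrite in_itv/= andbT.
Qed.

Lemma measurable_fun_cases (I : Type) (A : I -> set T) (g : I -> T -> R) f :
  countable [set: I] -> (forall w, exists i, A i w) ->
  (forall i, measurable (A i)) -> (forall i, measurable_fun setT (g i)) ->
  (forall i w, A i w -> f w = g i w) -> measurable_fun setT f.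
Proof.
move=> cI UA mA mg fg _ B mB; rewrite setTI.
have -> : f @^-1` B = \bigcup_i (A i `&` (g i @^-1` B)).
  apply/seteqP; split=> [w /= fw|w [i _ [/= Aw gw]]].
    by have [i Aw] := UA w; exists i => //; split => //=; rewrite -(fg i).
  by rewrite (fg i).
apply: countable_bigcupT_measurable => // i; apply: measurableI => //.
by rewrite -[X in measurable X]setTI; exact: mg.
Qed.

Lemma random_element_continuous (U : topologicalType) (X : T -> U) (h : U -> R) :
  random_element X -> continuous h -> measurable_fun setT (fun w => h (X w)).
Proof.
move=> rX ch; apply: (measurability _ (RGenOpens.measurableE R)).
move=> _ [_ [a [b ->] <-]]; rewrite setTI.
have oh : open (h @^-1` `]a, b[%classic).
  by move/continuousP : ch; apply; exact: interval_open.
by apply: (rX (h @^-1` `]a, b[%classic)); exact: sub_sigma_algebra.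
Qed.

Section random_measure.
Variable z : T -> M1 R.
Hypothesis mz : forall j, measurable_fun setT (fun w => m1_coord j (z w)).

Lemma measurable_first_moment : measurable_fun setT (fun w => first_moment (z w)).
Proof. exact: (mz 0%N). Qed.

Lemma measurable_truncated_moment_ratr (q : rat) :
  measurable_fun setT (fun w => truncated_moment (z w) (ratr q)).
Proof.
have [j hj] := m1_coord_ratr R q.
by rewrite (_ : (fun w => _) = (fun w => m1_coord j (z w)))//; apply/funext.
Qed.

End random_measure.

(** The slopes of the truncated moment at 0 are squeezed between tails near 0 and at 0. This makes
    the mass a limit of functions already known to be measurable. *)
Lemma cvg_truncated_moment_mass (z : M1 R) : tail z 0 = mass z ->
  n.+1%:R * truncated_moment z (ratr (n.+1%:R^-1 : rat)) @[n --> \oo] --> mass z.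
Proof.
move=> z0; apply/cvgrPdist_lt => e e0.
have [h h0] := tail_right z 0 e0; rewrite add0r z0 => hh.
near=> n.
have qE : ratr (n.+1%:R^-1 : rat) = n.+1%:R^-1 :> R by rewrite fmorphV rmorph_nat.
have n0 : 0 < n.+1%:R :> R by [].
have nh : n.+1%:R^-1 < h.
  near: n; have [N hN] := ltr_add_invr h0; exists N => // n /= Nn.
  rewrite add0r in hN; apply: le_lt_trans hN.
  by rewrite lef_pV2 ?posrE// ler_nat.
rewrite qE; have ni0 : 0 <= n.+1%:R^-1 :> R by rewrite invr_ge0 ltW.
have /andP[] := truncated_moment_slope z ni0.
rewrite truncated_moment0 !subr0 => h1 h2.
have t1 : tail z h <= tail z n.+1%:R^-1 by apply: le_tail; exact: ltW.
have t2 := tail_le_mass z 0.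
have e1 : n.+1%:R * (n.+1%:R^-1 * tail z n.+1%:R^-1) = tail z n.+1%:R^-1.
  by rewrite mulrA divff ?mul1r// gt_eqF.
have e2 : n.+1%:R * (n.+1%:R^-1 * tail z 0) = tail z 0.
  by rewrite mulrA divff ?mul1r// gt_eqF.
have h1' : tail z n.+1%:R^-1 <= n.+1%:R * truncated_moment z n.+1%:R^-1.
  by rewrite -e1 ler_wpM2l// ltW.
have h2' : n.+1%:R * truncated_moment z n.+1%:R^-1 <= tail z 0.
  by rewrite -e2 ler_wpM2l// ltW.
by rewrite ltr_norml; apply/andP; split; lra.
Unshelve. all: by end_near. Qed.

Section random_service.
Variables (z : T -> M1 R) (y : T -> R).
Hypothesis mz : forall j, measurable_fun setT (fun w => m1_coord j (z w)).
Hypothesis my : measurable_fun setT y.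
Hypothesis y0 : forall w, 0 <= y w.

(** The inverse [s] is a choice and is avoided: the value exceeds [c] if and only if some rational
    [x] with truncated moment below [y w], hence to the left of [s], already has a truncated moment
    at [x + q] above [c + y w]. Exhausted batches are treated apart. *)
Let measurable_served_truncated_moment (q : rat) : 0 <= q ->
  measurable_fun setT (fun w => truncated_moment (served (z w) (y w)) (ratr q)).
Proof.
move=> q0; have qr0 : 0 <= ratr q :> R by rewrite ler0q.
apply: measurable_fun_gt_sets => c.
pose A (x : rat) := [set w | truncated_moment (z w) (ratr x) < y w] `&`
  [set w | c + y w < truncated_moment (z w) (ratr (x + q))].
have -> : [set w | c < truncated_moment (served (z w) (y w)) (ratr q)] =
    ([set w | y w < first_moment (z w)] `&` \bigcup_x A x) `|`
    ([set w | first_moment (z w) <= y w] `&` [set w | c < 0]).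
  apply/seteqP; split=> w /=.
    case: (invP (z w) (y0 w)) => [s yw E s0 st hl _|yw m0].
      rewrite /served E truncated_moment_shift// st => h; left; split => //.
      have e0 : 0 < truncated_moment (z w) (s + ratr q) - y w - c by lra.
      have := truncated_moment_continuous (z := z w) (x := s + ratr q).
      move=> /cvgrPdist_lt/(_ _ e0)/nbhs_ballP[dl /= dl0 hd].
      have sd : s - dl < s by lra.
      have [x] := rat_in_itvoo sd; rewrite in_itv/= => /andP[x1 x2].
      exists x => //; split => /=; first exact: hl.
      have : `|truncated_moment (z w) (s + ratr q) - truncated_moment (z w) (ratr x + ratr q)| <
          truncated_moment (z w) (s + ratr q) - y w - c.
        by apply: hd; rewrite /ball/= ltr_norml; apply/andP; split; lra.
      by rewrite rmorphD ltr_norml => /andP[_]; lra.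
    by rewrite truncated_moment_null// => c0; right.
  case=> [[yw [x _ [/= h1 h2]]]|[yw c0]].
    case: (invP (z w) (y0 w)) => [s _ E s0 st hl _|]; last lra.
    rewrite /served E truncated_moment_shift// st.
    have xs : ratr x <= s.
      rewrite leNgt; apply/negP => /ltW/(le_truncated_moment (z w)); lra.
    have : truncated_moment (z w) (ratr (x + q)) <= truncated_moment (z w) (s + ratr q).
      by apply: le_truncated_moment; rewrite rmorphD lerD2r.
    lra.
  by apply: (lt_le_trans c0); exact: truncated_moment_ge0.
apply: measurableU.
  apply: measurableI; first exact: measurable_lt_set (measurable_first_moment mz).
  apply: bigcupT_measurable_rat => x; apply: measurableI.
    by apply: measurable_lt_set => //; exact: measurable_truncated_moment_ratr.
  apply: measurable_lt_set; last exact: measurable_truncated_moment_ratr.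
  by apply: measurable_funD => //; exact: measurable_cst.
apply: measurableI; first by apply: measurable_le_set => //; exact: measurable_first_moment.
by apply: measurable_lt_set; exact: measurable_cst.
Qed.

Lemma measurable_served j : measurable_fun setT (fun w => m1_coord j (served (z w) (y w))).
Proof.
case: j => [|i] /=.
  under eq_fun do rewrite first_moment_served//.
  apply: measurable_maxr; last exact: measurable_cst.
  by apply: measurable_funB => //; exact: measurable_first_moment.
set q := odflt _ _; have [q0|/ltW q0] := leP 0 q.
  exact: measurable_served_truncated_moment.
have qr0 : ratr q <= 0 :> R by rewrite -[leRHS](ratr_int R 0) ler_rat.
under eq_fun do rewrite truncated_moment_le0//.
apply: measurable_funM; first exact: measurable_cst.
apply: (@measurable_fun_cvg _ _ _ _
  (fun n w => n.+1%:R * truncated_moment (served (z w) (y w)) (ratr (n.+1%:R^-1 : rat)))).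
  move=> n; apply: measurable_funM; first exact: measurable_cst.
  by apply: measurable_served_truncated_moment; rewrite invr_ge0.
by move=> w _; apply: cvg_truncated_moment_mass; exact: tail_served.
Qed.

End random_service.

(** * Measurability of the states of the queue *)

Section random_paths.
Variables (b0 : T -> M1 R) (E : R -> T -> nat) (v : nat -> T -> R).
Hypothesis E0 : forall w, E 0 w = 0%N.
Hypothesis E_le : forall w s t, 0 <= s -> s <= t -> (E s w <= E t w)%N.
Hypothesis E_right : forall w t, 0 <= t ->
  exists2 e, 0 < e & forall s, t <= s < t + e -> E s w = E t w.
Hypothesis mb0 : forall j, measurable_fun setT (fun w => m1_coord j (b0 w)).
Hypothesis mv : forall i, measurable_fun setT (v i).
Hypothesis mE : forall tau : T -> R, measurable_fun setT tau -> (forall w, 0 <= tau w) ->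
  forall n, measurable [set w | E (tau w) w = n].

Local Notation beta w := (batch_start (b0 w) (E ^~ w) (v ^~ w)).
Local Notation prof w := (batch (b0 w) (E ^~ w) (v ^~ w)).

Let startP w k : beta w k = +oo%E \/
  exists2 c, 0 <= c & beta w k = c%:E /\ workload (b0 w) (E ^~ w) (v ^~ w) c = first_moment (prof w k).
Proof. exact: (batch_startP (b0 w) (v ^~ w) (E0 w) (@E_le w) (@E_right w) k). Qed.

Let beta_ge0 w k : (0 <= beta w k)%E.
Proof. by case: (startP w k) => [->//|[c ? [-> _]]]; rewrite lee_fin. Qed.

Let nextE w k c : (beta w k.+1 <= c%:E)%E <-> [/\ (beta w k <= c%:E)%E,
  fine (beta w k) + first_moment (prof w k) <= c &
  work (E ^~ w) (v ^~ w) (fine (beta w k)) < work (E ^~ w) (v ^~ w) c].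
Proof.
have finE : (beta w k <= c%:E)%E -> beta w k = (fine (beta w k))%:E.
  by case: (beta w k) (beta_ge0 w k) => [b| |].
split=> [h|[bk h1 h2]].
  have bk := le_trans (batch_start_le (b0 w) (v ^~ w) (E0 w) (@E_le w) (@E_right w) k) h.
  by have [] := (batch_start_next (E0 w) (@E_le w) (@E_right w) c (finE bk)).1 h.
exact: (batch_start_next (E0 w) (@E_le w) (@E_right w) c (finE bk)).2.
Qed.

Let measurable_finite (f : T -> \bar R) : (forall w, (0 <= f w)%E) ->
  (forall c : R, measurable [set w | (f w <= c%:E)%E]) -> measurable [set w | (f w < +oo)%E].
Proof.
move=> f0 h; rewrite (_ : [set w | _] = \bigcup_n [set w | (f w <= (n%:R : R)%:E)%E]).
  by apply: bigcupT_measurable.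
apply/seteqP; split=> [w /=|w [n _ /=]]; last by move=> /le_lt_trans; apply; rewrite ltry.
case fE : (f w) (f0 w) => [x| |]// x0 _; exists (Num.truncn x).+1 => //.
by rewrite /= fE lee_fin ltW// truncnS_gt.
Qed.

Lemma measurable_point_masses m n j :
  measurable_fun setT (fun w => m1_coord j (point_masses (v ^~ w) m n) : R).
Proof.
have mmax i : measurable_fun setT (fun w => Num.max 0 (v i w)).
  exact: measurable_maxr (measurable_cst _) (mv i).
case: j => [|j] /=.
  under eq_fun do rewrite first_moment_point_masses.
  exact: measurable_sum.
set q := ratr _; have [q0|/ltW q0] := leP 0 q.
  under eq_fun do rewrite truncated_moment_point_masses//.
  apply: measurable_sum => i.
  exact: measurable_minr (mmax i) (measurable_cst _).
under eq_fun do rewrite truncated_moment_le0// mass_point_masses.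
exact: measurable_cst.
Qed.

Lemma measurable_arrivals_between (s t : T -> R) j :
  measurable_fun setT s -> (forall w, 0 <= s w) ->
  measurable_fun setT t -> (forall w, 0 <= t w) ->
  measurable_fun setT (fun w => m1_coord j (arrivals_between (E ^~ w) (v ^~ w) (s w) (t w))).
Proof.
move=> ms s0 mt t0.
apply: (@measurable_fun_cases (nat * nat)%type
  (fun p => [set w | E (s w) w = p.1] `&` [set w | E (t w) w = p.2])
  (fun p w => m1_coord j (point_masses (v ^~ w) p.1 p.2))).
- exact: countableP.
- by move=> w; exists (E (s w) w, E (t w) w).
- by move=> p; apply: measurableI; exact: mE.
- by move=> p; exact: measurable_point_masses.
- by move=> p w /= [h1 h2]; rewrite /arrivals_between h1 h2.
Qed.

Lemma measurable_work (t : T -> R) : measurable_fun setT t -> (forall w, 0 <= t w) ->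
  measurable_fun setT (fun w => work (E ^~ w) (v ^~ w) (t w)).
Proof.
move=> mt t0; have := @measurable_arrivals_between (cst 0) t 0 (measurable_cst _) (fun=> lexx _) mt t0.
by congr measurable_fun; apply/funext => w; rewrite /work /arrivals /arrivals_between E0.
Qed.

(** Starting times and profiles are treated jointly: [nextE] expresses the next start through the
    current start, its profile and the work arrived by [c], and the next profile consists of the
    arrivals between the two starts. *)
Lemma measurable_batch_start k :
  (forall c : R, measurable [set w | (beta w k <= c%:E)%E]) /\
  (forall j, measurable_fun setT (fun w => m1_coord j (prof w k))).
Proof.
(* [fine] sends +oo to 0, so for [c >= 0] the event [c < fine (f w)] excludes the points where [f]
   is infinite. *)
have from_le (f : T -> \bar R) : (forall w, (0 <= f w)%E) ->
    (forall c : R, measurable [set w | (f w <= c%:E)%E]) -> measurable_fun setT (fine \o f).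
  move=> f0 h; apply: measurable_fun_gt_sets => c.
  have mfin := measurable_finite f0 h.
  have [c0|c0] := leP 0 c.
    rewrite (_ : [set w | _] = [set w | (f w < +oo)%E] `\` [set w | (f w <= c%:E)%E]).
      exact: measurableD.
    apply/seteqP; split=> w /=; case: (f w) (f0 w) => [x| |]//=.
    + by move=> _ cx; rewrite ltry lee_fin; split => //; apply/negP; rewrite -ltNge.
    + by move=> _; rewrite ltNge c0.
    + by move=> _ [_ /negP]; rewrite lee_fin -ltNge.
    + by move=> _ [].
  rewrite (_ : [set w | _] = setT)//; apply/seteqP; split=> w //= _.
  by apply: (lt_le_trans c0); exact: fine_ge0.
elim: k => [|k [ihb ihp]].
  split=> // c; rewrite /=; have [c0|c0] := leP 0 c.
    by rewrite (_ : [set w | _] = setT)//; apply/seteqP; split=> w //= _; rewrite lee_fin.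
  rewrite (_ : [set w | _] = set0)//; apply/seteqP; split=> w //=.
  by rewrite lee_fin leNgt c0.
have mb := from_le _ (beta_ge0 ^~ k) ihb.
have b0' w : 0 <= fine (beta w k) by exact: fine_ge0 (beta_ge0 w k).
have mS c : measurable [set w | (beta w k.+1 <= c%:E)%E].
  have [c0|c0] := leP 0 c; last first.
    rewrite (_ : [set w | _] = set0)//; apply/seteqP; split=> w //= h.
    by have := le_trans (beta_ge0 w k.+1) h; rewrite lee_fin leNgt c0.
  have -> : [set w | (beta w k.+1 <= c%:E)%E] =
      [set w | (beta w k <= c%:E)%E] `&`
      ([set w | fine (beta w k) + first_moment (prof w k) <= c] `&`
       [set w | work (E ^~ w) (v ^~ w) (fine (beta w k)) < work (E ^~ w) (v ^~ w) c]).
    by apply/seteqP; split=> w; [move=> /nextE[]|move=> [? [? ?]]; apply/nextE].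
  apply: measurableI => //; apply: measurableI.
    apply: measurable_le_set; last exact: measurable_cst.
    by apply: measurable_funD => //; exact: (ihp 0%N).
  apply: measurable_lt_set; first exact: measurable_work.
  by apply: (@measurable_work (cst c)); [exact: measurable_cst|].
split=> // j /=; apply: measurable_arrivals_between => //.
- exact: (from_le _ (beta_ge0 ^~ k.+1) mS).
- by move=> w; exact: fine_ge0 (beta_ge0 w k.+1).
Qed.

Variables (t : R).
Hypothesis t0 : 0 <= t.

Let b k w := fine (beta w k).

Let b_ge0 k w : 0 <= b k w.
Proof.
exact: fine_ge0 (beta_ge0 w k).
Qed.

Let cell k := [set w | (beta w k <= t%:E)%E] `\` [set w | (beta w k.+1 <= t%:E)%E].

Let measurable_cell k : measurable (cell k).
Proof.
by apply: measurableD; [exact: (measurable_batch_start k).1|exact: (measurable_batch_start k.+1).1].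
Qed.

(* On a cell the start of the current batch is at most t; truncating it there
   makes it measurable everywhere. *)
Let measurable_b k : measurable_fun setT (fun w => Num.min (b k w) t).
Proof.
apply: measurable_fun_gt_sets => c; have [tc|ct] := leP t c.
  rewrite (_ : [set w | _] = set0)//; apply/seteqP; split=> w //=.
  by rewrite lt_min [X in _ && X]ltNge tc andbF.
rewrite (_ : [set w | _] = ~` [set w | b k w <= c]); last first.
  apply/seteqP; split=> w /=; first by rewrite lt_min => /andP[h _]; apply/negP; rewrite -ltNge.
  by move=> /negP; rewrite -ltNge lt_min => ->.
apply: measurableC; have [c0|c0] := leP 0 c; last first.
  rewrite (_ : [set w | _] = set0)//; apply/seteqP; split=> w //=.
  by move=> /(le_trans (b_ge0 k w)); rewrite leNgt c0.
have mfin := measurable_finite (beta_ge0 ^~ k) (measurable_batch_start k).1.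
rewrite (_ : [set w | _] = [set w | (beta w k <= c%:E)%E] `|` ~` [set w | (beta w k < +oo)%E]).
  by apply: measurableU; [exact: (measurable_batch_start k).1|exact: measurableC].
apply/seteqP; split=> w /=; rewrite /b;
  case: (startP w k) => [->|[x x0 [-> _]]] /=.
- by move=> _; right; rewrite ltxx.
- by rewrite lee_fin; left.
- by [].
- by case=> [|/negP]; rewrite ?lee_fin// ltry.
Qed.

Let min_b k w : cell k w -> Num.min (b k w) t = b k w /\ beta w k = (b k w)%:E.
Proof.
rewrite /b => -[/= h _].
case: (startP w k) h => [->//|[x x0 [-> _]]] /=.
by rewrite lee_fin => xt; rewrite min_l.
Qed.

Let cell_cover w : exists k, cell k w.
Proof.
have [x [k [bk x0 xt tk]]] := last_batchP (b0 w) (v ^~ w) (E0 w) (@E_le w) (@E_right w) t0.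
exists k; rewrite /cell; split; first by rewrite /= bk lee_fin.
by rewrite /= => /(lt_le_trans tk); rewrite ltxx.
Qed.

Let min_ge0 k w : 0 <= Num.min (b k w) t.
Proof. by rewrite le_min b_ge0. Qed.

Lemma measurable_in_service j :
  measurable_fun setT (fun w => m1_coord j (in_service (b0 w) (E ^~ w) (v ^~ w) t)).
Proof.
apply: (@measurable_fun_cases nat cell
  (fun k w => m1_coord j (served (prof w k) (t - Num.min (b k w) t)))) => //.
  move=> k; apply: measurable_served.
  - exact: (measurable_batch_start k).2.
  - by apply: measurable_funB => //; exact: measurable_cst.
  - by move=> w; rewrite subr_ge0 ge_min lexx orbT.
move=> k w ck; have [-> bk] := min_b ck; case: ck => /= h1 h2.
rewrite (in_serviceE (E0 w) (@E_le w) (@E_right w) bk)//.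
  by move: h1; rewrite bk lee_fin.
by rewrite ltNge; exact/negP.
Qed.

Lemma measurable_in_waiting j :
  measurable_fun setT (fun w => m1_coord j (in_waiting (b0 w) (E ^~ w) (v ^~ w) t)).
Proof.
apply: (@measurable_fun_cases nat cell
  (fun k w => m1_coord j (arrivals_between (E ^~ w) (v ^~ w) (Num.min (b k w) t) t))) => //.
  by move=> k; apply: (@measurable_arrivals_between _ (cst t)) => //; exact: measurable_cst.
move=> k w ck; have [-> bk] := min_b ck; case: ck => /= h1 h2.
rewrite (in_waitingE (E0 w) (@E_le w) (@E_right w) bk)//.
  by move: h1; rewrite bk lee_fin.
by rewrite ltNge; exact/negP.
Qed.

End random_paths.

(** * Measurability of fluid paths in the initial measure *)

Section random_fluid.
Variables (alpha : R) (nu : M1 R) (xi : T -> M1 R).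
Hypothesis alpha0 : 0 < alpha.
Hypothesis mxi : forall j, measurable_fun setT (fun w => m1_coord j (xi w)).
Variables (t : R).
Hypothesis t0 : 0 <= t.

Let mw := measurable_first_moment mxi.

Let fm0 w : 0 <= first_moment (xi w). Proof. exact: first_moment_ge0. Qed.

Let cell (o : option nat) : set T :=
  if o is Some k then [set w | 0 < first_moment (xi w)] `&`
    ([set w | k%:R * first_moment (xi w) <= t] `&` [set w | t < k.+1%:R * first_moment (xi w)])
  else [set w | first_moment (xi w) <= 0].

Let measurable_cell o : measurable (cell o).
Proof.
have mc c : measurable_fun setT (fun w => c * first_moment (xi w)).
  by apply: measurable_funM => //; exact: measurable_cst.
case: o => [k|] /=; last by apply: measurable_le_set => //; exact: measurable_cst.
apply: measurableI; first by apply: measurable_lt_set => //; exact: measurable_cst.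
by apply: measurableI; [apply: measurable_le_set|apply: measurable_lt_set] => //;
  exact: measurable_cst.
Qed.

Let cell_cover w : exists o, cell o w.
Proof.
have [w0|w0] := leP (first_moment (xi w)) 0; first by exists None.
by have [k /andP[k1 k2]] := fluid_index w0 t0; exists (Some k).
Qed.

Let measurable_fluid_batch k j :
  measurable_fun setT (fun w => m1_coord j (fluid_batch alpha nu (xi w) k)).
Proof.
case: k => [|k] //=.
under eq_fun => w.
  rewrite m1_coord_scale; last by rewrite mulr_ge0// ltW.
  over.
apply: measurable_funM; last exact: measurable_cst.
by apply: measurable_funM => //; exact: measurable_cst.
Qed.

Let mtime k : measurable_fun setT (fun w => Num.max (t - k%:R * first_moment (xi w)) 0).
Proof.
apply: measurable_maxr; last exact: measurable_cst.
apply: measurable_funB; first exact: measurable_cst.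
by apply: measurable_funM => //; exact: measurable_cst.
Qed.

Lemma measurable_fluid_in_service j :
  measurable_fun setT (fun w => m1_coord j (fluid_in_service alpha nu (xi w) t)).
Proof.
apply: (@measurable_fun_cases (option nat) cell (fun o w => if o is Some k then
    m1_coord j (served (fluid_batch alpha nu (xi w) k) (Num.max (t - k%:R * first_moment (xi w)) 0))
  else m1_coord j (served (fluid_batch alpha nu (xi w) 1) 0))) => //.
- case=> [k|]; apply: measurable_served => //.
  by move=> w; rewrite le_max lexx orbT.
- case=> [k|] w /=.
    move=> [w0 [h1 h2]]; rewrite max_l ?subr_ge0//.
    by have [-> _] : _ := @fluid_piece R alpha nu (xi w) k t w0 (introT andP (conj h1 h2)).
  move=> w0; have w00 : first_moment (xi w) = 0 by apply/eqP; rewrite eq_le w0 fm0.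
  by have [-> _] := @fluid_w0 R alpha nu (xi w) t w00 t0.
Qed.

Lemma measurable_fluid_in_waiting j :
  measurable_fun setT (fun w => m1_coord j (fluid_in_waiting alpha nu (xi w) t)).
Proof.
apply: (@measurable_fun_cases (option nat) cell (fun o w => if o is Some k then
    alpha * Num.max (t - k%:R * first_moment (xi w)) 0 * m1_coord j nu else 0)) => //.
- case=> [k|]; last exact: measurable_cst.
  apply: measurable_funM; last exact: measurable_cst.
  by apply: measurable_funM => //; exact: measurable_cst.
- case=> [k|] w /=.
    move=> [w0 [h1 h2]]; rewrite max_l ?subr_ge0//.
    have [_ ->] : _ := @fluid_piece R alpha nu (xi w) k t w0 (introT andP (conj h1 h2)).
    by rewrite m1_coord_scale// mulr_ge0 ?(ltW alpha0)// subr_ge0.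
  move=> w0; have w00 : first_moment (xi w) = 0 by apply/eqP; rewrite eq_le w0 fm0.
  have [_ ->] := @fluid_w0 R alpha nu (xi w) t w00 t0.
  by rewrite m1_coord_scale mulr0// mul0r.
Qed.

End random_fluid.

End measurability.

(** * Deterministic fluid limit *)

Section scaling.
Variable R : realType.
Implicit Types z : M1 R.

Lemma tail_scale z c x : 0 <= c -> tail (M1_scale c z) x = c * tail z x.
Proof.
move=> c0; rewrite /tail /= /mscale fineM//=; first by rewrite (ger0_norm c0).
by apply: m1_fin; exact: measurable_itv.
Qed.

(** Multiplying [z] by [c] multiplies its truncated moments by [c], so the inverse of the scaled
    measure at [c * t] is that of [z] at [t]. Once the work is exhausted, both sides have mass 0. *)
Lemma m1_coord_served_scale c z t j : 0 < c -> 0 <= t ->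
  m1_coord j (M1_scale c (served z t)) = m1_coord j (served (M1_scale c z) (c * t)).
Proof.
move=> c0 t0; have c0' := ltW c0; have ct0 : 0 <= c * t by rewrite mulr_ge0.
have massE : c * mass (served z t) = mass (served (M1_scale c z) (c * t)).
  case: (invP z t0) => [s tw E s0 st hl _|wt m0].
    case: (invP (M1_scale c z) ct0) => [s' _ E' s'0 st' hl' _|]; last first.
      by rewrite first_moment_scale// ler_pM2l//; lra.
    have st1 : truncated_moment z s' = t.
      by apply: (mulfI (lt0r_neq0 c0)); rewrite -truncated_moment_scale.
    have ss' : s = s'.
      have [h|h|//] := ltgtP s' s; first by have := hl _ h; rewrite st1 ltxx.
      by have := hl' _ h; rewrite truncated_moment_scale// st ltxx.
    by rewrite /served E E' !mass_shift// tail_scale// ss'.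
  case: (invP (M1_scale c z) ct0) => [s' + _ _ _ _ _|_ m0'].
    by rewrite first_moment_scale// ltr_pM2l//; lra.
  by rewrite /served m0 m0' mulr0.
have tmE q : 0 <= q -> c * truncated_moment (served z t) q =
    truncated_moment (served (M1_scale c z) (c * t)) q.
  move=> q0; case: (invP z t0) => [s tw E s0 st hl _|wt m0].
    case: (invP (M1_scale c z) ct0) => [s' _ E' s'0 st' hl' _|]; last first.
      by rewrite first_moment_scale// ler_pM2l//; lra.
    have st1 : truncated_moment z s' = t.
      by apply: (mulfI (lt0r_neq0 c0)); rewrite -truncated_moment_scale.
    have ss' : s = s'.
      have [h|h|//] := ltgtP s' s; first by have := hl _ h; rewrite st1 ltxx.
      by have := hl' _ h; rewrite truncated_moment_scale// st ltxx.
    by rewrite /served E E' !truncated_moment_shift// !truncated_moment_scale// ss' mulrBr.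
  have m1 := massE; move: m1; rewrite {1}/served m0 mulr0 => /esym m1.
  by rewrite !truncated_moment_null// mulr0.
rewrite m1_coord_scale//; case: j => [|j] /=.
  by rewrite !first_moment_served// first_moment_scale// maxr_pMr// mulrBr mulr0.
by set q := ratr _; have [q0|/ltW q0] := leP 0 q; [exact: tmE|rewrite !truncated_moment_le0// mulrCA massE].
Qed.

Lemma m1_coord_arrivals_between (E : R -> nat) v s t j : (E s <= E t)%N ->
  m1_coord j (arrivals_between E v s t) =
  m1_coord j (arrivals E v t) - m1_coord j (arrivals E v s).
Proof.
move=> st; rewrite /arrivals_between /arrivals.
case: j => [|j] /=.
  by rewrite !first_moment_point_masses (@big_cat_nat _ _ _ (E s) 0 (E t))//= [RHS]addrAC subrr add0r.
set q := ratr _; have [q0|/ltW q0] := leP 0 q.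
  by rewrite !truncated_moment_point_masses// (@big_cat_nat _ _ _ (E s) 0 (E t))//= [RHS]addrAC subrr add0r.
by rewrite !truncated_moment_le0// !mass_point_masses !subn0 natrB// mulrBr.
Qed.

(* All that convergence needs to know about a fluid scaled sample path; [arr] is the
   scaled arrival process and [bt], [B] are the scaled starting times and profiles of
   the batches. *)
Record gated (sv wt arr : R -> M1 R) (bt : nat -> \bar R) (B : nat -> M1 R) : Prop := Gated {
  gated0 : bt 0%N = 0%E ;
  gated_start : forall k, bt k = +oo%E \/ exists2 b, 0 <= b & bt k = b%:E ;
  gated_le : forall k, (bt k <= bt k.+1)%E ;
  gated_next : forall k b t, bt k = b%:E -> (bt k.+1 <= t%:E)%E <->
    b + first_moment (B k) <= t /\ first_moment (arr b) < first_moment (arr t) ;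
  gated_batch : forall k b c j, bt k = b%:E -> bt k.+1 = c%:E ->
    m1_coord j (B k.+1) = m1_coord j (arr c) - m1_coord j (arr b) ;
  gated_last : forall t, 0 <= t -> exists b k,
    [/\ bt k = b%:E, 0 <= b, b <= t & (t%:E < bt k.+1)%E] ;
  gated_service : forall k b t j, bt k = b%:E -> b <= t -> (t%:E < bt k.+1)%E ->
    m1_coord j (sv t) = m1_coord j (served (B k) (t - b)) ;
  gated_waiting : forall k b t j, bt k = b%:E -> b <= t -> (t%:E < bt k.+1)%E ->
    m1_coord j (wt t) = m1_coord j (arr t) - m1_coord j (arr b) }.

(** Time and mass are divided by the same [r], so work still drains at unit rate and the rule for
    the next start keeps its form. *)
Lemma scaled_gated (r : R) (b0 : M1 R) (E : R -> nat) (v : nat -> R) : 0 < r ->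
  E 0 = 0%N -> (forall s t, 0 <= s -> s <= t -> (E s <= E t)%N) ->
  (forall t, 0 <= t -> exists2 e, 0 < e & forall s, t <= s < t + e -> E s = E t) ->
  gated (fun t => M1_scale r^-1 (in_service b0 E v (r * t)))
    (fun t => M1_scale r^-1 (in_waiting b0 E v (r * t)))
    (fun t => M1_scale r^-1 (arrivals E v (r * t)))
    (fun k => (r^-1)%:E * batch_start b0 E v k)%E
    (fun k => M1_scale r^-1 (batch b0 E v k)).
Proof.
move=> r0 E0 E_le E_right; have ri0 : 0 < r^-1 by rewrite invr_gt0.
have ri0' := ltW ri0.

have rK x : r * (r^-1 * x) = x by rewrite mulrA divff ?gt_eqF// mul1r.
have Kr x : r^-1 * (r * x) = x by rewrite mulrA mulVf ?gt_eqF// mul1r.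
have ltE k t : ((t%:E < (r^-1)%:E * batch_start b0 E v k) = ((r * t)%:E < batch_start b0 E v k))%E.
  case: (batch_startP b0 v E0 E_le E_right k) => [->|[b _ [-> _]]].
    by rewrite gt0_muley ?lte_fin// !ltry.
  by rewrite -EFinM !lte_fin -[in LHS](Kr t) ltr_pM2l.
have leE k t : (((r^-1)%:E * batch_start b0 E v k <= t%:E) = (batch_start b0 E v k <= (r * t)%:E))%E.
  by rewrite leNgt ltE -leNgt.
have finE k b : ((r^-1)%:E * batch_start b0 E v k = b%:E)%E -> batch_start b0 E v k = (r * b)%:E /\ 0 <= r * b.
  case: (batch_startP b0 v E0 E_le E_right k) => [->|[c c0 [-> _]]].
    by rewrite gt0_muley ?lte_fin.
  by rewrite -EFinM => -[<-]; rewrite rK.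
split.
- by rewrite /= mule0.
- move=> k; case: (batch_startP b0 v E0 E_le E_right k) => [->|[c c0 [-> _]]].
    by left; rewrite gt0_muley ?lte_fin.
  by right; exists (r^-1 * c) => //; rewrite mulr_ge0.
- move=> k; apply: lee_wpmul2l; first by rewrite lee_fin.
  exact: batch_start_le.
- move=> k b t /finE[bk b0']; rewrite leE (batch_start_next E0 E_le E_right _ bk).
  rewrite !first_moment_scale// ltr_pM2l// -/(work E v _).
  have -> : (b + r^-1 * first_moment (batch b0 E v k) <= t) =
      (r * b + first_moment (batch b0 E v k) <= r * t).
    by rewrite -[in LHS](Kr b) -[in LHS](Kr t) -mulrDr ler_pM2l.
  by [].
- move=> k b c j /finE[bk b0'] /finE[ck c0'].
  have -> : batch b0 E v k.+1 = arrivals_between E v (r * b) (r * c).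
    rewrite -[LHS]/(arrivals_between E v (fine (batch_start b0 E v k))
      (fine (batch_start b0 E v k.+1))).
    by rewrite bk ck.
  rewrite !m1_coord_scale// -mulrBr; congr (_ * _).
  have [_ /ltW bc _ _] := batch_start_lt E0 E_le E_right bk ck.
  by rewrite m1_coord_arrivals_between//; exact: E_le.
- move=> t t0; have rt0 : 0 <= r * t by rewrite mulr_ge0// ltW.
  have [b [k [bk b0' bt tk]]] := last_batchP b0 v E0 E_le E_right rt0.
  exists (r^-1 * b), k; split.
  + by rewrite bk.
  + by rewrite mulr_ge0.
  + by rewrite -(Kr t) ler_pM2l.
  + by rewrite ltE.
- move=> k b t j /finE[bk b0'] bt; rewrite ltE => tk.
  rewrite (in_serviceE E0 E_le E_right bk _ tk); last by rewrite ler_pM2l.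
  rewrite m1_coord_served_scale//; last by rewrite subr_ge0 ler_pM2l.
  by rewrite -mulrBr Kr.
- move=> k b t j /finE[bk b0'] bt; rewrite ltE => tk.
  have rbt : r * b <= r * t by rewrite ler_pM2l.
  rewrite (in_waitingE E0 E_le E_right bk _ tk)//.
  by rewrite !m1_coord_scale// m1_coord_arrivals_between ?mulrBr// E_le.
Qed.

End scaling.

Lemma near_ltn (S : Type) (F : set_system S) (FF : Filter F) N (P : nat -> S -> Prop) :
  (forall i, (i < N)%N -> \forall s \near F, P i s) ->
  \forall s \near F, forall i, (i < N)%N -> P i s.
Proof.
elim: N => [|N ih] h; first by apply: filterE.
have hN := h N (ltnSn N); have := ih (fun i iN => h i (ltnW iN)).
move=> {}ih; apply: filterS2 hN ih => s hN hs i; rewrite ltnS leq_eqVlt => /orP[/eqP ->//|].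
exact: hs.
Qed.

Lemma dist_increments (R : realType) (a b s t e : R) : `|a - b| < e -> `|s - t| < e ->
  `|t - b - (s - a)| < 2 * e.
Proof. by rewrite !ltr_norml => /andP[? ?] /andP[? ?]; apply/andP; split; lra. Qed.

Lemma dist_approx (R : realType) (x y x' y' z d D : R) : `|x - x'| < d -> `|y - y'| < d ->
  `|x' - y' - z| <= D -> `|x - y - z| < D + 2 * d.
Proof.
by rewrite ler_norml !ltr_norml => /andP[? ?] /andP[? ?] /andP[? ?]; apply/andP; split; lra.
Qed.

(** A zero first moment concentrates [z] at 0, which is not an atom. *)
Lemma mass_of_first_moment0 (R : realType) (z : M1 R) : z [set 0] = 0%E ->
  first_moment z = 0 -> mass z = 0.
Proof.
move=> z0 fz; have t0 : tail z 0 = 0.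
  apply/eqP; rewrite eq_le tail_ge0 andbT leNgt; apply/negP => tp.
  have [h h0] := tail_right z 0 tp; rewrite subrr add0r => th.
  have := lt_truncated_moment h0 th; rewrite truncated_moment0.
  by have := truncated_moment_le_first z h; lra.
apply/eqP; rewrite eq_le mass_ge0 andbT leNgt; apply/negP => mp.
have [h h0] := tail_left z0 mp; rewrite t0 sub0r add0r tail_neg ?oppr_lt0//.
by rewrite ltxx.
Qed.

Lemma m1_coord_bound (R : realType) j : exists2 C : R, 0 <= C & forall z : M1 R,
  `|m1_coord j z| <= C * (first_moment z + mass z).
Proof.
case: j => [|j] /=.
  exists 1 => // z; rewrite mul1r ger0_norm ?first_moment_ge0//.
  by rewrite lerDl mass_ge0.
set q := ratr _; exists (1 + `|q|) => [|z]; first by rewrite addr_ge0.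
have fz := first_moment_ge0 z; have mz := mass_ge0 z.
have h : 0 <= `|q| * (first_moment z + mass z) by rewrite mulr_ge0// addr_ge0.
have [q0|/ltW q0] := leP 0 q.
  rewrite ger0_norm ?truncated_moment_ge0//.
  by have := truncated_moment_le_first z q; lra.
rewrite truncated_moment_le0// normrM (ger0_norm mz).
have : 0 <= `|q| * first_moment z by rewrite mulr_ge0.
lra.
Qed.

(** * Convergence of gated paths along a filter *)

Section fluid_limit.
Variables (R : realType) (alpha : R) (nu xi : M1 R).
Hypothesis alpha0 : 0 < alpha.
Hypothesis nu1 : first_moment nu = alpha^-1.
Hypothesis nu_atom : forall x, nu [set x] = 0%E.
Hypothesis xi_atom : forall x, xi [set x] = 0%E.
Variables (S : Type) (F : set_system S) (FF : Filter F).
Variables (sv wt arr : S -> R -> M1 R) (bt : S -> nat -> \bar R) (B : S -> nat -> M1 R).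
Hypothesis gat : forall s, gated (sv s) (wt s) (arr s) (bt s) (B s).
Hypothesis cB : forall j, m1_coord j (B s 0%N) @[s --> F] --> m1_coord j xi.
Hypothesis carr : forall j T e, 0 < e -> \forall s \near F, forall t, 0 <= t <= T ->
  `|m1_coord j (arr s t) - alpha * t * m1_coord j nu| < e.

Let w := first_moment xi.
Let A s t := first_moment (arr s t).
Let w0 : 0 <= w. Proof. exact: first_moment_ge0. Qed.

Let alpha_nu1 t : alpha * t * m1_coord 0 nu = t.
Proof. by rewrite /= nu1 mulrAC divff ?mul1r// gt_eqF. Qed.

(** The load [alpha * first_moment nu] is 1: in the limit work arrives at unit rate. *)
Let cA T e : 0 < e -> \forall s \near F, forall t, 0 <= t <= T -> `|A s t - t| < e.
Proof.
move=> e0; have := carr 0%N T e0; apply: filterS => s h t tT.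
by have := h t tT; rewrite alpha_nu1.
Qed.

Let fluid_batch_w k : first_moment (fluid_batch alpha nu xi k) = w.
Proof.
case: k => [//|k] /=; rewrite first_moment_scale; last by rewrite mulr_ge0// ltW.
exact: alpha_nu1.
Qed.

Lemma fluid_batch_atom k x : fluid_batch alpha nu xi k [set x] = 0%E.
Proof. by case: k => [|k] //=; rewrite /mscale/= nu_atom mule0. Qed.

Let bs s i := fine (bt s i).

(** By induction on [i]. The next start cannot precede the end of the batch, nor be much later,
    because work arrives at nearly unit rate. The new profile is an increment of the arrivals over a
    period that tends to [w]. *)
Lemma fluid_start i : 0 < w ->
  [/\ \forall s \near F, bt s i = (bs s i)%:E /\ 0 <= bs s i,
      bs s i @[s --> F] --> i%:R * w &
      forall j, m1_coord j (B s i) @[s --> F] --> m1_coord j (fluid_batch alpha nu xi i)].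
Proof.
move=> wp; elim: i => [|i [ihb ihc ihB]].
  split=> //; first by apply: filterE => s; rewrite /bs (gated0 (gat s)).
  rewrite mul0r; apply: cvg_trans (_ : cst 0 @ F --> (0 : R)); last exact: cvg_cst.
  by apply: near_eq_cvg; apply: filterE => s; rewrite /bs (gated0 (gat s)).
have ihw : first_moment (B s i) @[s --> F] --> w.
  by rewrite -(fluid_batch_w i); exact: (ihB 0%N).
pose T := i.+2%:R * w + 2.
have i2 : i.+2%:R * w = i%:R * w + 2 * w by rewrite -addn2 natrD mulrDl.
have i1 : i.+1%:R * w = i%:R * w + w by rewrite -addn1 natrD mulrDl mul1r.
have iw : 0 <= i%:R * w :> R by rewrite mulr_ge0.
have step e : 0 < e -> e < 1 -> \forall s \near F,
    [/\ bt s i.+1 = (bs s i.+1)%:E, 0 <= bs s i <= T, 0 <= bs s i.+1 <= T &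
        `|i.+1%:R * w - bs s i.+1| < e /\ bt s i = (bs s i)%:E].
  move=> e0 e1; have e8 : 0 < e / 8 by lra.
  near=> s.
  have [bE b0] : bt s i = (bs s i)%:E /\ 0 <= bs s i by near: s.
  have hb : `|i%:R * w - bs s i| < e / 8 by near: s; exact: near_dist_lt.
  have hw : `|w - first_moment (B s i)| < e / 8 by near: s; exact: near_dist_lt.
  have hA : forall t, 0 <= t <= T -> `|A s t - t| < e / 8 by near: s; exact: cA.
  move: (hb) (hw); rewrite !ltr_norml => /andP[hb1 hb2] /andP[hw1 hw2].
  (* The arrived work is known up to [e / 8] at each end, so some work has certainly arrived between
     [bs s i] and [t], and the next batch has started by [t]. *)
  pose t := bs s i + first_moment (B s i) + e / 2.
  have W0 := first_moment_ge0 (B s i).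
  have tT : 0 <= t <= T by apply/andP; split; rewrite /t /T ?i2; lra.
  have bT : 0 <= bs s i <= T by apply/andP; split; rewrite /T ?i2; lra.
  have ble : (bt s i.+1 <= t%:E)%E.
    apply/(gated_next (gat s) _ bE); split; first by rewrite /t; lra.
    have := hA _ tT; have := hA _ bT; rewrite !ltr_norml -/(A s t) -/(A s (bs s i)).
    move=> /andP[h1 h2] /andP[h3 h4]; move: h3; rewrite /t; lra.
  have [c c0 cE] : exists2 c, 0 <= c & bt s i.+1 = c%:E.
    by case: (gated_start (gat s) i.+1) ble => [->|].
  have bsE : bs s i.+1 = c by rewrite /bs cE.
  have [cl _] : bs s i + first_moment (B s i) <= c /\ A s (bs s i) < A s c.
    by apply/(gated_next (gat s) _ bE); rewrite cE.
  move: ble; rewrite cE bsE lee_fin => ct; split => //.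
    by rewrite c0 (le_trans ct)//; case/andP : tT.
  split=> //; rewrite i1; move: ct; rewrite /t.
  move=> ct; apply/andP; split; lra.
have cb : bs s i.+1 @[s --> F] --> i.+1%:R * w.
  apply/cvgrPdist_lt => e e0; have m0 : 0 < Num.min e (1 / 2) by rewrite lt_min e0/=; lra.
  have m1 : Num.min e (1 / 2) < 1 by rewrite gt_min; apply/orP; right; lra.
  apply: filterS (step _ m0 m1) => s [_ _ _ [+ _]].
  by move=> /lt_le_trans; apply; rewrite ge_min lexx.
have half : 0 < 1 / 2 :> R by lra.
have half1 : 1 / 2 < 1 :> R by lra.
have hs := step _ half half1.
split=> //.
  by apply: filterS hs => s [-> _ /andP[]].
move=> j; apply/cvgrPdist_lt => e e0; have e4 : 0 < e / 4 by lra.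
have cg : alpha * (bs s i.+1 - bs s i) * m1_coord j nu @[s --> F] -->
    alpha * w * m1_coord j nu.
  have -> : alpha * w = alpha * (i.+1%:R * w - i%:R * w) by rewrite i1; congr (_ * _); lra.
  apply: cvgM (cvg_cst _); apply: cvgM (cvg_cst _) _.
  exact: cvgB.
have fE : m1_coord j (fluid_batch alpha nu xi i.+1) = alpha * w * m1_coord j nu.
  by rewrite /= m1_coord_scale// mulr_ge0// ltW.
rewrite fE; near=> s.
have [cE bT cT [_ bE]] : [/\ bt s i.+1 = (bs s i.+1)%:E, 0 <= bs s i <= T, 0 <= bs s i.+1 <= T &
        `|i.+1%:R * w - bs s i.+1| < 1 / 2 /\ bt s i = (bs s i)%:E] by near: s.
have hA : forall t, 0 <= t <= T -> `|m1_coord j (arr s t) - alpha * t * m1_coord j nu| < e / 4.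
  by near: s; exact: carr.
have hg : `|alpha * w * m1_coord j nu - alpha * (bs s i.+1 - bs s i) * m1_coord j nu| < e / 4.
  by near: s; exact: near_dist_lt.
rewrite (gated_batch (gat s) j bE cE); move: hg (hA _ bT) (hA _ cT).
have -> : alpha * (bs s i.+1 - bs s i) * m1_coord j nu =
  alpha * bs s i.+1 * m1_coord j nu - alpha * bs s i * m1_coord j nu by rewrite mulrBr mulrBl.
rewrite !ltr_norml => /andP[h1 h2] /andP[h3 h4] /andP[h5 h6].
apply/andP; split; lra.
Unshelve. all: by end_near. Qed.


Let served_close k N : 0 < w -> exists n, forall i, (i < N)%N -> forall z' t t',
  m1_close n z' (fluid_batch alpha nu xi i) -> 0 <= t <= w -> 0 <= t' ->
  `|t' - t| < 2^-1 ^+ n ->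
  m1_close k (served z' t') (served (fluid_batch alpha nu xi i) t).
Proof.
move=> wp; elim: N => [|N [n hn]]; first by exists 0%N.
have [m hm] := m1_close_served k (fluid_batch_atom N) (ltW wp).
exists (maxn n m) => i; rewrite ltnS leq_eqVlt => /orP[/eqP -> {i}|iN] z' t t' h tw t0 tt'.
  apply: hm => //; first exact: m1_close_le (leq_maxr n m) h.
  by apply: (lt_le_trans tt'); exact/half_exp_le/leq_maxr.
apply: hn => //; first exact: m1_close_le (leq_maxl n m) h.
by apply: (lt_le_trans tt'); exact/half_exp_le/leq_maxl.
Qed.

(** A piecewise affine map taking [b i] to [i%:R * w]. With [e <= w / 4], consecutive [b i] differ
    by at least [w / 2], so the affine pieces can be chained. *)
Let grid_change (b : nat -> R) e N : 0 < w -> b 0%N = 0 ->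
  (forall i, (i < N.+1)%N -> `|i%:R * w - b i| < e) -> e <= w / 4 ->
  exists l, [/\ time_change l, l (b N) = N%:R * w & forall t, 0 <= t < b N ->
    exists i, [/\ (i < N)%N, b i <= t < b i.+1, i%:R * w <= l t < i.+1%:R * w
      & `|l t - t| < e]].
Proof.
move=> wp b0; elim: N => [|N ih] hb ew.
  exists id; split; [exact: time_change_id|by rewrite b0 mul0r|].
  by move=> t; rewrite b0 => /andP[t0 /(le_lt_trans t0)]; rewrite ltxx.
have [l [lt lN hl]] := ih (fun i iN => hb i (ltnW iN)) ew.
have hN := hb N (ltnW (ltnSn _)); have hN1 := hb N.+1 (ltnSn _).
have N1 : N.+1%:R * w = N%:R * w + w by rewrite -addn1 natrD mulrDl mul1r.
have bb : b N < b N.+1.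
  by move: hN hN1; rewrite N1 !ltr_norml => /andP[? ?] /andP[? ?]; lra.
have bN0 : 0 <= b N.
  case: N {ih N1 l lt lN hl bb hN1} hb hN => [|N] hb hN; first by rewrite b0.
  have : w <= N.+1%:R * w by rewrite ler_peMl ?(ltW wp)// ler1n.
  by move: hN; rewrite !ltr_norml => /andP[? ?]; lra.
have NN : N%:R * w < N.+1%:R * w by rewrite N1 ltrDl.
have [l' [tl' l'l l'b l'r l'e]] := time_change_extend lt bN0 lN bb NN.
exists l'; split=> // t /andP[t0 tb]; have [tN|Nt] := ltP t (b N).
  have tN' : 0 <= t < b N by rewrite t0.
  have [i [iN it lit e1]] := hl t tN'.
  by exists i; rewrite l'l ?(ltW tN)//; split => //; exact: ltnW.
exists N; split => //; first by rewrite Nt.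
  exact: l'r.
by apply: l'e => //; rewrite Nt ltW.
Qed.

Lemma fluid_limit_pos k : 0 < w -> \forall s \near F, exists2 l, time_change l &
  forall t, 0 <= t -> t <= k%:R -> [/\ `|l t - t| < 2^-1 ^+ k,
    m1_close k (sv s t) (fluid_in_service alpha nu xi (l t)) &
    m1_close k (wt s t) (fluid_in_waiting alpha nu xi (l t))].
Proof.
move=> wp.
(* [N] fluid batches cover [[0, k + 1]]; the extra unit absorbs the error in the start of batch
   [N]. *)
pose N := (Num.truncn ((k%:R + 1) / w)).+1.
have kN : k%:R + 1 < N%:R * w by rewrite -ltr_pdivrMr//; exact: truncnS_gt.
have [n hn] := served_close k N wp.
pose M := \sum_(j < k.+1) `|m1_coord j nu|.
have M0 : 0 <= M by apply: sumr_ge0.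
have hM j : (j <= k)%N -> `|m1_coord j nu| <= M.
  move=> jk; rewrite -ltnS in jk; rewrite /M (bigD1 (Ordinal jk))//= lerDl.
  by apply: sumr_ge0.
have aM : 0 <= alpha * M by rewrite mulr_ge0// ltW.
have hk := half_exp_gt0 R k.
have k8 : 2^-1 ^+ k / 2 + 2 * (2^-1 ^+ k / 8) <= 2^-1 ^+ k :> R by lra.
have hnp := half_exp_gt0 R n; have hk1 := half_exp_le1 R k.
(* The bounds on [e] serve, in turn, the time change, the service times, which are matched up to
   [2 * e], the monotonicity of the starts, and the waiting jobs, for which [alpha * (2 * e) * M]
   must be small. *)
pose e := Num.min (Num.min (2^-1 ^+ k) (2^-1 ^+ n / 2))
  (Num.min (w / 4) (2^-1 ^+ k / (4 * (alpha * M + 1)))).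
have aM1 : 0 < 4 * (alpha * M + 1) by lra.
have e0 : 0 < e by rewrite !lt_min hk !divr_gt0.
have ek : e <= 2^-1 ^+ k by rewrite !ge_min lexx.
have en : e <= 2^-1 ^+ n / 2 by rewrite !ge_min lexx !orbT.
have ew : e <= w / 4 by rewrite !ge_min lexx !orbT.
have eM : (alpha * M + 1) * e <= 2^-1 ^+ k / 4.
  have : e <= 2^-1 ^+ k / (4 * (alpha * M + 1)) by rewrite !ge_min lexx !orbT.
  by rewrite ler_pdivlMr//; lra.
have e2n : 2 * e <= 2^-1 ^+ n by lra.
have eM2 : alpha * (2 * e) * M <= 2^-1 ^+ k / 2.
  by rewrite (_ : alpha * (2 * e) * M = 2 * (alpha * M * e)); lra.
have d0 : 0 < 2^-1 ^+ k / 8 :> R by rewrite divr_gt0.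
near=> s.
have hb : forall i, (i < N.+1)%N -> bt s i = (bs s i)%:E /\ 0 <= bs s i.
  by near: s; apply: near_ltn => i _; have [] := fluid_start i wp.
have he : forall i, (i < N.+1)%N -> `|i%:R * w - bs s i| < e.
  near: s; apply: near_ltn => i _; have [_ h _] := fluid_start i wp.
  exact: near_dist_lt.
have hB : forall i, (i < N)%N -> m1_close n (B s i) (fluid_batch alpha nu xi i).
  near: s; apply: near_ltn => i _; have [_ _ h] := fluid_start i wp.
  exact: (m1_close_cvg _ _ _).2.
have hA : forall j, (j < k.+1)%N -> forall t, 0 <= t <= k%:R ->
    `|m1_coord j (arr s t) - alpha * t * m1_coord j nu| < 2^-1 ^+ k / 8.
  by near: s; apply: near_ltn => j _; exact: carr.
have b00 : bs s 0%N = 0 by rewrite /bs (gated0 (gat s)).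
have [l [tl lN hl]] := grid_change wp b00 he ew.
exists l => // t t0 tk.
have tN : 0 <= t < bs s N.
  have := le_trans (ltW (le_lt_trans (ler_norm _) (he N (ltnSn _)))) (le_trans ek hk1).
  by rewrite lerBlDr t0/= => h; rewrite (le_lt_trans tk)// -(ltrD2r 1) (lt_le_trans kN)// addrC.
have [i [iN /andP[bit tbi] lit lte]] := hl t tN.
have [bE bi0] := hb i (ltnW iN); have [bE1 _] := hb i.+1 iN.
have tbi' : (t%:E < bt s i.+1)%E by rewrite bE1 lte_fin.
have [-> ->] := fluid_piece alpha nu wp lit.
have hei := he i (ltnW iN).
have dist : `|t - bs s i - (l t - i%:R * w)| < 2 * e.
  exact: dist_increments.
have /andP[lit1 lit2] := lit.
split.
- exact: lt_le_trans lte ek.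
- have h : m1_close k (served (B s i) (t - bs s i)) (served (fluid_batch alpha nu xi i) (l t - i%:R * w)).
    apply: (hn i iN); first exact: hB.
    + rewrite subr_ge0 lit1/= lerBlDl; move: (ltW lit2).
      by rewrite -addn1 natrD mulrDl mul1r.
    + by rewrite subr_ge0.
    + exact: lt_le_trans dist e2n.
  by move=> j jk; rewrite (gated_service (gat s) j bE bit tbi'); exact: h.
- move=> j jk; rewrite (gated_waiting (gat s) j bE bit tbi').
  rewrite m1_coord_scale; last by rewrite mulr_ge0 ?subr_ge0// ltW.
  have tk' : 0 <= t <= k%:R by rewrite t0.
  have bk' : 0 <= bs s i <= k%:R by rewrite bi0 (le_trans bit).
  move: (hA j jk _ tk') (hA j jk _ bk').
  have h : `|alpha * (t - bs s i - (l t - i%:R * w)) * m1_coord j nu| <= 2^-1 ^+ k / 2.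
    rewrite !normrM (gtr0_norm alpha0).
    apply: (@le_trans _ _ (alpha * (2 * e) * M)).
      apply: ler_pM; rewrite ?mulr_ge0//; [exact: ltW|by apply: ler_wpM2l; apply: ltW|exact: hM].
    exact: eM2.
  move: h; have -> : alpha * (t - bs s i - (l t - i%:R * w)) * m1_coord j nu =
     alpha * t * m1_coord j nu - alpha * bs s i * m1_coord j nu
       - alpha * (l t - i%:R * w) * m1_coord j nu.
    by ring.
  move=> h1 h2 h3; apply: (lt_le_trans (dist_approx h2 h3 h1)).
  exact: k8.
Unshelve. all: by end_near. Qed.


Let cmass T e : 0 < e -> \forall s \near F, forall t, 0 <= t <= T ->
  `|mass (arr s t) - alpha * t * mass nu| < e.
Proof.
have [j hj] := m1_coord_ratr R (-1).
have mE (z : M1 R) : m1_coord j z = - mass z.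
  by rewrite hj rmorphN1 truncated_moment_le0 ?lerN10// mulN1r.
move=> e0; have := carr j T e0; apply: filterS => s h t tT.
by have := h t tT; rewrite !mE mulrN -opprD normrN.
Qed.

(* The quantity [b + w - A b], where the batch starting at [b] has work [w], does not
   exceed its previous value unless the server idles, in which case it is almost 0. *)
Lemma fluid_batches_null T e : w = 0 -> 0 <= T -> 0 < e -> \forall s \near F,
  forall t, 0 <= t <= T -> exists b i, [/\ bt s i = b%:E, 0 <= b, b <= t,
    (t%:E < bt s i.+1)%E & first_moment (B s i) + mass (B s i) < e /\ t - b < e].
Proof.
move=> wz T0 e0; have mxi : mass xi = 0 by exact: mass_of_first_moment0.
pose m := alpha * mass nu; have m0 : 0 <= m by rewrite mulr_ge0 ?mass_ge0// ltW.
pose d := Num.min (1 / 8) (e / (8 * (m + 1))).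
have m1 : 0 < 8 * (m + 1) by lra.
have d0 : 0 < d by rewrite lt_min !divr_gt0//.
have d8 : d <= 1 / 8 by rewrite ge_min lexx.
have de : 8 * (m * d + d) <= e.
  have : d <= e / (8 * (m + 1)) by rewrite ge_min lexx orbT.
  by rewrite ler_pdivlMr//; lra.
have md : 0 <= m * d by rewrite mulr_ge0// ltW.
have cW := near_dist_lt FF (@cB 0%N) d0.
have cM := near_dist_lt FF (cvg_mass FF cB) d0.
apply: filterS3 cW cM (filterI (cA (T + 1) d0) (cmass (T + 1) d0)) => s /=.
rewrite -/w wz sub0r normrN mxi sub0r normrN => /ltr_normlW hW /ltr_normlW hM [hA hN].
have Ad b : 0 <= b -> b <= T + 1 -> b - d < A s b /\ A s b < b + d.
  move=> b0 bT; have bT' : 0 <= b <= T + 1 by rewrite b0.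
  by have := hA b bT'; rewrite ltr_norml => /andP[? ?]; split; lra.
(* At time [t], the maximum below, the batch is finished. Also [A s t > t - d >= A s b], so new work
   has arrived. *)
have next i b c : bt s i = b%:E -> bt s i.+1 = c%:E -> 0 <= b -> b <= T ->
    b + first_moment (B s i) - A s b < 2 * d ->
    c <= Num.max (b + first_moment (B s i)) (A s b + d).
  move=> bE cE b0 bT D; rewrite -lee_fin -cE; apply/(gated_next (gat s) _ bE).
  have bT1 : b <= T + 1 by lra.
  have [A1 A2] := Ad b b0 bT1; have fB := first_moment_ge0 (B s i).
  set t := Num.max _ _; have t0 : 0 <= t by rewrite le_max; apply/orP; left; lra.
  have tT : t <= T + 1 by rewrite ge_max; apply/andP; split; lra.
  have [A3 _] := Ad t t0 tT; split; first by rewrite le_max lexx.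
  rewrite -/(A s b) -/(A s t).
  have : A s b + d <= t by rewrite le_max lexx orbT.
  lra.
have start i b : bt s i = b%:E -> 0 <= b.
  by case: (gated_start (gat s) i) => [->//|[c c0 ->] [<-]].
have prev i c : bt s i.+1 = c%:E -> exists2 b, bt s i = b%:E & b <= c.
  move=> cE; have := gated_le (gat s) i; rewrite cE.
  by case: (gated_start (gat s) i) => [->//|[b b0 ->]]; rewrite lee_fin; exists b.
have D i b : bt s i = b%:E -> b <= T -> b + first_moment (B s i) - A s b < 2 * d.
  elim: i b => [|i ih] c cE cT.
    have c0 : c = 0 by move: cE; rewrite (gated0 (gat s)) => -[].
    have T1 : 0 <= T + 1 by lra.
    by have [] := Ad 0 (lexx 0) T1; move: hW; rewrite c0 /=; lra.
  have [b bE bc] := prev _ _ cE; have bT := le_trans bc cT; have b0 := start _ _ bE.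
  have Db := ih b bE bT; have := next i b c bE cE b0 bT Db.
  (* The work telescopes: the quantity for the new batch equals [c - A s b], which [next] bounds by
     that of the old batch or by [d]. *)
  have -> : first_moment (B s i.+1) = A s c - A s b by exact: (gated_batch (gat s) 0%N bE cE).
  by rewrite le_max => /orP[]; lra.
move=> t /andP[t0 tT]; have [b [i [bE b0 bt' tb]]] := gated_last (gat s) t0.
exists b, i; have bT : b <= T by lra.
have bT1 : b <= T + 1 by lra.
have tT1 : t <= T + 1 by lra.
have DB := D i b bE bT; have [A1 A2] := Ad b b0 bT1; have [A3 A4] := Ad t t0 tT1.
have fB := first_moment_ge0 (B s i).
(* A longer wait would contradict the starting rule: by [b + 3 * d] the batch would be finished and
   work would have arrived. *)
have tb3 : t - b < 3 * d.
  rewrite ltNge; apply/negP => h; move: tb; apply/negP; rewrite -leNgt.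
  by apply/(gated_next (gat s) _ bE); rewrite -/(A s b) -/(A s t); split; lra.
split=> //; split; last by lra.
(* The mass of a later batch is that of the arrivals in a period shorter than [3 * d], at limiting
   rate [m], with an error [d] at each end; the initial batch has mass below [d]. *)
suff : mass (B s i) <= 3 * (m * d) + 2 * d by lra.
case: i bE DB {tb fB} => [|i] bE DB; first by move: hM; lra.
have [a aE ab] := prev _ _ bE; have a0 := start _ _ aE; have aT := le_trans ab bT.
have Da := D i a aE aT; have hb := next i a b aE bE a0 aT Da.
have aT1 : a <= T + 1 by lra.
have [A5 A6] := Ad a a0 aT1.
have ba : b - a < 3 * d by move: hb; rewrite le_max => /orP[]; lra.
have [j hj] := m1_coord_ratr R (-1).
have mE (z : M1 R) : m1_coord j z = - mass z.
  by rewrite hj rmorphN1 truncated_moment_le0 ?lerN10// mulN1r.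
have := gated_batch (gat s) j aE bE; rewrite !mE => mB.
have aTT : 0 <= a <= T + 1 by rewrite a0.
have bTT : 0 <= b <= T + 1 by rewrite b0.
move: (hN a aTT) (hN b bTT); rewrite !ltr_norml.
have mb : alpha * b * mass nu = m * b by rewrite /m mulrAC.
have ma : alpha * a * mass nu = m * a by rewrite /m mulrAC.
rewrite mb ma => /andP[h1 h2] /andP[h3 h4].
have : m * (b - a) <= m * (3 * d) by apply: ler_wpM2l => //; exact: ltW.
lra.
Qed.

(** The state in service is dominated by its small batch, and the waiting jobs are the arrivals of a
    short period. Every coordinate is thus uniformly small, as it is 0 for the fluid path, and no
    time change is needed. *)
Lemma fluid_limit_null k : w = 0 -> \forall s \near F, forall t, 0 <= t -> t <= k%:R ->
    m1_close k (sv s t) (fluid_in_service alpha nu xi t) /\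
    m1_close k (wt s t) (fluid_in_waiting alpha nu xi t).
Proof.
move=> wz; have hk := half_exp_gt0 R k.
have : \forall s \near F, forall j, (j < k.+1)%N -> forall t, 0 <= t -> t <= k%:R ->
    `|m1_coord j (sv s t)| < 2^-1 ^+ k /\ `|m1_coord j (wt s t)| < 2^-1 ^+ k.
  apply: near_ltn => j _; have [C C0 hC] := m1_coord_bound R j.
  pose M := C + alpha * `|m1_coord j nu| + 1.
  have aM : 0 <= alpha * `|m1_coord j nu| by rewrite mulr_ge0// ltW.
  have M0 : 0 < M by rewrite /M; lra.
  have e0 : 0 < 2^-1 ^+ k / (4 * M) by rewrite divr_gt0// mulr_gt0.
  have d0 : 0 < 2^-1 ^+ k / 4 :> R by rewrite divr_gt0.
  have := fluid_batches_null wz (ler0n R k) e0; have := carr j k%:R d0.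
  apply: filterS2 => s hA h t t0 tk; have tT : 0 <= t <= k%:R by rewrite t0.
  have [b [i [bE b0 bt' tb [hB tb']]]] := h t tT.
  have tb0 : 0 <= t - b by rewrite subr_ge0.
  set e := 2^-1 ^+ k / (4 * M) in e0 hB tb'.
  have eM : M * e = 2^-1 ^+ k / 4 by rewrite /e; field; rewrite gt_eqF.
  split.
    rewrite (gated_service (gat s) j bE bt' tb); apply: (le_lt_trans (hC _)).
    have fs : first_moment (served (B s i) (t - b)) <= first_moment (B s i).
      rewrite first_moment_served// ge_max first_moment_ge0 andbT; lra.
    have ms := le_mass_served (B s i) tb0.
    apply: (@le_lt_trans _ _ (C * e)); first by apply: ler_wpM2l => //; lra.
    apply: (@le_lt_trans _ _ (M * e)); last by rewrite eM; lra.
    by apply: ler_wpM2r; [exact: ltW|rewrite /M; lra].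
  rewrite (gated_waiting (gat s) j bE bt' tb).
  have bT : 0 <= b <= k%:R by rewrite b0 (le_trans bt').
  have z : `|alpha * t * m1_coord j nu - alpha * b * m1_coord j nu - 0| <= 2^-1 ^+ k / 4.
    rewrite subr0 -mulrBl -mulrBr !normrM (gtr0_norm alpha0) (ger0_norm tb0) -eM.
    apply: (@le_trans _ _ (alpha * `|m1_coord j nu| * e)).
      by rewrite mulrAC; apply: ler_wpM2l => //; exact: ltW.
    by apply: ler_wpM2r; [exact: ltW|rewrite /M; lra].
  have := dist_approx (hA _ tT) (hA _ bT) z; rewrite subr0 => /lt_le_trans; apply.
  lra.
apply: filterS => s h t t0 tk; have [-> ->] := fluid_w0 alpha nu wz t0.
have z0 : mass (served (M1_scale (alpha * w) nu) 0) = 0.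
  apply/eqP; rewrite eq_le mass_ge0 andbT; apply: (le_trans (le_mass_served _ (lexx 0))).
  by rewrite wz mulr0 mass_scale// mul0r.
have n0 : mass (M1_scale (alpha * 0) nu) = 0 by rewrite mulr0 mass_scale// mul0r.
have null (z : M1 R) j : mass z = 0 -> m1_coord j z = 0.
  by case: j => [|j] mz /=; [exact: first_moment_null|exact: truncated_moment_null].
by split=> j jk; rewrite ?(null _ _ z0) ?(null _ _ n0) subr0; have [] := h j jk t t0 tk.
Qed.

Lemma fluid_limit k : \forall s \near F, exists2 l, time_change l &
  forall t, 0 <= t -> t <= k%:R -> [/\ `|l t - t| < 2^-1 ^+ k,
    m1_close k (sv s t) (fluid_in_service alpha nu xi (l t)) &
    m1_close k (wt s t) (fluid_in_waiting alpha nu xi (l t))].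
Proof.
have := w0; rewrite le_eqVlt => /orP[/eqP wz|]; last exact: fluid_limit_pos.
have := fluid_limit_null k (esym wz); apply: filterS => s h.
exists id => [|t t0 tk]; first exact: time_change_id.
by have [? ?] := h t t0 tk; split => //; rewrite subrr normr0 half_exp_gt0.
Qed.

End fluid_limit.

(** * Weak convergence *)

Section bounded_expectation.
Variables (R : realType) (d : measure_display) (T : measurableType d) (P : probability T R).

Lemma bounded_integrable (g : T -> R) C : measurable_fun setT g ->
  (forall w, `|g w| <= C) -> P.-integrable setT (EFin \o g).
Proof.
move=> mg gC; apply: measurable_bounded_integrable => //.
  by apply: (le_lt_trans (probability_le1 P measurableT)); rewrite ltry.
exists C; split; first exact: num_real.
by move=> M CM w _ /=; apply: le_trans (gC w) (ltW CM).
Qed.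

Lemma expectationE (g : T -> R) : P.-integrable setT (EFin \o g) ->
  'E_P[g]%E = (\int[P]_w g w)%:E.
Proof. by move=> ig; rewrite unlock /Rintegral fineK//; exact: integrable_fin_num. Qed.

End bounded_expectation.

Lemma cvg_expectationP (R : realType) (d : nat -> measure_display)
    (T : forall n, measurableType (d n)) (P : forall n, probability (T n) R)
    d0 (T0 : measurableType d0) (P0 : probability T0 R)
    (g : forall n, T n -> R) (g0 : T0 -> R) :
  (forall n, (P n).-integrable setT (EFin \o g n)) -> P0.-integrable setT (EFin \o g0) ->
  ('E_(P n)[g n] @[n --> \oo] --> 'E_P0[g0])%E <->
  (\int[P n]_w g n w) @[n --> \oo] --> \int[P0]_w g0 w.
Proof.
move=> ig ig0; rewrite (expectationE ig0); under eq_fun do rewrite (expectationE (ig _)).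
split=> [/fine_cvgP[_]//|h]; apply/fine_cvgP; split => //.
by apply: filterE.
Qed.

(** * Penalties and convergence in law *)

Section penalty.
Variable R : realType.
Implicit Types z : M1 R.

Let dist k z z' : R := \sum_(j < k.+1) `|m1_coord j z - m1_coord j z'| * 2 ^+ k.

Let dist_ge0 k z z' : 0 <= dist k z z'.
Proof. by apply: sumr_ge0 => j _; rewrite mulr_ge0. Qed.

(** The factor [2 ^+ k] in [dist] is the one for which failure of [m1_close k] costs the full
    penalty 1. *)
Definition m1_penalty k z z' : R := Num.min 1 (dist k z z').

Lemma m1_penalty_ge0 k z z' : 0 <= m1_penalty k z z'.
Proof. by rewrite le_min ler01 dist_ge0. Qed.

Lemma m1_penalty_refl k z : m1_penalty k z z = 0.
Proof.
rewrite /m1_penalty /dist big1 ?min_r// => j _.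
by rewrite subrr normr0 mul0r.
Qed.

Lemma m1_penalty_far k z z' : ~ m1_close k z z' -> m1_penalty k z z' = 1.
Proof.
move=> h; apply/min_idPl; rewrite leNgt; apply/negP => h1; apply: h => j jk.
rewrite -ltnS in jk; have k2 : 0 < 2 ^+ k :> R by rewrite exprn_gt0.
rewrite exprVn -[ltRHS]mul1r ltr_pdivlMr//.
apply: le_lt_trans h1; rewrite /dist (bigD1 (Ordinal jk))//= lerDl.
by apply: sumr_ge0 => i _; rewrite mulr_ge0.
Qed.

Lemma m1_penalty_lip k z z1 z2 :
  m1_penalty k z z1 <= m1_penalty k z z2 + dist k z1 z2.
Proof.
rewrite /m1_penalty [leRHS]addr_minl le_min; apply/andP; split.
  by rewrite ge_min lerDl dist_ge0.
rewrite ge_min; apply/orP; right; rewrite /dist -big_split/=.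
apply: ler_sum => j _; rewrite -mulrDl; apply: ler_wpM2r; first by rewrite exprn_ge0.
rewrite -[in leLHS](subrK (m1_coord j z2) (m1_coord j z)) -addrA.
by apply: (le_trans (ler_normD _ _)); rewrite lerD2l distrC.
Qed.

Lemma m1_dist_cvg k z0 : dist k z z0 @[z --> z0] --> 0.
Proof.
have FF : Filter (nbhs z0) := nbhs_filter z0.
have <- : \sum_(j < k.+1) `|m1_coord j z0 - m1_coord j z0| * 2 ^+ k = 0.
  by rewrite big1// => j _; rewrite subrr normr0 mul0r.
apply: cvg_big => [|j _]; first exact: add_continuous.
 apply: cvgM (cvg_cst _); apply: cvg_norm.
by apply: cvgB (cvg_cst _); exact: m1_coord_continuous.
Qed.

Lemma m1_dist_sym k z z' : dist k z z' = dist k z' z.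
Proof. by apply: eq_bigr => j _; rewrite distrC. Qed.

Section approximate_mapping.
Variables (S : topologicalType).
Variables (d : nat -> measure_display) (T : forall n, measurableType (d n)).
Variables (P : forall n, probability (T n) R).
Variables (X : forall n, T n -> S) (b : forall n, T n -> M1 R) (G : nat -> forall n, T n -> R).
Variables (d0 : measure_display) (T0 : measurableType d0) (P0 : probability T0 R).
Variables (B0 : T0 -> M1 R) (Y : T0 -> S).
Hypothesis rX : forall n, random_element (@X n).
Hypothesis rY : random_element Y.
Hypothesis cb : cvg_in_distribution P b P0 B0.
Hypothesis mG : forall k n, measurable_fun setT (@G k n).
Hypothesis G01 : forall k n w, 0 <= @G k n w <= 1.
Hypothesis cG : forall k, ('E_(P n)[@G k n] @[n --> \oo] --> 0)%E.
Hypothesis near_Y : {ae P0, forall w, forall O, open O -> O (Y w) -> exists K, forall k,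
  (K <= k)%N -> forall n w', m1_close k (b w') (B0 w) -> @G k n w' < 1 -> O (X w')}.

Section upper_bound.
Variables (f : S -> R) (C : R).
Hypothesis cf : continuous f.
Hypothesis fC : forall x, `|f x| <= C.

(** The suprema below run over sample points; a space of probability 1 has one. *)
Let inhabited : [set: T 0%N] !=set0.
Proof.
apply/set0P/eqP => h; have := probability_setT (P 0%N).
by rewrite h measure0 => /eqP; rewrite eq_sym onee_eq0.
Qed.

Let C0 : 0 <= C.
Proof.
have [w _] := inhabited.
exact: le_trans (normr_ge0 _) (fC (X w)).
Qed.

(** With the factor [2 * C], a full penalty outweighs the whole range of [f]. *)
Let vals k z := [set x | exists n (w : T n),
  x = f (X w) - 2 * C * m1_penalty k (b w) z - 2 * C * G k w].

(** The penalized values may fall below [- C]; cutting off there bounds [L k] by [C] uniformly in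
    [k]. *)
Let L k z : R := Num.max (- C) (sup (vals k z)).

Let vals_le k z : ubound (vals k z) C.
Proof.
move=> _ [n [w ->]]; have := fC (X w); rewrite ler_norml => /andP[_ h].
have /andP[g0 _] := G01 k w; have p0 := m1_penalty_ge0 k (b w) z.
have : 0 <= 2 * C * m1_penalty k (b w) z by rewrite !mulr_ge0.
have : 0 <= 2 * C * G k w by rewrite !mulr_ge0.
lra.
Qed.

Let vals0 k z : vals k z !=set0.
Proof.
by have [w _] := inhabited; eexists; exists 0%N, w.
Qed.

Let le_L k z n (w : T n) : f (X w) - 2 * C * m1_penalty k (b w) z - 2 * C * G k w <= L k z.
Proof.
rewrite le_max; apply/orP; right; apply: ub_le_sup; last by exists n, w.
by exists C; exact: vals_le.
Qed.

Let L_le k z x : - C <= x -> ubound (vals k z) x -> L k z <= x.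
Proof. by move=> Cx h; rewrite ge_max Cx; apply: ge_sup. Qed.

Let L_bound k z : `|L k z| <= C.
Proof.
rewrite ler_norml le_max lexx/=; apply: L_le => //.
by have := C0; lra.
Qed.

Let L_lip k z1 z2 : L k z1 <= L k z2 + 2 * C * dist k z1 z2.
Proof.
have D0 : 0 <= 2 * C * dist k z1 z2 by rewrite !mulr_ge0.
apply: L_le => [|_ [n [w ->]]].
  by have := L_bound k z2; rewrite ler_norml => /andP[]; lra.
have := le_L k z2 w; have := m1_penalty_lip k (b w) z2 z1; rewrite m1_dist_sym => h.
have : 2 * C * m1_penalty k (b w) z2 <= 2 * C * (m1_penalty k (b w) z1 + dist k z1 z2).
  by apply: ler_wpM2l => //; rewrite mulr_ge0.
rewrite mulrDr; lra.
Qed.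

Let L_continuous k : continuous (L k).
Proof.
move=> z0; have FF : Filter (nbhs z0) := nbhs_filter z0; apply/cvgrPdist_lt => e e0.
have h : 2 * C * dist k z z0 @[z --> z0] --> 2 * C * 0.
  by apply: cvgM; [exact: cvg_cst|exact: m1_dist_cvg].
rewrite mulr0 in h; move/cvgrPdist_lt : h => /(_ _ e0); apply: filterS => z.
rewrite sub0r normrN => /ltr_normlW hz.
have h1 := L_lip k z z0; have h2 := L_lip k z0 z; rewrite m1_dist_sym in h2.
by rewrite ltr_norml; apply/andP; split; lra.
Qed.

(** A sample path with a full penalty contributes at most [C - 2 * C], which is at most [f (Y w)].
    The others lie in [O] for large [k]. *)
Let L_limit w : (forall O, open O -> O (Y w) -> exists K, forall k,
  (K <= k)%N -> forall n w', m1_close k (b w') (B0 w) -> @G k n w' < 1 -> O (X w')) ->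
  forall e, 0 < e -> exists K, forall k, (K <= k)%N -> L k (B0 w) <= f (Y w) + e.
Proof.
move=> hY e e0; pose O := f @^-1` `]-oo, f (Y w) + e[.
have oO : open O by move/continuousP : cf; apply; exact: interval_open.
have OY : O (Y w) by rewrite /O/= in_itv/= ltrDl.
have [K hK] := hY O oO OY; exists K => k Kk; apply: L_le => [|_ [n [w' ->]]].
  by have := fC (Y w); rewrite ler_norml => /andP[]; lra.
have := fC (X w'); rewrite ler_norml => /andP[_ fX].
have := fC (Y w); rewrite ler_norml => /andP[fY _].
have /andP[g0 _] := G01 k w'; have p0 := m1_penalty_ge0 k (b w') (B0 w).
have cp : 0 <= 2 * C * m1_penalty k (b w') (B0 w) by rewrite !mulr_ge0.
have cg : 0 <= 2 * C * G k w' by rewrite !mulr_ge0.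
have [hc|hc] := pselect (m1_close k (b w') (B0 w)); last first.
  by rewrite (m1_penalty_far hc) mulr1; lra.
have [g1|g1] := ltP (G k w') 1.
  by have := hK k Kk n w' hc g1; rewrite /O/= in_itv/=; lra.
have : 2 * C * 1 <= 2 * C * G k w' by apply: ler_wpM2l => //; rewrite mulr_ge0.
lra.
Qed.

Let iX n : (P n).-integrable setT (EFin \o (f \o @X n)).
Proof.
apply: (@bounded_integrable _ _ _ _ _ C); last by move=> w; exact: fC.
exact: random_element_continuous (rX n) cf.
Qed.

Let iY : P0.-integrable setT (EFin \o (f \o Y)).
Proof.
apply: (@bounded_integrable _ _ _ _ _ C); last by move=> w; exact: fC.
exact: random_element_continuous rY cf.
Qed.

Let iLb k n : (P n).-integrable setT (EFin \o (L k \o @b n)).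
Proof.
apply: (@bounded_integrable _ _ _ _ _ C); last by move=> w; exact: L_bound.
have [rb _ _] := cb; exact: random_element_continuous (rb n) (@L_continuous k).
Qed.

Let mLB k : measurable_fun setT (L k \o B0).
Proof. have [_ rB _] := cb; exact: random_element_continuous rB (@L_continuous k). Qed.

Let iLB k : P0.-integrable setT (EFin \o (L k \o B0)).
Proof. by apply: (@bounded_integrable _ _ _ _ _ C) => // w; exact: L_bound. Qed.

Let iG k n : (P n).-integrable setT (EFin \o @G k n).
Proof.
apply: (@bounded_integrable _ _ _ _ _ 1) => // w; have /andP[g0 g1] := G01 k w.
by rewrite ger0_norm.
Qed.

(** [L_limit] controls [L k] only from above. Its maximum [H k] with the limit value converges
    almost everywhere, and dominated convergence applies to [H k]. *)
Let limsup_mean_L e : 0 < e ->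
  exists k, \int[P0]_w L k (B0 w) < \int[P0]_w f (Y w) + e.
Proof.
move=> e0; pose H k w := Num.max (L k (B0 w)) (f (Y w)).
have mY : measurable_fun setT (f \o Y) by exact: random_element_continuous rY cf.
have HC k w : `|H k w| <= C.
  have := L_bound k (B0 w); have := fC (Y w).
  rewrite !ler_norml => /andP[h1 h2] /andP[h3 h4].
  by rewrite le_max ge_max h3 h4 h2.
have mH k : measurable_fun setT (H k) by exact: measurable_maxr (mLB k) mY.
have iH k : P0.-integrable setT (EFin \o H k).
  exact: bounded_integrable (mH k) (HC k).
have cH : \forall w \ae P0, [set: T0] w -> (H n w)%:E @[n --> \oo] --> (f (Y w))%:E.
  apply: filterS near_Y => w hw _; apply/fine_cvgP; split; first exact: filterE.
  apply/cvgrPdist_lt => r r0; have r2 : 0 < r / 2 by rewrite divr_gt0.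
  have [K hK] := L_limit hw r2; exists K => // k /= Kk; have := hK k Kk.
  rewrite /H; case: (leP (L k (B0 w)) (f (Y w))) => h; rewrite ltr_norml => h'; apply/andP; split; lra.
have [||||_ _] := @dominated_convergence _ _ _ P0 _ measurableT (fun k w => (H k w)%:E)
    (fun w => (f (Y w))%:E) (cst C%:E) _ _ cH.
- by move=> k; exact/measurable_EFinP.
- exact/measurable_EFinP.
- by have := @bounded_integrable _ _ _ P0 (cst C) `|C| (measurable_cst _) (fun=> lexx _).
- by apply: aeW => w k _; rewrite /= lee_fin.
have intE k : (\int[P0]_w (H k w)%:E = (\int[P0]_w H k w)%:E)%E.
  by rewrite /Rintegral fineK//; exact: integrable_fin_num (iH k).
have intY : (\int[P0]_w (f (Y w))%:E = (\int[P0]_w f (Y w))%:E)%E.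
  by rewrite /Rintegral fineK//; exact: integrable_fin_num iY.
rewrite intY; under eq_fun do rewrite intE.
move=> /fine_cvgP[_] /cvgrPdist_lt/(_ _ e0)[k _ /(_ k (leqnn k))] /=.
rewrite ltr_norml => /andP[hk _]; exists k.
have : \int[P0]_w L k (B0 w) <= \int[P0]_w H k w.
  by apply: le_Rintegral => //; [exact: iLB|move=> w _; rewrite /H le_max lexx].
lra.
Qed.

(** Evaluating [L k] at the path's own initial measure makes the first penalty vanish, so [f (X w)]
    is at most [L k (b w) + 2 * C * G k w]. The mean of [L k (b w)] converges and that of [G k]
    tends to 0. *)
Lemma limsup_expectation e : 0 < e ->
  \forall n \near \oo, \int[P n]_w f (X w) < \int[P0]_w f (Y w) + e.
Proof.
move=> e0; have e2 : 0 < e / 2 by rewrite divr_gt0.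
have [k hk] := limsup_mean_L e2.
pose del := \int[P0]_w f (Y w) + e / 2 - \int[P0]_w L k (B0 w).
have cL : (\int[P n]_w L k (b w)) @[n --> \oo] --> \int[P0]_w L k (B0 w).
  apply/(cvg_expectationP _ _).1; [exact: iLb|exact: iLB|].
  have [_ _ h] := cb; apply: h; first exact: L_continuous.
  by exists C; exact: L_bound.
have cGk : 2 * C * (\int[P n]_w G k w) @[n --> \oo] --> 2 * C * 0.
  apply: cvgM (cvg_cst _) _; have := cG k.
  by under eq_fun do rewrite (expectationE (@iG k _)); move=> /fine_cvgP[].
rewrite mulr0 in cGk.
have cS : (\int[P n]_w L k (b w)) + 2 * C * (\int[P n]_w G k w) @[n --> \oo] -->
    \int[P0]_w L k (B0 w) + 0 by exact: cvgD.
rewrite addr0 in cS; apply: filterS (near_ltr_cvg _ cS (cvg_cst _) hk) => n hn.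
apply: (@le_lt_trans _ _ (\int[P n]_w (L k (b w) + 2 * C * G k w))); last first.
  rewrite RintegralD//; last 2 first.
    exact: iLb.
    exact: (@integrableZl _ _ _ _ _ measurableT (2 * C) _ (iG k n)).
  have -> : \int[P n]_w (2 * C * G k w) = 2 * C * \int[P n]_w G k w.
    exact: RintegralZl (iG k n).
  lra.
apply: le_Rintegral => //.
  have := integrableD measurableT (iLb k n)
    (@integrableZl _ _ _ _ _ measurableT (2 * C) _ (iG k n)).
  by apply: eq_integrable => // w _.
move=> w _; have := le_L k (b w) w; rewrite m1_penalty_refl mulr0; lra.
Qed.

End upper_bound.

(** The upper bound for [f] and for [- f]. The hypothesis [near_Y] takes the place of almost sure
    continuity in a continuous mapping theorem: [X n] need not be a function of [b n], but is close
    to [Y] when [b n] is close to [B0] and [G k n] is below 1. *)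
Lemma approximate_mapping : cvg_in_distribution P X P0 Y.
Proof.
split=> // f cf [C fC]; apply/(cvg_expectationP _ _).2.
- move=> n; apply: (@bounded_integrable _ _ _ _ _ C); last by move=> w; exact: fC.
  exact: random_element_continuous (rX n) cf.
- apply: (@bounded_integrable _ _ _ _ _ C); last by move=> w; exact: fC.
  exact: random_element_continuous rY cf.
apply/cvgrPdist_lt => e e0.
have cN : continuous (fun x => - f x) by move=> x; apply: cvgN; exact: cf.
have NC x : `|- f x| <= C by rewrite normrN.
have intN d' (T' : measurableType d') (P' : probability T' R) (Z : T' -> S) :
    random_element Z -> \int[P']_w - f (Z w) = - \int[P']_w f (Z w).
  move=> rZ; under eq_Rintegral do rewrite -mulN1r; rewrite RintegralZl ?mulN1r//.
  apply: (@bounded_integrable _ _ _ _ _ C); last by move=> w; exact: fC.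
  exact: random_element_continuous rZ cf.
apply: filterS2 (limsup_expectation cf fC e0) (limsup_expectation cN NC e0) => n.
rewrite !intN// => h1 h2; rewrite ltr_norml; apply/andP; split; lra.
Qed.

End approximate_mapping.
End penalty.

Lemma sup_entourage (T : choiceType) (I : Type) (Tc : I -> Uniform T) i (V : set (T * T)) :
  @entourage (Uniform.Pack (Tc i)) V -> @entourage (sup_topology Tc) V.
Proof.
move=> hV; have hC := asboolT hV; exists V => //.
pose p : {p : {classic I} * set (T * T) | `[< @entourage (Uniform.Pack (Tc p.1)) p.2 >]} :=
  exist _ (i, V) hC.
refine (@finI_from1 _ _ _ _ p _).
by [].
Qed.

(** * A J1-continuous distance to the fluid arrivals *)

Section arrival_gap.
Variables (R : realType) (alpha : R) (nu : M1 R).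
Hypothesis alpha0 : 0 < alpha.
(** The uniform structure of [M1 R] is pulled back from pointwise convergence on test functions.
    Entourages are required because the J1 neighbourhoods are defined through them. *)
Lemma entourage_pairing (f : R -> R) (e : R) : w1_test f -> 0 < e ->
  entourage [set p : M1 R * M1 R | `|pairing f p.1 - pairing f p.2| < e].
Proof.
move=> tf e0; pose F : @w1_test R := exist _ f (mem_set tf).
pose V : set ({ptws @w1_test R -> R} * {ptws @w1_test R -> R}) :=
  [set q | `|q.1 F - q.2 F| < e].
have eV : entourage V.
  pose C := initial_topology (@proj _ (fun _ : @w1_test R => (R : uniformType)) F).
  have eC : @entourage C V.
    exists [set p : R * R | `|p.1 - p.2| < e]; last by move=> p.
    exact: (entourage_ball R (PosNum e0)).
  exact: (@sup_entourage _ _ (fun i => Uniform.class (initial_topology (@proj _ (fun _ : @w1_test R => (R : uniformType)) i))) F).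
by exists V.
Qed.

Lemma entourage_m1_coord j (e : R) : 0 < e ->
  entourage [set p : M1 R * M1 R | `|m1_coord j p.1 - m1_coord j p.2| < e].
Proof.
by move=> e0; case: j => [|j]; apply: entourage_pairing => //; [left|exact: w1_test_min].
Qed.

Lemma entourage_m1_close_set k : entourage [set p : M1 R * M1 R | m1_close k p.1 p.2].
Proof.
have := @near_ltn (M1 R * M1 R) entourage _ k.+1
  (fun j p => `|m1_coord j p.1 - m1_coord j p.2| < 2^-1 ^+ k).
by apply => j _; exact: entourage_m1_coord (half_exp_gt0 R k).
Qed.

(** Since [m1_close m] is an entourage, [sk_close m y0] contains a basic J1 neighbourhood of
    [y0]. *)
Lemma skorohod_continuous (g : skorohod R (M1 R) -> R) :
  (forall e, 0 < e -> exists m, forall y0 y, sk_close m y0 y -> `|g y0 - g y| < e) ->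
  continuous g.
Proof.
move=> h; apply/continuousP => O oO.
suff : skorohod_open (g @^-1` O) by [].
move=> y0 /= Oy.
have /nbhs_ballP[e /= e0 he] := open_nbhs_nbhs (conj oO Oy).
have [m hm] := h e e0.
exists m%:R, (2^-1 ^+ m), [set p | m1_close m p.1 p.2]; split.
- exact: half_exp_gt0.
- exact: entourage_m1_close_set.
move=> y [l tl hl]; apply: he; apply: hm; exists l => // t t0 tm.
by apply: hl; rewrite t0.
Qed.

(** The value is 1 up to time [k] and 0 from [k + 1] on. The Lipschitz transition between them makes
    the cut-off insensitive to small time changes. *)
Let window k (t : R) : R := Num.max 0 (Num.min 1 (k.+1%:R - t)).
Let dev k j t (z : M1 R) : R :=
  Num.min 1 (2 ^+ k * `|m1_coord j z - alpha * t * m1_coord j nu|).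

(* Continuous, and at least 1 unless [y] stays close to the fluid arrival process
   up to time k. *)
Definition arrival_gap k (y : skorohod R (M1 R)) : R :=
  sup [set x | exists j t, [/\ (j <= k)%N, 0 <= t & x = window k t * dev k j t (y t)]].

Let window01 k t : 0 <= window k t <= 1.
Proof. by rewrite le_max lexx/= ge_max ler01 ge_min lexx. Qed.

Let dev01 k j t z : 0 <= dev k j t z <= 1.
Proof. by rewrite ge_min lexx le_min ler01 mulr_ge0. Qed.

Let window_lip k t t' : window k t <= window k t' + `|t - t'|.
Proof.
have h := ler_norm (t' - t); rewrite distrC in h; have h0 := normr_ge0 (t - t').
have m01 : Num.max 0 1 = 1 :> R by rewrite max_r.
rewrite /window; case: (leP 1 (k.+1%:R - t)); case: (leP 1 (k.+1%:R - t')) => ? ?;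
  rewrite ?m01; try lra.
- by case: (leP 0 (k.+1%:R - t')); lra.
- by case: (leP 0 (k.+1%:R - t)); lra.
- by case: (leP 0 (k.+1%:R - t)); case: (leP 0 (k.+1%:R - t')); lra.
Qed.

Let dev_lip k j t z t' z' : dev k j t z <= dev k j t' z' +
  2 ^+ k * (`|m1_coord j z - m1_coord j z'| + alpha * `|m1_coord j nu| * `|t - t'|).
Proof.
set D := _ * (_ + _); have k2 : 0 <= 2 ^+ k :> R by rewrite exprn_ge0.
have D0 : 0 <= D by rewrite mulr_ge0// addr_ge0// mulr_ge0// mulr_ge0// ltW.
rewrite /dev [leRHS]addr_minl le_min; apply/andP; split.
  by rewrite ge_min lerDl D0.
rewrite ge_min; apply/orP; right; rewrite -mulrDr; apply: ler_wpM2l => //.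
have -> : alpha * `|m1_coord j nu| * `|t - t'| =
    `|alpha * t * m1_coord j nu - alpha * t' * m1_coord j nu|.
  by rewrite -mulrBl -mulrBr !normrM (gtr0_norm alpha0) mulrAC.
set a := m1_coord j z; set b := m1_coord j z'; set p := alpha * t * _; set q := alpha * t' * _.
have -> : a - p = (b - q) + ((a - b) - (p - q)) by lra.
by apply: (le_trans (ler_normD _ _)); rewrite lerD2l ler_normB.
Qed.

Let value_lip k j t z t' z' : window k t * dev k j t z <= window k t' * dev k j t' z' +
  (`|t - t'| + 2 ^+ k * (`|m1_coord j z - m1_coord j z'| + alpha * `|m1_coord j nu| * `|t - t'|)).
Proof.
have h1 := window_lip k t t'; have h2 := dev_lip k j t z t' z'.
have /andP[a0 a1] := window01 k t'; have /andP[b0 b1] := dev01 k j t z.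
have /andP[c0 c1] := window01 k t.
set D := 2 ^+ k * _ in h2 *; set x := window k t in h1 c0 c1 *.
set x' := window k t' in h1 a0 a1 *; set u := dev k j t z in h2 b0 b1 *.
set u' := dev k j t' z' in h2 *.
have D0 : 0 <= D.
  by rewrite mulr_ge0 ?exprn_ge0// addr_ge0// mulr_ge0// mulr_ge0// ltW.
have e1 : x * u <= (x' + `|t - t'|) * u by apply: ler_wpM2r.
have e2 : x' * u <= x' * (u' + D) by apply: ler_wpM2l.
have e3 : x' * D <= 1 * D by apply: ler_wpM2r.
have e4 : `|t - t'| * u <= `|t - t'| * 1 by apply: ler_wpM2l.
rewrite mulrDl in e1; rewrite mulrDr in e2; lra.
Qed.

Let value_ub k (y : skorohod R (M1 R)) : has_ubound
  [set x | exists j t, [/\ (j <= k)%N, 0 <= t & x = window k t * dev k j t (y t)]].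
Proof.
exists 1 => _ [j [t [_ _ ->]]]; have /andP[a0 a1] := window01 k t.
have /andP[b0 b1] := dev01 k j t (y t).
by rewrite -[leRHS]mulr1 ler_pM.
Qed.

Let value_le k (y : skorohod R (M1 R)) j t : (j <= k)%N -> 0 <= t ->
  window k t * dev k j t (y t) <= arrival_gap k y.
Proof. by move=> jk t0; apply: (ub_le_sup (value_ub k y)); exists j, t. Qed.

Lemma arrival_gap01 k y : 0 <= arrival_gap k y <= 1.
Proof.
apply/andP; split.
  apply: le_trans (value_le y (leq0n k) (lexx 0)).
  by have /andP[a0 _] := window01 k 0; have /andP[b0 _] := dev01 k 0 0 (y 0); rewrite mulr_ge0.
apply: ge_sup; first by eexists; exists 0%N, 0.
move=> _ [j [t [_ _ ->]]]; have /andP[a0 a1] := window01 k t.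
have /andP[b0 b1] := dev01 k j t (y t).
by rewrite -[leRHS]mulr1 ler_pM.
Qed.

Lemma arrival_gap_lt1 k y : arrival_gap k y < 1 -> forall j t, (j <= k)%N ->
  0 <= t <= k%:R -> `|m1_coord j (y t) - alpha * t * m1_coord j nu| < 2^-1 ^+ k.
Proof.
move=> h j t jk /andP[t0 tk]; have := le_lt_trans (value_le y jk t0) h.
have w1 : window k t = 1.
  rewrite /window min_l; last by rewrite -addn1 natrD; lra.
  by rewrite max_r.
rewrite w1 mul1r gt_min ltxx/= exprVn => hd.
by rewrite -[ltRHS]mul1r ltr_pdivlMr ?exprn_gt0// mulrC.
Qed.

Lemma arrival_gap_fluid k (y : skorohod R (M1 R)) :
  (forall t, 0 <= t -> y t = M1_scale (alpha * t) nu) -> arrival_gap k y = 0.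
Proof.
move=> hy; apply/eqP; rewrite eq_le; apply/andP; split; last by have /andP[] := arrival_gap01 k y.
apply: ge_sup; first by eexists; exists 0%N, 0.
move=> _ [j [t [_ t0 ->]]]; rewrite hy// /dev m1_coord_scale; last by rewrite mulr_ge0// ltW.
by rewrite subrr normr0 mulr0 min_r// mulr0.
Qed.

(** The window and the fluid arrivals are Lipschitz in time, so replacing [t] by [l t] changes each
    value in the supremum by a multiple of the deformation. [Q] collects the Lipschitz constants,
    uniformly over the coordinates up to [k]. *)
Lemma arrival_gap_continuous k : continuous (arrival_gap k).
Proof.
apply: skorohod_continuous => e e0.
pose M := \sum_(j < k.+1) `|m1_coord j nu|.
have M0 : 0 <= M by apply: sumr_ge0.
have hM j : (j <= k)%N -> `|m1_coord j nu| <= M.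
  move=> jk; rewrite -ltnS in jk; rewrite /M (bigD1 (Ordinal jk))//= lerDl.
  by apply: sumr_ge0.
have aM : 0 <= alpha * M by rewrite mulr_ge0// ltW.
have k2 : 0 <= 2 ^+ k :> R by rewrite exprn_ge0.
pose Q : R := 1 + 2 ^+ k * (1 + alpha * M).
have Q0 : 0 < Q by have : 0 <= 2 ^+ k * (1 + alpha * M); [rewrite mulr_ge0//; lra|rewrite /Q; lra].
have [n hn] := half_exp_lt (divr_gt0 e0 Q0).
(* The window vanishes beyond [k + 1]; with horizon at least [k + 2], the preimage under [l] of a
   time up to [k + 1] stays within the range controlled by [hl]. *)
pose m := maxn n (maxn k k.+2).
have hm : 2^-1 ^+ m < e / Q by apply: le_lt_trans hn; apply: half_exp_le; exact: leq_maxl.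
have km : (k <= m)%N by rewrite !leq_max leqnn orbT.
have km2 : k.+2%:R <= m%:R :> R by rewrite ler_nat !leq_max leqnn !orbT.
have hQ : Q * 2^-1 ^+ m < e by rewrite mulrC -ltr_pdivlMr.
have bound j t t' z z' : (j <= k)%N -> `|t - t'| < 2^-1 ^+ m -> m1_close m z z' ->
    window k t * dev k j t z <= window k t' * dev k j t' z' + Q * 2^-1 ^+ m.
  move=> jk tt zz; apply: (le_trans (value_lip k j t z t' z')); rewrite lerD2l.
  have hz := zz j (leq_trans jk km).
  have h1 : alpha * `|m1_coord j nu| * `|t - t'| <= alpha * M * 2^-1 ^+ m.
    apply: ler_pM => //; [by rewrite mulr_ge0// ltW| |exact: ltW].
    by apply: ler_wpM2l; [exact: ltW|exact: hM].
  have h2 : 2 ^+ k * (`|m1_coord j z - m1_coord j z'| + alpha * `|m1_coord j nu| * `|t - t'|)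
     <= 2 ^+ k * ((1 + alpha * M) * 2^-1 ^+ m).
    by apply: ler_wpM2l => //; rewrite mulrDl mul1r; lra.
  by rewrite /Q mulrDl mul1r -mulrA; lra.
exists m => y0 y [l tl hl].
have win0 t : k.+1%:R < t -> window k t = 0.
  by move=> kt; rewrite /window max_l// ge_min; apply/orP; right; lra.
have k12 : k.+2%:R = k.+1%:R + 1 :> R by rewrite -addn1 natrD.
have /andP[g0 _] := arrival_gap01 k y0; have /andP[g1 _] := arrival_gap01 k y.
have q0 : 0 <= Q * 2^-1 ^+ m by rewrite mulr_ge0// ltW// half_exp_gt0.
have le1 : arrival_gap k y <= arrival_gap k y0 + Q * 2^-1 ^+ m.
  apply: ge_sup; first by eexists; exists 0%N, 0.
  move=> _ [j [t [jk t0 ->]]]; have [tk|kt] := leP t k.+1%:R; last first.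
    by rewrite win0// mul0r addr_ge0.
  have tm : t <= m%:R by lra.
  have [h1 h2] := hl t t0 tm.
  apply: (le_trans (bound j t (l t) (y t) (y0 (l t)) jk _ h2)); first by rewrite distrC.
  by rewrite lerD2r; apply: value_le => //; exact: time_change_ge0.
have le2 : arrival_gap k y0 <= arrival_gap k y + Q * 2^-1 ^+ m.
  apply: ge_sup; first by eexists; exists 0%N, 0.
  move=> _ [j [t [jk t0 ->]]]; have [tk|kt] := leP t k.+1%:R; last first.
    by rewrite win0// mul0r addr_ge0.
  have [s s0 st] := time_change_surj tl t0.
  have sm : s <= m%:R.
    rewrite leNgt; apply/negP => ms; have m0 : (0 : R) <= m%:R by [].
    have := time_change_lt tl m0 s0; rewrite ms st => lm.
    have [+ _] := hl m%:R m0 (lexx _); rewrite ltr_norml => /andP[h1 _].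
    by have := half_exp_le1 R m; lra.
  have [h1 h2] := hl s s0 sm; rewrite st in h1 h2.
  apply: (le_trans (bound j t s (y0 t) (y s) jk h1 (m1_close_sym h2))).
  by rewrite lerD2r; exact: value_le.
by rewrite ltr_norml; apply/andP; split; lra.
Qed.

End arrival_gap.

(** The time [tau] is random, as batch starts are. The event [n < E (tau w) w] compares a partial
    sum of interarrival times with [tau w]. *)
Lemma renewal_measurable (R : realType) d (T : measurableType d) (P : probability T R)
    (a : R) (E : R -> T -> nat) (tau : T -> R) n :
  delayed_renewal P a E -> measurable_fun setT tau -> (forall w, 0 <= tau w) ->
  measurable [set w | E (tau w) w = n].
Proof.
move=> [u [_ _ _ _ hu]] mtau tau0.
have mlt m : measurable [set w | (m < E (tau w) w)%N].
  rewrite (_ : [set w | _] = [set w | \sum_(i < m.+1) u i w <= tau w]); last first.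
    by apply/seteqP; split => w /=; rewrite hu.
  by apply: measurable_le_set => //; apply: measurable_sum => i.
case: n => [|n].
  rewrite (_ : [set w | _] = ~` [set w | (0 < E (tau w) w)%N]); first exact: measurableC.
  by apply/seteqP; split => w /=; [move=> ->|rewrite lt0n; case: (E _ _)].
rewrite (_ : [set w | _] = [set w | (n < E (tau w) w)%N] `\` [set w | (n.+1 < E (tau w) w)%N]).
  exact: measurableD.
apply/seteqP; split => w /=; first by move=> ->; rewrite !ltnn ltnS leqnn.
by move=> [h1 /negP]; rewrite -leqNgt => h2; apply/eqP; rewrite eqn_leq h2.
Qed.

(** * Scaled sample paths as random elements *)

Section sample_paths.
Variables (R : realType) (r : R) (Q : gps_model R).
Hypothesis r0 : 0 < r.

Let b0 (w : gps_space Q) : M1 R := point_masses (fun j => gps_v0 Q j w) 0 (gps_Z0 Q w).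
Let E (w : gps_space Q) (t : R) : nat := gps_E t w.
Let v (w : gps_space Q) (i : nat) : R := gps_v Q i w.
Let E0 w : E w 0 = 0%N. Proof. exact: gps_E0. Qed.
Let E_le w s t : 0 <= s -> s <= t -> (E w s <= E w t)%N.
Proof. exact: (renewal_le (gps_E_renewal Q)). Qed.
Let E_right w t : 0 <= t -> exists2 e, 0 < e & forall s, t <= s < t + e -> E w s = E w t.
Proof. exact: (renewal_right (gps_E_renewal Q)). Qed.

Definition scaled_path (w : gps_space Q) : skorohod R (M1 R) * skorohod R (M1 R) :=
  (MkSkorohod (scaled_service_cadlag (b0 w) (v w) (@E0 w) (@E_le w) (@E_right w) r0),
   MkSkorohod (scaled_waiting_cadlag (b0 w) (v w) (@E0 w) (@E_le w) (@E_right w) r0)).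

Lemma scaled_path_gated w : exists bt B,
  gated (scaled_path w).1 (scaled_path w).2 (scaled_arrivals r w) bt B /\
  B 0%N = scaled_initial r w.
Proof.
eexists; eexists; split.
  exact: (scaled_gated (b0 w) (v w) r0 (@E0 w) (@E_le w) (@E_right w)).
by [].
Qed.

Lemma scaled_path_random : random_element (@scaled_initial R r Q) ->
  random_element scaled_path.
Proof.
move=> rb; have ri0 : 0 <= r^-1 by rewrite invr_ge0 ltW.
have mb j : measurable_fun setT (fun w => m1_coord j (b0 w)).
  have h := random_element_continuous rb (@m1_coord_continuous R j).
  rewrite (_ : (fun w => _) = (fun w => r * m1_coord j (scaled_initial r w))).
    by apply: measurable_funM => //; exact: measurable_cst.
  apply/funext => w; rewrite /scaled_initial m1_coord_scale// mulrA divff ?mul1r//.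
  by rewrite gt_eqF.
have mv i : measurable_fun setT (fun w => v w i) by [].
have mE (tau : gps_space Q -> R) : measurable_fun setT tau -> (forall w, 0 <= tau w) ->
    forall n, measurable [set w | E w (tau w) = n].
  by move=> mt t0 n; exact: renewal_measurable (gps_E_renewal Q) mt t0.
apply: random_element_skorohod => t t0 j /=.
  under eq_fun do rewrite m1_coord_scale//.
  apply: measurable_funM; first exact: measurable_cst.
  apply: (@measurable_in_service _ _ _ b0 (fun t w => E w t) (fun i w => v w i)) => //.
  by rewrite mulr_ge0// ltW.
under eq_fun do rewrite m1_coord_scale//.
apply: measurable_funM; first exact: measurable_cst.
apply: (@measurable_in_waiting _ _ _ b0 (fun t w => E w t) (fun i w => v w i)) => //.
by rewrite mulr_ge0// ltW.
Qed.

End sample_paths.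

Lemma fluid_path_random (R : realType) d (T : measurableType d) (alpha : R) (nu : M1 R)
    (alpha0 : 0 < alpha) (B0 : T -> M1 R) :
  random_element B0 -> random_element (fun w => fluid_path nu (B0 w) alpha0).
Proof.
move=> rB; have mB j := random_element_continuous rB (@m1_coord_continuous R j).
apply: random_element_skorohod => t t0 j /=.
  exact: measurable_fluid_in_service.
exact: measurable_fluid_in_waiting.
Qed.

(** * From the deterministic limit to open sets of paths *)

Section continuity.
Variables (R : realType) (alpha : R) (nu xi : M1 R).
Hypothesis alpha0 : 0 < alpha.
Hypothesis nu1 : first_moment nu = alpha^-1.
Hypothesis nu_atom : forall x, nu [set x] = 0%E.
Hypothesis xi_atom : forall x, xi [set x] = 0%E.

Variables (r : nat -> R) (Q : nat -> gps_model R).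
Hypothesis r0 : forall n, 0 < r n.

(** The sample points of all the models form one type [S], with the filter generated by the
    conditions [good k]. Closeness of the data becomes convergence along this filter, and
    [fluid_limit] provides one [K] valid for all models at once. *)
Lemma fluid_path_continuity (O : set (skorohod R (M1 R) * skorohod R (M1 R))) :
  open O -> O (fluid_path nu xi alpha0) ->
  exists K, forall k, (K <= k)%N -> forall n (w : gps_space (Q n)),
    m1_close k (scaled_initial (r n) w) xi ->
    (forall j t, (j <= k)%N -> 0 <= t <= k%:R ->
      `|m1_coord j (scaled_arrivals (r n) w t) - alpha * t * m1_coord j nu| < 2^-1 ^+ k) ->
    O (scaled_path (r0 n) w).
Proof.
move=> oO Oxi; have [m hm] := sk_close_open2 oO Oxi.
pose S := {n : nat & gps_space (Q n)}.
pose path (s : S) := scaled_path (r0 (tag s)) (tagged s).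
pose arr (s : S) := scaled_arrivals (r (tag s)) (tagged s).
pose ini (s : S) := scaled_initial (r (tag s)) (tagged s).
pose good k (s : S) := m1_close k (ini s) xi /\ (forall j t, (j <= k)%N -> 0 <= t <= k%:R ->
  `|m1_coord j (arr s t) - alpha * t * m1_coord j nu| < 2^-1 ^+ k).
have good_le k l s : (k <= l)%N -> good l s -> good k s.
  move=> kl [h1 h2]; split; first exact: m1_close_le h1.
  move=> j t jk /andP[t0 tk]; apply: lt_le_trans (half_exp_le R kl).
  by apply: h2; [exact: leq_trans kl|rewrite t0 (le_trans tk)// ler_nat].
pose F := filter_from [set: nat] good.
have FF : Filter F.
  apply: filter_from_filter; first by exists 0%N.
  move=> i j _ _; exists (maxn i j) => // s h.
  by split; apply: good_le h; rewrite ?leq_maxl ?leq_maxr.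
have bBex s : exists p : (nat -> \bar R) * (nat -> M1 R),
    gated (path s).1 (path s).2 (arr s) p.1 p.2 /\ p.2 0%N = ini s.
  by have [bt [B h]] := scaled_path_gated (r0 (tag s)) (tagged s); exists (bt, B).
have [bB hbB] := choice bBex.
have cB j : m1_coord j ((bB s).2 0%N) @[s --> F] --> m1_coord j xi.
  move: j; apply/m1_close_cvg => k; exists k => // s [h _].
  by rewrite /= (hbB s).2.
have carr j T e : 0 < e -> \forall s \near F, forall t, 0 <= t <= T ->
    `|m1_coord j (arr s t) - alpha * t * m1_coord j nu| < e.
  move=> e0; have [n hn] := half_exp_lt e0.
  pose k := maxn n (maxn j (Num.truncn `|T|).+1).
  exists k => // s [_ h] t /andP[t0 tT]; apply: lt_trans hn.
  apply: lt_le_trans (half_exp_le R (leq_maxl n _)).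
  apply: h; first by rewrite !leq_max leqnn orbT.
  rewrite t0/= (le_trans tT)// (le_trans (ler_norm T))// (le_trans (ltW (truncnS_gt _)))//.
  by rewrite ler_nat !leq_max leqnn !orbT.
have [K _ hK] := fluid_limit alpha0 nu1 nu_atom xi_atom FF (fun s => (hbB s).1) cB carr m.
exists K => k Kk n w hw hA.
pose s : S := existT _ n w; have gs : good k s by split.
have [l tl hl] := hK s (good_le _ _ _ Kk gs).
by apply: hm; exists l => // t t0 tm; have [] := hl t t0 tm.
Qed.

End continuity.

Theorem theorem2p2 (R : realType) (r : nat -> R) (Q : nat -> gps_model R)
    (alpha : R) (nu : M1 R)
    (d0 : measure_display) (T0 : measurableType d0) (P0 : probability T0 R)
    (B0 : T0 -> M1 R)
    (Ebar : forall n, gps_space (Q n) -> skorohod R (M1 R))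
    (alpha_nu : skorohod R (M1 R)) :
  (forall n, 0 < r n) ->
  r @ \oo --> +oo ->
  0 < alpha ->
  nu setT = 1%E ->
  (forall x, nu [set x] = 0%E) ->
  first_moment nu = alpha^-1 ->
  (gps_rate (Q n) @[n --> \oo] --> alpha) ->
  (gps_nu (Q n) @[n --> \oo] --> nu) ->
  (first_moment (gps_nu (Q n)) @[n --> \oo] --> first_moment nu) ->
  (forall n w t, 0 <= t -> Ebar n w t = scaled_arrivals (r n) w t) ->
  (forall t, 0 <= t -> alpha_nu t = M1_scale (alpha * t) nu) ->
  cvg_in_distribution (fun n => gps_P (Q n)) Ebar P0 (fun=> alpha_nu) ->
  {ae P0, forall w, forall x, B0 w [set x] = 0%E} ->
  cvg_in_distribution (fun n => gps_P (Q n))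
    (fun n => @scaled_initial R (r n) (Q n)) P0 B0 ->
  ('E_(gps_P (Q n))[fun w => first_moment (scaled_initial (r n) w)]
     @[n --> \oo] --> 'E_P0[fun w => first_moment (B0 w)])%E ->
  exists (X : forall n, gps_space (Q n) -> skorohod R (M1 R) * skorohod R (M1 R))
         (sm : T0 -> skorohod R (M1 R) * skorohod R (M1 R)),
  [/\ forall n w t, 0 <= t ->
        (X n w).1 t = scaled_in_service (r n) w t /\
        (X n w).2 t = scaled_in_waiting (r n) w t,
      {ae P0, forall w, fluid_model_path alpha nu (B0 w) (sm w)}
    & cvg_in_distribution (fun n => gps_P (Q n)) X P0 sm].
Proof.
move=> r0 _ alpha0 _ nu_atom nu1 _ _ _ EbarE alpha_nuE cE B0_atom cb _.
exists (fun n => scaled_path (r0 n)), (fun w => fluid_path nu (B0 w) alpha0); split.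
- by [].
- by apply: aeW => w t t0.
have [rb rB _] := cb; have [rE _ wE] := cE.
apply: (@approximate_mapping _ _ _ _ _ _ _
  (fun k n w => arrival_gap alpha nu k (Ebar n w)) _ _ _ _ _ _ _ cb).
- by move=> n; exact: scaled_path_random.
- exact: fluid_path_random.
- by move=> k n; exact: random_element_continuous (rE n) (@arrival_gap_continuous R alpha nu alpha0 k).
- by move=> k n w; exact: arrival_gap01.
(* The gap is bounded and continuous, so its mean converges to its value at the deterministic limit
   [alpha_nu], which is 0. *)
- move=> k; have gC y : `|arrival_gap alpha nu k y| <= 1.
    by have /andP[h0 h1] := arrival_gap01 alpha nu k y; rewrite ger0_norm.
  have := wE _ (@arrival_gap_continuous R alpha nu alpha0 k) (ex_intro _ 1 gC).
  by rewrite arrival_gap_fluid// expectation_cst.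
apply: filterS B0_atom => w xi_atom O oO Ow.
have [K hK] := fluid_path_continuity nu1 nu_atom xi_atom Q r0 oO Ow.
exists K => k Kk n w' hb hG; apply: (hK k Kk n w' hb) => j t jk tk.
rewrite -EbarE; last by case/andP : tk.
exact: arrival_gap_lt1 hG _ _ _ _.
Qed.
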